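(* Let $M$ be a $2n$-dimensional symplectic manifold with symplectic form $\sigma$, let $\Delta\subset TM$ be a Lagrange distribution, and let $h\in C^\infty(M)$ be such that the Hamiltonian field $\vec h$ is complete and monotone with respect to $\Delta$ (at every point of $M$). Let $x_0\in M$. Assume that the semi-trajectory $\{e^{t\vec h}(x_0):t\ge 0\}$ has compact closure and that $\vec h$ has negative curvature with respect to $\Delta$ at each point of this closure. Then the limit $x_\infty=\lim_{t\to+\infty}e^{t\vec h}(x_0)$ exists in $M$, $\vec h(x_\infty)=0$, and the linearization $D_{x_\infty}\vec h:T_{x_\infty}M\to T_{x_\infty}M$ of $\vec h$ at the equilibrium $x_\infty$ is hyperbolic, i.e. has no eigenvalues on the imaginary axis.
   Context: All objects are $C^\infty$. A Lagrange distribution $\Delta\subset TM$ is a smooth vector subbundle each of whose fibers $\Delta_x=\Delta\cap T_xM$ is a Lagrangian subspace of $(T_xM,\sigma_x)$ (i.e. $\dim\Delta_x=n$ and $\sigma_x$ vanishes on $\Delta_x\times\Delta_x$). $\bar\Delta$ denotes the space of smooth sections of $\Delta$. For $h\in C^\infty(M)$, the Hamiltonian vector field $\vec h$ is defined by $dh=\sigma(\cdot,\vec h)$; $e^{t\vec h}$, $t\in\mathbb R$, denotes its flow. The Lie bracket is $[v_1,v_2]=v_1\circ v_2-v_2\circ v_1$ (vector fields acting as derivations). Regularity: $\vec h$ is regular at $x$ with respect to $\Delta$ if $\{[\vec h,v](x):v\in\bar\Delta\}=T_xM$. The form $g^h_x$: for $v_1,v_2\in\bar\Delta$ the number $\sigma([\vec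 h,v_1],v_2)(x)$ depends only on $v_1(x),v_2(x)$ and is symmetric in $v_1,v_2$; thus $g^h_x(v_1(x),v_2(x))=\sigma([\vec h,v_1],v_2)(x)$ defines a symmetric bilinear form on $\Delta_x$. It is nondegenerate if and only if $\vec h$ is regular at $x$. Monotonicity: a regular field $\vec h$ is monotone at $x$ with respect to $\Delta$ if $g^h_x$ is sign-definite (positive definite or negative definite). Curvature: for transversal $n$-dimensional subspaces $X_1,X_2\subset T_xM$, let $\pi_x(X_1,X_2):T_xM\to T_xM$ be the projector onto $X_2$ parallel to $X_1$ (so it is $0$ on $X_1$ and the identity on $X_2$). Put $J_x(t)=e^{-t\vec h}_*\Delta_{e^{t\vec h}(x)}\subset T_xM$, where $e^{-t\vec h}_*$ is the differential of $e^{-t\vec h}$. If $\vec h$ is regular, $J_x(t)$ and $J_x(\tau)$ are transversal for $t\neq\tau$ close to $0$, and there is a unique linear operator $R^h_x:\Delta_x\to\Delta_x$, self-adjoint with respect to $g^h_x$, such that $$\frac{\partial^2}{\partial t\,\partial\tau}\Bigl(\pi_x(J_x(\tau),J_x(t))\bigr|_{\Delta_x}\Bigr)\Bigr|_{\tau=0}=t^{-2}\mathbf 1+\tfrac13R^h_x+O(t)\quad\text{as } t\to0.$$ $R^h_x$ is the curvature operator and $r^h_x(\xi)=g^h_x(R^h_x\xi,\xi)$ is the curvature form of $\vec h$ at $x$ with respect to $\Delta$. (Normalization: for $M=\mathbb R^n\times\mathbb R^n$ with $\sigma=\sum dp_i\wedge dq_i$, $\Delta_{(p,q)}=(\mathbb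 R^n,0)$ and $h=\frac12|p|^2+U(q)$, one has $R^h_{(p,q)}=\frac{d^2U}{dq^2}$.) Negative curvature: $\vec h$ has negative curvature at $x$ if $r^h_x(\xi)\,g^h_x(\xi,\xi)<0$ for all $\xi\in\Delta_x\setminus\{0\}$. *)

(* Defs.v *)
From HB Require Import structures.
From mathcomp Require Import all_boot all_order all_algebra.
From mathcomp Require Import all_classical all_reals all_analysis.
From mathcomp Require Import complex.
Import Order.TTheory GRing.Theory Num.Theory numFieldNormedType.Exports.

Set Implicit Arguments.
Unset Strict Implicit.
Unset Printing Implicit Defensive.

Local Open Scope classical_set_scope.
Local Open Scope ring_scope.

(* For finite-dimensional V and open U this is the class C^k on U. *)
Fixpoint Ck (R : realType) (V W : normedModType R) (k : nat)
    (U : set V) (f : V -> W) : Prop :=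
  match k with
  | 0%N => forall x, U x -> {for x, continuous f}
  | k'.+1 => (forall x, U x -> differentiable f x) /\
             (forall v : V, Ck k' U (fun x => 'D_v f x))
  end.

Definition smooth_on (R : realType) (V W : normedModType R)
    (U : set V) (f : V -> W) : Prop := forall k, Ck k U f.

(* The maps are total; their values off [cdom] and off its image are junk. *)
Record chart (R : realType) (m : nat) (M : topologicalType) := Chart {
  cdom : set M;
  cmap : M -> 'rV[R]_m;
  cinv : 'rV[R]_m -> M;
  cdom_open : open cdom;
  cimg_open : open (cmap @` cdom);
  cmapK : forall x, cdom x -> cinv (cmap x) = x;
  cmap_cont : {within cdom, continuous cmap};
  cinv_cont : {within cmap @` cdom, continuous cinv} }.

(* A smooth atlas together with a preferred chart around each point: the
   tangent space T_xM is identified with R^m by means of [chart_at x], so that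
   tangent vectors at x, and linear maps and bilinear forms on T_xM, are plain
   vectors and matrices. *)
Record smooth_atlas (R : realType) (m : nat) (M : topologicalType) := Atlas {
  charts : set (chart R m M);
  chart_at : M -> chart R m M;
  chart_at_charts : forall x, charts (chart_at x);
  chart_at_dom : forall x, cdom (chart_at x) x;
  transition_smooth : forall c c', charts c -> charts c' ->
    smooth_on (cmap c @` (cdom c `&` cdom c')) (cmap c' \o cinv c) }.

Section Manifold.
Context {R : realType} {m : nat} {M : topologicalType}.
Variable A : smooth_atlas R m M.
Local Notation E := 'rV[R]_m.
Local Notation ch := (chart_at A).

(* The differential at x of a map into a normed space; for scalar f this is
   the derivative of f at x along the tangent vector u. *)
Definition mdiff (W : normedModType R) (f : M -> W) (x : M) (u : E) : W :=
  'd (f \o cinv (ch x)) (cmap (ch x) x) u.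

(* Components in c of a tangent vector at x; [tvect c x] is the inverse change
   of components, for x in the domain of c. *)
Definition tcoord (c : chart R m M) (x : M) (u : E) : E := mdiff (cmap c) x u.

Definition tvect (c : chart R m M) (x : M) (w : E) : E :=
  'd (cmap (ch x) \o cinv c) (cmap c x) w.

Definition tmap (f : M -> M) (x : M) (u : E) : E :=
  mdiff (cmap (ch (f x)) \o f) x u.

Definition smooth_fun (f : M -> R) : Prop :=
  forall c, charts A c -> smooth_on (cmap c @` cdom c) (f \o cinv c : E -> R).

Definition vf_in_chart (c : chart R m M) (v : M -> E) (y : E) : E :=
  tcoord c (cinv c y) (v (cinv c y)).

Definition smooth_vf_on (U : set M) (v : M -> E) : Prop :=
  forall c, charts A c -> smooth_on (cmap c @` (cdom c `&` U)) (vf_in_chart c v).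

(* The commutator v1 \o v2 - v2 \o v1 of derivations, evaluated on the
   coordinate functions of the preferred chart at x. *)
Definition lie_bracket (v1 v2 : M -> E) (x : M) : E :=
  \row_i let f := fun z : M => cmap (ch x) z 0 i : R in
    (mdiff (fun y => mdiff f y (v2 y)) x (v1 x)
     - mdiff (fun y => mdiff f y (v1 y)) x (v2 x)).

(* D_x v : T_xM -> T_xM at a zero x of v, as a matrix acting on row vectors. *)
Definition linearization (v : M -> E) (x : M) : 'M[R]_m :=
  'J (vf_in_chart (ch x) v) (cmap (ch x) x).

Definition hyperbolic (L : 'M[R]_m) : Prop :=
  forall z : R[i], eigenvalue (map_mx (real_complex R) L) z ->
    complex.Re z != 0.

(* The flow of a complete vector field v: a smooth action of (R, +) on M all of
   whose orbits are integral curves of v. *)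
Record is_flow (v : M -> E) (phi : R -> M -> M) : Prop := {
  flow0 : forall x, phi 0 x = x;
  flowD : forall s t x, phi (s + t) x = phi s (phi t x);
  flow_cont : continuous (fun p : R * M => phi p.1 p.2);
  flow_smooth : forall c c', charts A c -> charts A c' ->
    smooth_on
      [set p : R * E | (cmap c @` cdom c) p.2 /\
                       cdom c' (phi p.1 (cinv c p.2))]
      (fun p : R * E => cmap c' (phi p.1 (cinv c p.2)));
  flow_velocity : forall t x,
    is_derive t (1 : R) (fun s : R => cmap (ch (phi t x)) (phi s x)) (v (phi t x)) }.

Section Symplectic.
Variable sigma : M -> 'M[R]_m.

Definition form_at (x : M) (u w : E) : R := (u *m sigma x *m w^T) 0 0.

Definition form_in_chart (c : chart R m M) (y : E) : 'M[R]_m :=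
  let x := cinv c y in
  \matrix_(i, j) form_at x (tvect c x (delta_mx 0 i)) (tvect c x (delta_mx 0 j)).

Record symplectic : Prop := {
  symp_alt : forall x u, form_at x u u = 0;
  symp_nondeg : forall x u, (forall w, form_at x u w = 0) -> u = 0;
  symp_smooth : forall c, charts A c ->
    smooth_on (cmap c @` cdom c) (form_in_chart c);
  symp_closed : forall c, charts A c ->
    forall y, (cmap c @` cdom c) y -> forall i j k : 'I_m,
    let d a b e :=
      'D_(delta_mx 0 a : E) (fun z => form_in_chart c z b e : R) y in
    d i j k + d j k i + d k i j = 0 }.

Definition hamiltonian_field (h : M -> R) (X : M -> E) : Prop :=
  forall x u, mdiff h x u = form_at x u (X x).

Variable Delta : M -> {vspace E}.

Record lagrange_distribution (n : nat) : Prop := {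
  lagr_dim : forall x, (\dim (Delta x) = n)%N;
  lagr_isotropic : forall x u w,
    u \in Delta x -> w \in Delta x -> form_at x u w = 0;
  lagr_smooth : forall x, exists (U : set M) (v : 'I_n -> M -> E),
    [/\ open U, U x, forall i, smooth_vf_on U (v i)
      & forall y, U y -> Delta y = <<[seq v i y | i <- enum 'I_n]>>%VS] }.

Definition dsection (v : M -> E) : Prop :=
  smooth_vf_on setT v /\ forall x, v x \in Delta x.

Variable X : M -> E.

Definition regular_at (x : M) : Prop :=
  forall w : E, exists2 v, dsection v & lie_bracket X v x = w.

(* g_x(xi, eta): the common value of sigma([X, v1], v2)(x) over all sections
   v1, v2 of Delta through xi, eta; only meant for xi, eta in Delta x. *)
Definition gform (x : M) (xi eta : E) : R :=
  xget 0 [set r | exists v1 v2, [/\ dsection v1, dsection v2,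
    v1 x = xi, v2 x = eta & r = form_at x (lie_bracket X v1 x) (v2 x)]].

Definition monotone_at (x : M) : Prop :=
  regular_at x /\
  ((forall xi, xi \in Delta x -> xi != 0 -> 0 < gform x xi xi) \/
   (forall xi, xi \in Delta x -> xi != 0 -> gform x xi xi < 0)).

Variable phi : R -> M -> M.

Definition jacobi_curve (x : M) (t : R) : {vspace E} :=
  (linfun (tmap (phi (- t)) (phi t x)) @: Delta (phi t x))%VS.

(* [daddv_pi U V] projects onto its first argument along the second. *)
Definition proj_parallel (X1 X2 : {vspace E}) : 'End(E) := daddv_pi X2 X1.

(* The error term O(t) is measured in the operator norm on Delta x. *)
Definition is_curvature_operator (x : M) (C : 'End(subvs_of (Delta x))) : Prop :=
  (forall xi eta,
     gform x (vsval (C xi)) (vsval eta) = gform x (vsval xi) (vsval (C eta))) /\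
  exists K : R, \forall t \near 0^', forall xi : subvs_of (Delta x),
    `| derive1 (fun s : R => derive1 (fun tau : R =>
          proj_parallel (jacobi_curve x tau) (jacobi_curve x s) (vsval xi)) 0) t
       - (t ^- 2 *: vsval xi + 3^-1 *: vsval (C xi)) |
    <= K * `|t| * `|vsval xi|.

Definition curvature_operator (x : M) : 'End(subvs_of (Delta x)) :=
  xget 0 [set C | is_curvature_operator C].

Definition curvature_form (x : M) (xi : subvs_of (Delta x)) : R :=
  gform x (vsval (curvature_operator x xi)) (vsval xi).

Definition negative_curvature_at (x : M) : Prop :=
  forall xi : subvs_of (Delta x), xi != 0 ->
    curvature_form xi * gform x (vsval xi) (vsval xi) < 0.

End Symplectic.
End Manifold.

(* Main.v *)
(* The function kappa_y(w) = sup_(xi in Delta_y) 2 sigma(xi, w) - |g_y(xi, xi)|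
   on TM is a Lyapunov function.  Let w <> 0.  Since sigma is invariant under the
   flow, kappa at phi_s(y) of the transport of w is bounded from below by a function
   of s computed in the fixed space T_yM from a curve in the Jacobi curve J_y(s);
   for a suitable curve this bound is attained at s = 0 and its second derivative
   there is a nonnegative square minus a curvature term, hence positive when the
   curvature is negative.

   The flow transports X to itself, so along an orbit in the omega-limit set
   t |-> kappa(X) is bounded and touched from below at every t by strictly convex
   functions unless X = 0; such a function does not exist on R.  Hence X vanishes on
   the omega-limit set.  At an equilibrium, an eigenvalue i w with eigenvector a + i b
   makes kappa(a) + kappa(b) constant along the linearized flow, which is excluded in
   the same way, so the equilibrium is hyperbolic.  Hyperbolic equilibria are
   isolated zeros of X, and therefore the orbit converges. *)
Require Import Defs.
From HB Require Import structures.
From mathcomp Require Import all_boot all_order all_algebra.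
From mathcomp Require Import all_classical all_reals all_analysis.
From mathcomp Require Import complex ring lra.
Import Order.TTheory GRing.Theory Num.Theory numFieldNormedType.Exports.
Local Open Scope classical_set_scope.
Local Open Scope ring_scope.

Set Implicit Arguments.
Unset Strict Implicit.
Unset Printing Implicit Defensive.

(** * Limits and derivatives of matrix-valued functions *)

(** The second derivative of the Lyapunov function along the flow is never computed; it would
    involve derivatives of an inverse Gram matrix. A lower bound that is exact at s = 0 is enough,
    because only interior maxima, after subtraction of a linear function, have to be excluded. The
    curve behind the bound starts at the maximizer of the supremum, and its velocity is chosen so
    that the second derivative splits into a square and the curvature.

    The curvature is defined by an expansion of projectors, whereas that second derivative is
    expressed by a pulled-back frame e of [Delta], whose derivatives are pullbacks of iterated
    brackets with X. The link is the pairing of e(t) with e(0). It vanishes at t = 0 and is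
    invertible only for small t <> 0; comparing it with the Gram matrix of g up to order t^2 yields
    the curvature without expanding an inverse.

    Both signs of a definite g are treated at once by a factor eps = 1 or -1, which is locally
    constant. The frames consist of global sections of [Delta], since [gform] is defined through
    such sections. *)

Section MatrixLimits.
Context {R : realType} {T : Type} {F : set_system T} {FF : Filter F}.

Lemma cvg_mx m n (f : T -> 'M[R]_(m, n)) (a : 'M[R]_(m, n)) :
  (forall i j, f x i j @[x --> F] --> a i j) -> f x @[x --> F] --> a.
Proof.
move=> fa; apply/cvgrPdist_le => e e0; near=> x.
rewrite /Num.Def.normr/= mx_normrE (bigmax_le _ (ltW e0))//= => i _.
rewrite !mxE/=; move: i; near: x; apply: filter_forall => /= i.
exact: ((cvgrPdist_le _ _).1 (fa i.1 i.2)).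
Unshelve. all: by end_near. Qed.

Lemma cvg_mx_coord m n (f : T -> 'M[R]_(m, n)) (a : 'M[R]_(m, n)) i j :
  f x @[x --> F] --> a -> f x i j @[x --> F] --> a i j.
Proof.
move=> fa; exact: (cvg_comp f (fun M : 'M[R]_(m, n) => M i j) fa
  (@coord_continuous R m n i j a)).
Qed.

Lemma cvg_bigsum (W : normedModType R) (I : Type) (r : seq I) (P : pred I)
    (f : I -> T -> W) (a : I -> W) :
  (forall i, P i -> f i x @[x --> F] --> a i) ->
  \sum_(i <- r | P i) f i x @[x --> F] --> \sum_(i <- r | P i) a i.
Proof.
move=> h; elim: r => [|i r IH].
  by rewrite big_nil; under eq_fun do rewrite big_nil; exact: cvg_cst.
rewrite big_cons; under eq_fun do rewrite big_cons.
by case Pi: (P i) => //; apply: cvgD => //; exact: h.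
Qed.

Lemma cvg_bigprod (I : Type) (r : seq I) (P : pred I) (f : I -> T -> R) (a : I -> R) :
  (forall i, P i -> f i x @[x --> F] --> a i) ->
  \prod_(i <- r | P i) f i x @[x --> F] --> \prod_(i <- r | P i) a i.
Proof.
move=> h; elim: r => [|i r IH].
  by rewrite big_nil; under eq_fun do rewrite big_nil; exact: cvg_cst.
rewrite big_cons; under eq_fun do rewrite big_cons.
by case Pi: (P i) => //; apply: cvgM => //; exact: h.
Qed.

Lemma cvg_mulmx m n p (f : T -> 'M[R]_(m, n)) (g : T -> 'M[R]_(n, p))
    (a : 'M[R]_(m, n)) (b : 'M[R]_(n, p)) :
  f x @[x --> F] --> a -> g x @[x --> F] --> b ->
  f x *m g x @[x --> F] --> a *m b.
Proof.
move=> fa gb; apply: cvg_mx => i j.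
rewrite mxE; under eq_fun do rewrite mxE.
by apply: cvg_bigsum => k _; apply: cvgM; exact: cvg_mx_coord.
Qed.

Lemma cvg_addmx m n (f g : T -> 'M[R]_(m, n)) (a b : 'M[R]_(m, n)) :
  f x @[x --> F] --> a -> g x @[x --> F] --> b -> f x + g x @[x --> F] --> a + b.
Proof. exact: cvgD. Qed.

Lemma cvg_submx m n (f g : T -> 'M[R]_(m, n)) (a b : 'M[R]_(m, n)) :
  f x @[x --> F] --> a -> g x @[x --> F] --> b -> f x - g x @[x --> F] --> a - b.
Proof. exact: cvgB. Qed.

Lemma cvg_scalemx m n (f : T -> R) (g : T -> 'M[R]_(m, n)) (a : R) (b : 'M[R]_(m, n)) :
  f x @[x --> F] --> a -> g x @[x --> F] --> b -> f x *: g x @[x --> F] --> a *: b.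
Proof. exact: cvgZ. Qed.

Lemma cvg_cstmx m n (a : 'M[R]_(m, n)) : a @[x --> F] --> a.
Proof. exact: cvg_cst. Qed.

Lemma cvg_trmx m n (f : T -> 'M[R]_(m, n)) (a : 'M[R]_(m, n)) :
  f x @[x --> F] --> a -> (f x)^T @[x --> F] --> a^T.
Proof.
move=> fa; apply: cvg_mx => i j; rewrite mxE; under eq_fun do rewrite mxE.
exact: cvg_mx_coord.
Qed.

Lemma cvg_det n (f : T -> 'M[R]_n) (a : 'M[R]_n) :
  f x @[x --> F] --> a -> \det (f x) @[x --> F] --> \det a.
Proof.
move=> fa; rewrite /determinant; apply: cvg_bigsum => s _.
apply: cvgM; first exact: cvg_cst.
by apply: cvg_bigprod => i _; exact: cvg_mx_coord.
Qed.

Lemma cvg_unitmx n (f : T -> 'M[R]_n) (a : 'M[R]_n) : a \in unitmx ->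
  f x @[x --> F] --> a -> \forall x \near F, f x \in unitmx.
Proof.
move=> au fa.
have da : \det a != 0 by rewrite -unitfE -unitmxE.
have := cvg_det fa => /cvgrPdist_lt /(_ `|\det a|).
rewrite normr_gt0 => /(_ da); apply: filterS => x h.
rewrite unitmxE unitfE; apply/eqP => d0.
by move: h; rewrite d0 subr0 ltxx.
Qed.

Lemma cvg_invmx n (f : T -> 'M[R]_n) (a : 'M[R]_n) : a \in unitmx ->
  f x @[x --> F] --> a -> invmx (f x) @[x --> F] --> invmx a.
Proof.
move=> au fa.
have da : \det a != 0 by rewrite -unitfE -unitmxE.
have fu := cvg_unitmx au fa.
have -> : invmx a = (\det a)^-1 *: \adj a by rewrite /invmx au.
have h : (\det (f x))^-1 *: \adj (f x) @[x --> F] --> (\det a)^-1 *: \adj a.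
  apply: cvgZ; first by apply: cvgV => //; exact: cvg_det.
  apply: cvg_mx => i j; rewrite mxE; under eq_fun do rewrite mxE.
  apply: cvgM; first exact: cvg_cst.
  apply: cvg_det; apply: cvg_mx => k l.
  rewrite !mxE; under eq_fun do rewrite !mxE; exact: cvg_mx_coord.
(* [invmx] returns a singular matrix unchanged, so the adjugate formula for [invmx (f x)] holds only
   eventually. *)
apply: cvg_trans h; apply: near_eq_cvg; apply: filterS fu => x fxu.
by rewrite /invmx fxu.
Qed.

End MatrixLimits.
Arguments cvg_cstmx {R T F FF m n} a.

Lemma near_unitmx (R : realType) (T : topologicalType) n (f : T -> 'M[R]_n) (x : T) :
  {for x, continuous f} -> f x \in unitmx -> \forall y \near x, f y \in unitmx.
Proof. by move=> fa au; exact: (cvg_unitmx au fa). Qed.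

Section MatrixDerivatives.
Context {R : realType} {V : normedModType R}.

Lemma is_derive_mxP m n (M : V -> 'M[R]_(m, n)) (dM : 'M[R]_(m, n)) (x v : V) :
  is_derive x v M dM <-> forall i j, is_derive x v (fun y => M y i j) (dM i j).
Proof.
split=> [[dMx <-] i j|h].
  apply: DeriveDef; first exact: (derivable_mxP _ _ _).1.
  by rewrite derive_mx// mxE.
have dMx : derivable M x v by apply/derivable_mxP => i j; case: (h i j).
apply: DeriveDef => //; rewrite derive_mx//; apply/matrixP => i j; rewrite mxE.
by case: (h i j).
Qed.

Lemma is_derive_bigsum (W : normedModType R) (I : Type) (r : seq I) (P : pred I)
    (f : I -> V -> W) (df : I -> W) (x v : V) :
  (forall i, P i -> is_derive x v (f i) (df i)) ->
  is_derive x v (fun y => \sum_(i <- r | P i) f i y) (\sum_(i <- r | P i) df i).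
Proof.
move=> h; elim: r => [|i r IH].
  rewrite big_nil; under eq_fun do rewrite big_nil; exact: is_derive_cst.
rewrite big_cons; under eq_fun do rewrite big_cons.
case Pi: (P i) => //; exact: (is_deriveD (h i Pi) IH).
Qed.

Lemma is_derive_scale (W : normedModType R) (f : V -> R) (g : V -> W) df dg (x v : V) :
  is_derive x v f df -> is_derive x v g dg ->
  is_derive x v (fun y => f y *: g y) (f x *: dg + df *: g x).
Proof.
move=> [/cvg_ex[/= a fa] fda] [/cvg_ex[/= b gb] gdb].
have fE : a = df by rewrite -fda; apply/esym; exact: (cvg_lim (@norm_hausdorff _ _) fa).
have gE : b = dg by rewrite -gdb; apply/esym; exact: (cvg_lim (@norm_hausdorff _ _) gb).
subst a b.
have h : (h^-1 *: (f (h *: v + x) *: g (h *: v + x) - f x *: g x)) @[h --> 0^']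
    --> f x *: dg + df *: g x.
  (* A directional derivative gives continuity along the line x + h v only, which is all that the
     product rule needs. *)
  have dfc : f (h *: v + x) @[h --> 0^'] --> f x.
    have h1 : (h * (h^-1 *: (f (h *: v + x) - f x)) + f x) @[h --> 0^'] --> 0 * df + f x.
      apply: cvgD; last exact: cvg_cst.
      by apply: cvgM fa; exact: nbhs_dnbhs.
    rewrite mul0r add0r in h1; apply: cvg_trans h1; apply: near_eq_cvg.
    near=> h; rewrite /= /GRing.scale/= mulrA divff ?mul1r ?subrK//.
    by near: h; exact: nbhs_dnbhs_neq.
  have h2 : (f (h *: v + x) *: (h^-1 *: (g (h *: v + x) - g x)) +
      (h^-1 *: (f (h *: v + x) - f x)) *: g x) @[h --> 0^']
      --> f x *: dg + df *: g x.
    apply: cvgD; first exact: cvgZ.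
    by apply: cvgZ; [exact: fa|exact: cvg_cst].
  apply: cvg_trans h2; apply: near_eq_cvg; near=> h => /=.
  rewrite scalerA [f _ * _]mulrC -scalerA -scalerA -scalerDr; congr (_ *: _).
  by rewrite scalerBr scalerBl addrA subrK.
apply: DeriveDef; first by apply/cvg_ex; exists (f x *: dg + df *: g x).
exact: (cvg_lim (@norm_hausdorff _ _) h).
Unshelve. all: by end_near. Qed.

Lemma is_derive_add (W : normedModType R) (f g : V -> W) df dg (x v : V) :
  is_derive x v f df -> is_derive x v g dg ->
  is_derive x v (fun y => f y + g y) (df + dg).
Proof. exact: is_deriveD. Qed.

Lemma is_derive_sub (W : normedModType R) (f g : V -> W) df dg (x v : V) :
  is_derive x v f df -> is_derive x v g dg ->
  is_derive x v (fun y => f y - g y) (df - dg).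
Proof. exact: is_deriveB. Qed.

Lemma is_derive_opp (W : normedModType R) (f : V -> W) df (x v : V) :
  is_derive x v f df -> is_derive x v (fun y => - f y) (- df).
Proof. exact: is_deriveN. Qed.

Lemma is_derive_const (W : normedModType R) (a : W) (x v : V) :
  is_derive x v (fun=> a) 0.
Proof. exact: is_derive_cst. Qed.

Lemma is_derive_mul (f g : V -> R) df dg (x v : V) :
  is_derive x v f df -> is_derive x v g dg ->
  is_derive x v (fun y => f y * g y) (f x * dg + df * g x).
Proof. exact: is_derive_scale. Qed.

Lemma is_derive_mulmx m n p (M : V -> 'M[R]_(m, n)) (P : V -> 'M[R]_(n, p))
    dM dP (x v : V) :
  is_derive x v M dM -> is_derive x v P dP ->
  is_derive x v (fun y => M y *m P y) (dM *m P x + M x *m dP).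
Proof.
move=> /is_derive_mxP hM /is_derive_mxP hP; apply/is_derive_mxP => i j.
rewrite !mxE -big_split/=; under eq_fun do rewrite mxE.
apply: is_derive_bigsum => k _.
apply: (is_derive_eq (is_derive_scale (hM i k) (hP k j))).
by rewrite addrC.
Qed.

Lemma is_derive_trmx m n (M : V -> 'M[R]_(m, n)) dM (x v : V) :
  is_derive x v M dM -> is_derive x v (fun y => (M y)^T) dM^T.
Proof.
move=> /is_derive_mxP hM; apply/is_derive_mxP => i j.
rewrite mxE; under eq_fun do rewrite mxE; exact: hM.
Qed.

End MatrixDerivatives.

Lemma is_derive_continuous (R : realType) (W : normedModType R) (f : R -> W) (df : W) (t : R) :
  is_derive t (1 : R) f df -> {for t, continuous f}.
Proof. by case=> /derivable1_diffP /differentiable_continuous. Qed.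

(** The difference quotient is rewritten by N^-1 - M^-1 = - N^-1 (N - M) M^-1, and the continuity of
    the inverse then gives the limit. *)
Lemma is_derive_invmx (R : realType) n (M : R -> 'M[R]_n) (dM : 'M[R]_n) (t : R) :
  M t \in unitmx -> is_derive t (1 : R) M dM ->
  is_derive t (1 : R) (fun s => invmx (M s)) (- (invmx (M t) *m dM *m invmx (M t))).
Proof.
move=> Mu dMt; have Mc := is_derive_continuous dMt.
have Mic : invmx (M s) @[s --> t] --> invmx (M t) by exact: cvg_invmx.
case: (dMt) => /cvg_ex[/= a Ma] dE.
have aE : a = dM by rewrite -dE; apply/esym; exact: (cvg_lim (@norm_hausdorff _ _) Ma).
subst a.
have sc : h + t @[h --> (0 : R)^'] --> t.
  rewrite -[X in _ --> X]add0r; apply: cvgD; last exact: cvg_cst.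
  exact: nbhs_dnbhs.
have Mic' : invmx (M (h + t)) @[h --> (0 : R)^'] --> invmx (M t).
  exact: (cvg_comp (fun h => h + t) _ sc Mic).
have hlim : (h^-1 *: (invmx (M (h + t)) - invmx (M t))) @[h --> (0:R)^'] -->
    - (invmx (M t) *m dM *m invmx (M t)).
  have h1 : - (invmx (M (h + t)) *m (h^-1 *: (M (h *: (1:R) + t) - M t))
      *m invmx (M t)) @[h --> (0:R)^'] --> - (invmx (M t) *m dM *m invmx (M t)).
    apply: cvgN; apply: cvg_mulmx; last exact: cvg_cst.
    by apply: cvg_mulmx; [exact: Mic'|exact: Ma].
  apply: cvg_trans h1; apply: near_eq_cvg.
  have un : \forall h \near (0:R)^', M (h + t) \in unitmx.
    exact: (sc _ (near_unitmx Mc Mu)).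
  apply: filterS un => h Mhu.
  rewrite /= [h%:A](mulr1).
  rewrite -scalemxAr -scalemxAl -scalerN; congr (_ *: _).
  by rewrite mulmxBr mulmxBl mulVmx// mul1mx -mulmxA mulmxV// mulmx1 opprB.
apply: DeriveDef.
  apply/cvg_ex; eexists; apply: cvg_trans hlim; apply: near_eq_cvg.
  by near=> h; rewrite /= [h%:A](mulr1).
apply: cvg_lim => //; apply: cvg_trans hlim; apply: near_eq_cvg.
by near=> h; rewrite /= [h%:A](mulr1).
Unshelve. all: by end_near. Qed.

(** Serves to differentiate at t <> 0 a function that is known explicitly only off 0: the formula
    then holds in a whole neighbourhood of t. *)
Lemma near_dnbhs_near (R : realType) (P : R -> Prop) (x : R) :
  (\forall s \near x^', P s) -> \forall t \near x^', \forall s \near t, P s.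
Proof.
rewrite /dnbhs /within /= => h.
have h2 : \forall t \near x, nbhs t (fun s => s != x -> P s) by exact: (nbhs_interior h).
apply: filterS h2 => t ht tx.
have tn : nbhs t (fun s => s != x) by exact: (open_nbhs_nbhs (conj (open_neq (y := x)) tx)).
by apply: filterS2 ht tn => s; exact.
Qed.

Lemma is_derive_uniq (R : realType) (V W : normedModType R) (f : V -> W) (x v : V) a b :
  is_derive x v f a -> is_derive x v f b -> a = b.
Proof. by move=> [_ <-] [_ <-]. Qed.

(** * Taylor expansions and C^k maps *)

Section Peano.
Context {R : realType}.

Lemma primitive_littleo (g g1 : R -> R) k :
  (forall t, is_derive t (1 : R) g (g1 t)) -> g 0 = 0 ->
  t ^- k * g1 t @[t --> (0 : R)^'] --> (0 : R) ->
  t ^- k.+1 * g t @[t --> (0 : R)^'] --> (0 : R).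
Proof.
move=> dg g0 /cvgr0Pnorm_le hg; apply/cvgr0Pnorm_le => e e0.
have [d /= d0 hd] := hg e e0.
have gc : continuous g by move=> t; exact: is_derive_continuous (dg t).
have bnd c : c != 0 -> `|c| < d -> `|g1 c| <= e * `|c| ^+ k.
  move=> c0 cd; have := hd c; rewrite /ball_/= sub0r normrN => /(_ cd c0).
  by rewrite normrM normfV normrX mulrC ler_pdivrMr// exprn_gt0// normr_gt0.
near=> t.
have t0 : t != 0 by near: t; exact: nbhs_dnbhs_neq.
have td : `|t| < d by near: t; exact: dnbhs0_lt.
have [c [c0 ct gt]] : exists c, [/\ c != 0, `|c| <= `|t| & g t = g1 c * t].
  case: (ltgtP t 0) t0 => // tt0 _.
    have [|c] := @MVT R g g1 t 0 tt0 (fun x _ => dg x).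
      exact: continuous_subspaceT.
    rewrite in_itv/= => /andP[tc c0]; rewrite g0 !sub0r => gt; exists c.
    rewrite lt_eqF//; split => //; last by apply: oppr_inj; rewrite gt mulrN.
    by rewrite !ltr0_norm// lerN2 ltW.
  have [|c] := @MVT R g g1 0 t tt0 (fun x _ => dg x).
    exact: continuous_subspaceT.
  rewrite in_itv/= => /andP[c0 ct]; rewrite g0 !subr0 => gt; exists c.
  by rewrite gt_eqF//; split => //; rewrite !gtr0_norm// ltW.
rewrite normrM normfV normrX mulrC ler_pdivrMr ?exprn_gt0 ?normr_gt0//.
rewrite gt normrM exprSr mulrA ler_wpM2r//.
apply: le_trans (bnd c c0 (le_lt_trans ct td)) _.
by rewrite ler_wpM2l ?(ltW e0)// lerXn2r ?nnegrE.
Unshelve. all: by end_near. Qed.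

Lemma peano1 (f f1 : R -> R) :
  (forall t, is_derive t (1 : R) f (f1 t)) -> {for 0, continuous f1} ->
  t ^- 1 * (f t - (f 0 + t * f1 0)) @[t --> (0 : R)^'] --> (0 : R).
Proof.
move=> df fc; apply: (@primitive_littleo _ (fun t => f1 t - f1 0)).
- move=> t; have h := is_derive_sub (df t) (is_derive_add (is_derive_const (f 0) t (1:R))
    (is_derive_mul (is_derive_id t (1:R)) (is_derive_const (f1 0) t (1:R)))).
  by apply: (is_derive_eq h); rewrite mulr0 !add0r mul1r.
- by rewrite mul0r addr0 subrr.
- under eq_fun do rewrite expr0 invr1 mul1r.
  have h : (f1 t - f1 0) @[t --> (0 : R)^'] --> f1 0 - f1 0.
    apply: cvgB; last exact: cvg_cst.
    by apply: cvg_trans fc; apply: cvg_app; exact: nbhs_dnbhs.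
  by rewrite subrr in h.
Qed.

Lemma peano2 (f f1 f2 : R -> R) :
  (forall t, is_derive t (1 : R) f (f1 t)) ->
  (forall t, is_derive t (1 : R) f1 (f2 t)) -> {for 0, continuous f2} ->
  t ^- 2 * (f t - (f 0 + t * f1 0 + t ^+ 2 * (2^-1 * f2 0))) @[t --> (0 : R)^'] --> (0 : R).
Proof.
move=> df df1 fc.
apply: (@primitive_littleo _ (fun t => f1 t - (f1 0 + t * f2 0))).
- move=> t; have dX : is_derive t (1:R) (fun t : R => t ^+ 2) (2 * t).
    have h := is_derive_mul (is_derive_id t (1:R)) (is_derive_id t (1:R)).
    apply: (is_derive_eq h); rewrite /GRing.scale/=; ring.
  have h := is_derive_sub (df t) (is_derive_add (is_derive_add (is_derive_const (f 0) t (1:R))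
    (is_derive_mul (is_derive_id t (1:R)) (is_derive_const (f1 0) t (1:R))))
    (is_derive_mul dX (is_derive_const (2^-1 * f2 0) t (1:R)))).
  by apply: (is_derive_eq h); rewrite /cst /GRing.scale/= !mulr0; field.
- by rewrite mul0r expr0n/= mul0r !addr0 subrr.
- exact: peano1.
Qed.

Lemma peano3 (f f1 f2 f3 : R -> R) :
  (forall t, is_derive t (1 : R) f (f1 t)) ->
  (forall t, is_derive t (1 : R) f1 (f2 t)) ->
  (forall t, is_derive t (1 : R) f2 (f3 t)) -> {for 0, continuous f3} ->
  t ^- 3 * (f t - (f 0 + t * f1 0 + t ^+ 2 * (2^-1 * f2 0) + t ^+ 3 * (6^-1 * f3 0)))
  @[t --> (0 : R)^'] --> (0 : R).
Proof.
move=> df df1 df2 fc.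
apply: (@primitive_littleo _ (fun t => f1 t - (f1 0 + t * f2 0 + t ^+ 2 * (2^-1 * f3 0)))).
- move=> t; have dX : is_derive t (1:R) (fun t : R => t ^+ 2) (2 * t).
    have h := is_derive_mul (is_derive_id t (1:R)) (is_derive_id t (1:R)).
    apply: (is_derive_eq h); rewrite /GRing.scale/=; ring.
  have dX3 : is_derive t (1:R) (fun t : R => t ^+ 3) (3 * t ^+ 2).
    have h := is_derive_mul (is_derive_id t (1:R)) dX.
    apply: (is_derive_eq h); rewrite /GRing.scale/=; ring.
  have h := is_derive_sub (df t) (is_derive_add (is_derive_add (is_derive_add (is_derive_const (f 0) t (1:R))
    (is_derive_mul (is_derive_id t (1:R)) (is_derive_const (f1 0) t (1:R))))
    (is_derive_mul dX (is_derive_const (2^-1 * f2 0) t (1:R))))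
    (is_derive_mul dX3 (is_derive_const (6^-1 * f3 0) t (1:R)))).
  by apply: (is_derive_eq h); rewrite /cst /GRing.scale/= !mulr0; field.
- by rewrite mul0r !expr0n/= !mul0r !addr0 subrr.
- exact: peano2.
Qed.

Lemma peano2_mx m n (f f1 f2 : R -> 'M[R]_(m, n)) :
  (forall t, is_derive t (1 : R) f (f1 t)) ->
  (forall t, is_derive t (1 : R) f1 (f2 t)) -> {for 0, continuous f2} ->
  t ^- 2 *: (f t - (f 0 + t *: f1 0 + t ^+ 2 *: (2^-1 *: f2 0))) @[t --> (0 : R)^']
  --> (0 : 'M[R]_(m, n)).
Proof.
move=> df df1 fc; apply: cvg_mx => i j; rewrite mxE.
under eq_fun do rewrite !mxE.
apply: (@peano2 (fun t => f t i j) (fun t => f1 t i j) (fun t => f2 t i j)).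
- by move=> t; exact: (is_derive_mxP _ _ _ _).1.
- by move=> t; exact: (is_derive_mxP _ _ _ _).1.
- exact: (@cvg_mx_coord _ _ _ _ _ _ _ i j fc).
Qed.

Lemma peano3_mx m n (f f1 f2 f3 : R -> 'M[R]_(m, n)) :
  (forall t, is_derive t (1 : R) f (f1 t)) ->
  (forall t, is_derive t (1 : R) f1 (f2 t)) ->
  (forall t, is_derive t (1 : R) f2 (f3 t)) -> {for 0, continuous f3} ->
  t ^- 3 *: (f t - (f 0 + t *: f1 0 + t ^+ 2 *: (2^-1 *: f2 0)
    + t ^+ 3 *: (6^-1 *: f3 0))) @[t --> (0 : R)^'] --> (0 : 'M[R]_(m, n)).
Proof.
move=> df df1 df2 fc; apply: cvg_mx => i j; rewrite mxE.
under eq_fun do rewrite !mxE.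
apply: (@peano3 (fun t => f t i j) (fun t => f1 t i j) (fun t => f2 t i j)
  (fun t => f3 t i j)).
- by move=> t; exact: (is_derive_mxP _ _ _ _).1.
- by move=> t; exact: (is_derive_mxP _ _ _ _).1.
- by move=> t; exact: (is_derive_mxP _ _ _ _).1.
- exact: (@cvg_mx_coord _ _ _ _ _ _ _ i j fc).
Qed.

End Peano.

Lemma scale_is_bilinear (R : realType) (W : normedModType R) :
  bilinear_for
    (GRing.Scale.Law.clone _ _ *:%R _) (GRing.Scale.Law.clone _ _ *:%R _)
    (fun (a : R) (w : W) => a *: w).
Proof.
split=> [u'|u] a x y /=; first by rewrite scalerDl scalerA.
by rewrite scalerDr !scalerA mulrC.
Qed.

Lemma differentiable_scale_pair (R : realType) (W : normedModType R) (p : R * W) :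
  differentiable (fun q : R * W => q.1 *: q.2) p.
Proof.
pose sM := bilinear_isBilinear.Build R R W W _ _ (fun (a : R) (w : W) => a *: w)
  (@scale_is_bilinear R W).
pose s : {bilinear R -> W -> W} := HB.pack (fun (a : R) (w : W) => a *: w) sM.
apply: (differentiable_bilin (f := s)) => q; exact: scale_continuous.
Qed.

Section Smooth.
Context {R : realType} {V : normedModType R}.

Lemma is_derive_D (W : normedModType R) (f : V -> W) (x v : V) :
  differentiable f x -> is_derive x v f ('D_v f x).
Proof. by move=> fx; apply: DeriveDef => //; exact: diff_derivable. Qed.

Lemma is_derive_line (W : normedModType R) (f : V -> W) (x u : V) (a : R) d :
  is_derive (a *: u + x) u f d -> is_derive a (1 : R) (fun b => f (b *: u + x)) d.
Proof.
have E : (fun h : R => h^-1 *: ((f \o shift (a *: u + x)) (h *: u) - f (a *: u + x))) =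
  (fun h => h^-1 *: (((fun b => f (b *: u + x)) \o shift a) (h *: (1 : R)) -
     f (a *: u + x))).
  by apply/funext => h; rewrite /= [h%:A](mulr1) scalerDl addrA.
move=> [dr dv]; apply: DeriveDef; last by rewrite -dv /derive E.
by rewrite /derivable -E.
Qed.

Lemma near_eq_diff (W : normedModType R) (f g : V -> W) (x : V) :
  (\near x, f x = g x) -> differentiable f x ->
  differentiable g x /\ 'd g x = 'd f x :> (V -> W).
Proof.
move=> fg /diff_locallyP[cf fE]; have fgx := nbhs_singleton fg.
have gE : g \o shift x = cst (g x) + 'd f x +o_ (0:V) id.
  apply/eqaddoP => e e0; move/eqaddoP : fE => /(_ e e0) h.
  have fg' : \forall y \near (0 : V), f (y + x) = g (y + x).
    by move: fg; rewrite (near_shift 0 x)/=; apply: filterS => y; rewrite /= subr0.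
  by apply: filterS2 fg' h => y /= E; rewrite /GRing.add/= /cst E fgx.
have dE := diff_unique cf gE; split; last exact: dE.
by apply/diff_locallyP; rewrite dE.
Qed.

Lemma Ck_ext (W : normedModType R) k (U : set V) (f g : V -> W) :
  open U -> (forall x, U x -> f x = g x) -> Ck k U f -> Ck k U g.
Proof.
move=> oU; elim: k f g => [|k IH] f g fg.
  move=> fc x Ux; have nE : \near x, f x = g x.
    by apply: filterS (open_nbhs_nbhs (conj oU Ux)) => y; exact: fg.
  rewrite /prop_for /continuous_at -fg//.
  by apply: cvg_trans (fc x Ux); apply: near_eq_cvg; apply: filterS nE.
move=> [df dk]; split=> [x Ux|v].
  have nE : \near x, f x = g x.
    by apply: filterS (open_nbhs_nbhs (conj oU Ux)) => y; exact: fg.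
  by have [] := near_eq_diff nE (df x Ux).
apply: IH (dk v) => x Ux; apply: near_eq_derive.
by apply: filterS (open_nbhs_nbhs (conj oU Ux)) => y; exact: fg.
Qed.

Lemma CkW (W : normedModType R) k (U : set V) (f : V -> W) :
  Ck k.+1 U f -> Ck k U f.
Proof.
elim: k f => [|k IH] f [df dk].
  by move=> x Ux; apply: differentiable_continuous; exact: df.
by split => // v; exact: IH.
Qed.

Lemma Ck_subset (W : normedModType R) k (U U' : set V) (f : V -> W) :
  U' `<=` U -> Ck k U f -> Ck k U' f.
Proof.
move=> UU; elim: k f => [|k IH] f; first by move=> h x /UU; exact: h.
by move=> [df dk]; split => [x /UU|v]; [exact: df|exact: IH (dk v)].
Qed.

Lemma Ck_cst (W : normedModType R) k (U : set V) (a : W) : Ck k U (fun=> a).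
Proof.
elim: k a => [|k IH] a; first by move=> x _; exact: cvg_cst.
split=> [x _|v]; first exact: differentiable_cst.
under eq_fun do rewrite derive_cst; exact: IH.
Qed.

Lemma CkD (W : normedModType R) k (U : set V) (f g : V -> W) : open U ->
  Ck k U f -> Ck k U g -> Ck k U (fun x => f x + g x).
Proof.
move=> oU; elim: k f g => [|k IH] f g.
  by move=> fc gc x Ux; apply: cvgD; [exact: fc|exact: gc].
move=> [df fk] [dg gk]; split=> [x Ux|v].
  by apply: differentiableD; [exact: df|exact: dg].
apply: (Ck_ext oU _ (IH _ _ (fk v) (gk v))) => x Ux; apply/esym.
have h := is_derive_add (is_derive_D v (df x Ux)) (is_derive_D v (dg x Ux)).
exact: derive_val.
Qed.

Lemma CkN (W : normedModType R) k (U : set V) (f : V -> W) : open U ->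
  Ck k U f -> Ck k U (fun x => - f x).
Proof.
move=> oU; elim: k f => [|k IH] f.
  by move=> fc x Ux; apply: cvgN; exact: fc.
move=> [df fk]; split=> [x Ux|v].
  by apply: differentiableN; exact: df.
apply: (Ck_ext oU _ (IH _ (fk v))) => x Ux; apply/esym.
have h := is_derive_opp (is_derive_D v (df x Ux)).
exact: derive_val.
Qed.

Lemma Ck_bigsum (W : normedModType R) k (U : set V) (I : Type) (r : seq I)
    (f : I -> V -> W) : open U ->
  (forall i, Ck k U (f i)) -> Ck k U (fun x => \sum_(i <- r) f i x).
Proof.
move=> oU fk; elim: r => [|i r IH].
  by under eq_fun do rewrite big_nil; exact: Ck_cst.
by under eq_fun do rewrite big_cons; apply: CkD.
Qed.

Lemma differentiable_scale (W : normedModType R) (f : V -> R) (g : V -> W) (x : V) :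
  differentiable f x -> differentiable g x -> differentiable (fun y => f y *: g y) x.
Proof.
move=> df dg.
exact: (differentiable_comp (differentiable_pair df dg) (differentiable_scale_pair _)).
Qed.

Lemma Ck_scale (W : normedModType R) k (U : set V) (f : V -> R) (g : V -> W) : open U ->
  Ck k U f -> Ck k U g -> Ck k U (fun x => f x *: g x).
Proof.
move=> oU; elim: k f g => [|k IH] f g.
  by move=> fc gc x Ux; apply: cvgZ; [exact: fc|exact: gc].
move=> fk gk; have [df dfk] := fk; have [dg dgk] := gk; split=> [x Ux|v].
  by apply: differentiable_scale; [exact: df|exact: dg].
apply: (Ck_ext oU _ (CkD oU (IH _ _ (CkW fk) (dgk v)) (IH _ _ (dfk v) (CkW gk)))).
move=> x Ux; apply/esym.
have h := is_derive_scale (is_derive_D v (df x Ux)) (is_derive_D v (dg x Ux)).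
exact: derive_val.
Qed.

Lemma differentiable_mx_coord m n (f : V -> 'M[R]_(m, n)) (x : V) i j :
  differentiable f x -> differentiable (fun y => f y i j) x.
Proof.
move=> df; exact: (differentiable_comp df (differentiable_coord _ i j)).
Qed.

Lemma Ck_mx_coord k (U : set V) m n (f : V -> 'M[R]_(m, n)) i j : open U ->
  Ck k U f -> Ck k U (fun x => f x i j).
Proof.
move=> oU; elim: k f => [|k IH] f.
  by move=> fc x Ux; apply: cvg_mx_coord; exact: fc.
move=> [df fk]; split=> [x Ux|v]; first exact/differentiable_mx_coord/df.
apply: (Ck_ext oU _ (IH _ (fk v))) => x Ux.
by rewrite derive_mx ?mxE//; apply: diff_derivable; exact: df.
Qed.

End Smooth.

(** * Symmetry of second derivatives *)

Section Schwarz.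
Context {R : realType} {V : normedModType R}.

(** The mean value theorem is applied in direction u to a difference in direction v, then in
    direction v to ['D_u f]. The variables w and z, tied by equations, allow the lemma to be used
    with u and v exchanged while the left-hand side stays literally the same. *)
Lemma second_difference (U : set V) (f : V -> R) (x u v w : V) (s z : R) : 0 < s ->
  w = s *: u + s *: v -> z = f (s *: u + x) + f (s *: v + x) ->
  (forall a b, 0 <= a <= s -> 0 <= b <= s -> U (a *: u + b *: v + x)) ->
  Ck 2 U f -> exists a b, [/\ 0 <= a <= s, 0 <= b <= s &
    f (w + x) + f x - z = s ^+ 2 * 'D_v (fun y => 'D_u f y) (a *: u + b *: v + x)].
Proof.
move=> s0 -> -> Us [df ddf].
have s0s : 0 <= s <= s by apply/andP; split => //; exact: ltW.
have z0s : 0 <= (0 : R) <= s by apply/andP; split => //; exact: ltW.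
pose g a := f (a *: u + (s *: v + x)) - f (a *: u + x).
pose g1 a := 'D_u f (a *: u + (s *: v + x)) - 'D_u f (a *: u + x).
have dg a : 0 <= a <= s -> is_derive a (1:R) g (g1 a).
  move=> a0s; apply: is_derive_sub; apply: is_derive_line; apply: is_derive_D; apply: df.
    by rewrite addrA; exact: Us.
  by have := Us a 0 a0s z0s; rewrite scale0r addr0.
have [a a0s gE] : exists2 a, 0 <= a <= s & g s - g 0 = g1 a * (s - 0).
  have [||a] := @MVT R g g1 0 s s0.
  - by move=> a /[!in_itv]/= /andP[a0 ais]; apply: dg; rewrite !ltW.
  - apply: continuous_in_subspaceT => a /[!inE]/= /[!in_itv]/= a0s.
    exact: is_derive_continuous (dg a a0s).
  - by move=> /[!in_itv]/= /andP[a0 ais] E; exists a => //; rewrite !ltW.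
have [ddfa _] := ddf u.
pose k b := 'D_u f (b *: v + (a *: u + x)).
pose k1 b := 'D_v (fun y => 'D_u f y) (b *: v + (a *: u + x)).
have dk b : 0 <= b <= s -> is_derive b (1:R) k (k1 b).
  move=> b0s; apply: (is_derive_line (f := fun y => 'D_u f y)); apply: is_derive_D; apply: ddfa.
  by rewrite addrA [_ + a *: u]addrC; exact: Us.
have [b b0s kE] : exists2 b, 0 <= b <= s & k s - k 0 = k1 b * (s - 0).
  have [||b] := @MVT R k k1 0 s s0.
  - by move=> b /[!in_itv]/= /andP[a0 ais]; apply: dk; rewrite !ltW.
  - apply: continuous_in_subspaceT => b /[!inE]/= /[!in_itv]/= b0s.
    exact: is_derive_continuous (dk b b0s).
  - by move=> /[!in_itv]/= /andP[b0 bis] E; exists b => //; rewrite !ltW.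
exists a, b; split => //.
have -> : f (s *: u + s *: v + x) + f x - (f (s *: u + x) + f (s *: v + x)) = g s - g 0.
  by rewrite /g scale0r !add0r addrA; ring.
rewrite gE /g1 !subr0.
have -> : 'D_u f (a *: u + (s *: v + x)) - 'D_u f (a *: u + x) = k s - k 0.
  by rewrite /k scale0r add0r addrCA.
by rewrite kE /k1 subr0 expr2 [b *: v + _]addrCA addrA mulrC -mulrA [_ * s]mulrC mulrA.
Qed.

Lemma eq_of_near_coincidences (F G : V -> R) (x : V) :
  {for x, continuous F} -> {for x, continuous G} ->
  (forall d, 0 < d -> exists y z, [/\ ball x d y, ball x d z & F y = G z]) -> F x = G x.
Proof.
move=> cF cG h.
apply/eqP; rewrite -subr_eq0 -normr_le0 leNgt; apply/negP => n0.
pose e := `|F x - G x| / 2; have e0 : 0 < e by rewrite divr_gt0.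
have /nbhs_ballP[d /= d0 hd] : nbhs x [set y | `|F x - F y| < e /\ `|G x - G y| < e].
  have /cvgrPdist_lt/(_ e e0) cF' : F y @[y --> x] --> F x by exact: cF.
  have /cvgrPdist_lt/(_ e e0) cG' : G y @[y --> x] --> G x by exact: cG.
  by near=> y; split; near: y.
have [y [z [/hd[h1 _] /hd[_ h2] E]]] := h d d0.
have : `|F x - G x| < e + e.
  rewrite -(subrK (G z) (F x)) -addrA (le_lt_trans (ler_normD _ _))// ltrD//.
    by rewrite -E.
  by rewrite distrC.
by rewrite /e -splitr ltxx.
Unshelve. all: by end_near. Qed.

(** The second difference over a small parallelogram is s^2 times either mixed derivative, each
    taken at some point of the parallelogram. As both mixed derivatives are continuous at x, they
    agree there. *)
Lemma schwarz (U : set V) (f : V -> R) (x u v : V) : open U -> U x -> Ck 2 U f ->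
  'D_v (fun y => 'D_u f y) x = 'D_u (fun y => 'D_v f y) x.
Proof.
move=> oU Ux fk; have [df ddf] := fk.
apply: (@eq_of_near_coincidences (fun y => 'D_v (fun y => 'D_u f y) y)
  (fun y => 'D_u (fun y => 'D_v f y) y)).
- by have [_ /(_ v)] := ddf u; apply.
- by have [_ /(_ u)] := ddf v; apply.
move=> d' d'0; have /nbhs_ballP[d'' /= d''0 hd] := open_nbhs_nbhs (conj oU Ux).
pose d := Num.min d' d''; have d0 : 0 < d by rewrite lt_min d'0.
(* This makes s (|u| + |v| + 1) = d / 2, so that the parallelogram of side s lies in the ball of
   radius d. *)
pose s := d / 2 / (`|u| + `|v| + 1).
have p0 : 0 < `|u| + `|v| + 1 by rewrite ltr_wpDl// addr_ge0.
have s0 : 0 < s by rewrite !divr_gt0.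
have bnd a b : 0 <= a <= s -> 0 <= b <= s -> ball x d (a *: u + b *: v + x).
  move=> /andP[a0 ais] /andP[b0 bis]; rewrite -ball_normE /ball_/= opprD addrCA subrr addr0.
  rewrite normrN; apply: (@le_lt_trans _ _ (s * (`|u| + `|v| + 1))).
    rewrite (le_trans (ler_normD _ _))// !normrZ !ger0_norm//.
    have -> : s * (`|u| + `|v| + 1) = s * `|u| + s * `|v| + s by ring.
    by apply: ler_wpDr; [exact: ltW|apply: lerD; exact: ler_wpM2r].
  by rewrite /s divfK ?gt_eqF// ltr_pdivrMr// ltr_pMr// ltr1n.
clearbody s; have bnd1 y : ball x d y -> ball x d' y by apply: le_ball; rewrite ge_min lexx.
have bnd2 y : ball x d y -> U y.
  by move=> h; apply: hd; apply: le_ball h; rewrite ge_min lexx orbT.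
have [|a [b [a0s b0s E1]]] := @second_difference U f x u v (s *: u + s *: v) s _ s0 erefl erefl _ fk.
  by move=> a b ha hb; apply: bnd2; exact: bnd.
have [|a' [b' [a0s' b0s' E2]]] := @second_difference U f x v u (s *: u + s *: v) s
  (f (s *: u + x) + f (s *: v + x)) s0 (addrC _ _) (addrC _ _) _ fk.
  by move=> a' b' ha hb; apply: bnd2; rewrite [_ *: v + _]addrC; exact: bnd.
exists (a *: u + b *: v + x), (a' *: v + b' *: u + x); split.
- by apply: bnd1; exact: bnd.
- by apply: bnd1; rewrite [_ *: v + _]addrC; exact: bnd.
apply: (@mulfI _ (s ^+ 2)); first by rewrite expf_eq0/= gt_eqF.
exact: (etrans (esym E1) E2).
Qed.

Lemma derive_mx_coord m n (f : V -> 'M[R]_(m, n)) (x v : V) i j :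
  derivable f x v -> 'D_v f x i j = 'D_v (fun y => f y i j) x.
Proof. by move=> df; rewrite derive_mx ?mxE. Qed.

Lemma derive_swap_mx_coord m n (U : set V) (f : V -> 'M[R]_(m, n)) (x u v : V) i j :
  open U -> U x -> Ck 2 U f ->
  'D_v (fun y => 'D_u f y) x i j = 'D_v (fun y => 'D_u (fun z => f z i j) y) x.
Proof.
move=> oU Ux [df ddf]; rewrite derive_mx_coord; last first.
  by apply: diff_derivable; case: (ddf u) => + _; exact.
apply: near_eq_derive; apply: filterS (open_nbhs_nbhs (conj oU Ux)) => y Uy.
by rewrite derive_mx_coord//; apply: diff_derivable; exact: df.
Qed.

Lemma schwarz_mx m n (U : set V) (f : V -> 'M[R]_(m, n)) (x u v : V) :
  open U -> U x -> Ck 2 U f ->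
  'D_v (fun y => 'D_u f y) x = 'D_u (fun y => 'D_v f y) x.
Proof.
move=> oU Ux fk; apply/matrixP => i j.
apply: (etrans (derive_swap_mx_coord u v i j oU Ux fk)).
apply: (etrans _ (esym (derive_swap_mx_coord v u i j oU Ux fk))).
exact: (schwarz u v oU Ux (Ck_mx_coord i j oU fk)).
Qed.

End Schwarz.

(** * Curves of Lagrangian subspaces *)

(** [form_at sigma x] is convertible to [bf (sigma x)]; rectangular matrices cover pairings of
    vectors written in two different frames. *)
Definition bf {R : realType} {m n} (M : 'M[R]_(m, n)) (p : 'rV[R]_m) (q : 'rV[R]_n) : R :=
  (p *m M *m q^T) 0 0.

Section BilinearForm.
Context {R : realType}.
Implicit Types m n k : nat.

Lemma bfDl m n (M : 'M[R]_(m, n)) p p' q : bf M (p + p') q = bf M p q + bf M p' q.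
Proof. by rewrite /bf !mulmxDl mxE. Qed.

Lemma bfDr m n (M : 'M[R]_(m, n)) p q q' : bf M p (q + q') = bf M p q + bf M p q'.
Proof. by rewrite /bf linearD mulmxDr mxE. Qed.

Lemma bfDm m n (M M' : 'M[R]_(m, n)) p q : bf (M + M') p q = bf M p q + bf M' p q.
Proof. by rewrite /bf mulmxDr mulmxDl mxE. Qed.

Lemma bfNl m n (M : 'M[R]_(m, n)) p q : bf M (- p) q = - bf M p q.
Proof. by rewrite /bf !mulNmx mxE. Qed.

Lemma bfNr m n (M : 'M[R]_(m, n)) p q : bf M p (- q) = - bf M p q.
Proof. by rewrite /bf linearN mulmxN mxE. Qed.

Lemma bfNm m n (M : 'M[R]_(m, n)) p q : bf (- M) p q = - bf M p q.
Proof. by rewrite /bf mulmxN mulNmx mxE. Qed.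

Lemma bfZl m n (M : 'M[R]_(m, n)) a p q : bf M (a *: p) q = a * bf M p q.
Proof. by rewrite /bf -!scalemxAl mxE. Qed.

Lemma bfZr m n (M : 'M[R]_(m, n)) a p q : bf M p (a *: q) = a * bf M p q.
Proof. by rewrite /bf linearZ -scalemxAr mxE. Qed.

Lemma bfZm m n (M : 'M[R]_(m, n)) a p q : bf (a *: M) p q = a * bf M p q.
Proof. by rewrite /bf -scalemxAr -scalemxAl mxE. Qed.

Lemma bf0l m n (M : 'M[R]_(m, n)) q : bf M 0 q = 0.
Proof. by rewrite /bf !mul0mx mxE. Qed.

Lemma bf0r m n (M : 'M[R]_(m, n)) p : bf M p 0 = 0.
Proof. by rewrite /bf trmx0 mulmx0 mxE. Qed.

Lemma bf0m m n p q : bf (0 : 'M[R]_(m, n)) p q = 0.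
Proof. by rewrite /bf mulmx0 mul0mx mxE. Qed.

Lemma bfT m n (M : 'M[R]_(m, n)) p q : bf M^T p q = bf M q p.
Proof.
rewrite /bf; transitivity ((p *m M^T *m q^T)^T 0 0); first by rewrite [RHS]mxE.
by rewrite !trmx_mul !trmxK mulmxA.
Qed.

Lemma bf_mull m n k (M : 'M[R]_(m, n)) (B : 'M[R]_(k, m)) p q :
  bf M (p *m B) q = bf (B *m M) p q.
Proof. by rewrite /bf !mulmxA. Qed.

Lemma bf_mulr m n k (M : 'M[R]_(m, n)) (B : 'M[R]_(k, n)) p q :
  bf M p (q *m B) = bf (M *m B^T) p q.
Proof. by rewrite /bf trmx_mul !mulmxA. Qed.

Lemma bf_suml m n (M : 'M[R]_(m, n)) (I : Type) (r : seq I) (P : pred I) F q :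
  bf M (\sum_(i <- r | P i) F i) q = \sum_(i <- r | P i) bf M (F i) q.
Proof. by rewrite /bf !mulmx_suml summxE. Qed.

Lemma bf_sumr m n (M : 'M[R]_(m, n)) (I : Type) (r : seq I) (P : pred I) F p :
  bf M p (\sum_(i <- r | P i) F i) = \sum_(i <- r | P i) bf M p (F i).
Proof. by rewrite /bf linear_sum mulmx_sumr summxE. Qed.

Lemma bf_rows m n k l (M : 'M[R]_(m, n)) (B : 'M[R]_(k, m)) (C : 'M[R]_(l, n)) i j :
  (B *m M *m C^T) i j = bf M (row i B) (row j C).
Proof. rewrite /bf -row_mul tr_row [LHS]mxE [RHS]mxE; apply: eq_bigr => a _.
by congr (_ * _); rewrite [RHS]mxE. Qed.

Lemma is_derive_bf (V : normedModType R) m n (M : 'M[R]_(m, n)) (f : V -> 'rV[R]_m)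
    (g : V -> 'rV[R]_n) df dg (x v : V) :
  is_derive x v f df -> is_derive x v g dg ->
  is_derive x v (fun y => bf M (f y) (g y)) (bf M df (g x) + bf M (f x) dg).
Proof.
move=> hf hg; have hM := is_derive_const M x v.
have h := is_derive_mulmx (is_derive_mulmx hf hM) (is_derive_trmx hg).
move/is_derive_mxP: h => /(_ 0 0) h; apply: (is_derive_eq h).
by rewrite mulmx0 addr0 mxE.
Qed.

Lemma is_derive_bf_mx (V : normedModType R) m n (M : V -> 'M[R]_(m, n)) (f : V -> 'rV[R]_m)
    (g : V -> 'rV[R]_n) dM df dg (x v : V) :
  is_derive x v M dM -> is_derive x v f df -> is_derive x v g dg ->
  is_derive x v (fun y => bf (M y) (f y) (g y))
    (bf (M x) df (g x) + bf dM (f x) (g x) + bf (M x) (f x) dg).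
Proof.
move=> hM hf hg.
have h := is_derive_mulmx (is_derive_mulmx hf hM) (is_derive_trmx hg).
move/is_derive_mxP: h => /(_ 0 0) h; apply: (is_derive_eq h).
by rewrite mulmxDl mxE [X in X + _ = _]mxE.
Qed.

End BilinearForm.

(** The orthogonal complement of the row space of e has dimension 2n - n = n and contains that row
    space, so the two coincide. *)
Lemma lagrangian_maximal (R : realType) (n : nat) (Om : 'M[R]_(2 * n))
    (e : 'M[R]_(n, 2 * n)) (w : 'rV[R]_(2 * n)) :
  Om \in unitmx -> row_free e -> e *m Om *m e^T = 0 -> w *m Om *m e^T = 0 ->
  exists p, w = p *m e.
Proof.
move=> Ou ef eO wO; apply/submxP.
have rk : \rank (kermx (Om *m e^T)) = n.
  rewrite mxrank_ker -mxrank_tr trmx_mul trmxK mxrankMfree ?row_free_unit ?unitmx_tr//.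
  by rewrite (eqP ef) mul2n -addnn addnK.
have ek : (e <= kermx (Om *m e^T))%MS by apply/sub_kermxP; rewrite mulmxA.
have : (e == kermx (Om *m e^T))%MS by rewrite -(geq_leqif (mxrank_leqif_eq ek)) rk (eqP ef).
by move=> /andP[_ /(submx_trans _)]; apply; apply/sub_kermxP; rewrite mulmxA.
Qed.

Lemma daddv_piE (K : fieldType) (vT : vectType K) (U V : {vspace vT}) (a b : vT) :
  (U :&: V = 0)%VS -> a \in U -> b \in V -> daddv_pi U V (a + b) = a.
Proof.
move=> UV aU bV; rewrite linearD/= daddv_pi_id//.
have VU : (V :&: U = 0)%VS by rewrite capvC.
have := daddv_pi_add VU (subvP (addvSl V U) b bV).
rewrite daddv_pi_id// => /(congr1 (fun z => z - b)); rewrite addrAC subrr add0r => ->.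
by rewrite addr0.
Qed.

(** * Expansion of a moving Lagrangian frame, its curvature, and the convex trial function *)

Section LagrangianCurve.
Context {R : realType} {n : nat}.
Local Notation N := (2 * n)%N.
Variables (Om : 'M[R]_N) (e e1 e2 e3 : R -> 'M[R]_(n, N)).
Hypothesis OmT : Om^T = - Om.
Hypothesis de : forall t, is_derive t (1 : R) e (e1 t).
Hypothesis de1 : forall t, is_derive t (1 : R) e1 (e2 t).
Hypothesis de2 : forall t, is_derive t (1 : R) e2 (e3 t).
Hypothesis ce3 : {for 0, continuous e3}.
Hypothesis isoe : forall t, e t *m Om *m (e t)^T = 0.

Let omT p q (a : 'M[R]_(p, N)) (b : 'M[R]_(q, N)) :
  (a *m Om *m b^T)^T = - (b *m Om *m a^T).
Proof. by rewrite !trmx_mul trmxK OmT mulNmx mulmxN mulmxA. Qed.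

Let isoL p (q : 'M[R]_(p, n)) t : q *m e t *m Om *m (e t)^T = 0.
Proof. by have := congr1 (mulmx q) (isoe t); rewrite mulmx0 !mulmxA. Qed.

Let dom p q (a da : R -> 'M[R]_(p, N)) (b db : R -> 'M[R]_(q, N)) t :
  is_derive t (1 : R) a (da t) -> is_derive t (1 : R) b (db t) ->
  is_derive t (1 : R) (fun s => a s *m Om *m (b s)^T)
    (da t *m Om *m (b t)^T + a t *m Om *m (db t)^T).
Proof.
move=> ha hb; have hM := is_derive_const Om t (1 : R).
have h := is_derive_mulmx (is_derive_mulmx ha hM) (is_derive_trmx hb).
by apply: (is_derive_eq h); rewrite mulmx0 addr0.
Qed.

(** For the pulled-back frame of sections of [Delta], e1 consists of pulled-back brackets with X,
    and this is the Gram matrix of g at the point reached at time t. *)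
Definition speed_gram t := e1 t *m Om *m (e t)^T.
Local Notation G := speed_gram.

(** Differentiating the isotropy relation e Om e^T = 0 gives G - G^T = 0. *)
Lemma speed_gram_sym t : (G t)^T = G t.
Proof.
have h := dom (de t) (de t).
have h0 : is_derive t (1 : R) (fun s => e s *m Om *m (e s)^T) 0.
  by under eq_fun do rewrite isoe; exact: is_derive_const.
have /eqP := is_derive_uniq h h0.
by rewrite addr_eq0 => /eqP E; rewrite /G omT -E.
Qed.

Lemma speed_gramN t : e t *m Om *m (e1 t)^T = - G t.
Proof. by rewrite -[LHS]opprK -omT (speed_gram_sym t). Qed.

Let G1 t := e2 t *m Om *m (e t)^T + e1 t *m Om *m (e1 t)^T.
Let G2 t := e3 t *m Om *m (e t)^T + e2 t *m Om *m (e1 t)^T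
  + (e2 t *m Om *m (e1 t)^T + e1 t *m Om *m (e2 t)^T).

Let dG t : is_derive t (1 : R) G (G1 t).
Proof. exact: dom (de1 t) (de t). Qed.

Let dG1 t : is_derive t (1 : R) G1 (G2 t).
Proof.
exact: is_derive_add (dom (de2 t) (de t)) (dom (de1 t) (de1 t)).
Qed.

Let G1_sym t : (G1 t)^T = G1 t.
Proof.
apply: (@is_derive_uniq _ _ _ (fun s => (G s)^T) t 1); first exact: is_derive_trmx (dG t).
by under eq_fun do rewrite speed_gram_sym; exact: dG.
Qed.

(** The pairings at time 0 out of which the expansions of G to order 2 and of [Lam] to order 3 are
    built; the remaining pairings follow from these four by the symmetry of G and of its
    derivative. *)
Definition gramA := G 0.
Definition gramH := e2 0 *m Om *m (e 0)^T.
Definition gramK := e3 0 *m Om *m (e 0)^T.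
Definition gramZ := e2 0 *m Om *m (e1 0)^T.
Local Notation A := gramA.
Local Notation H := gramH.
Local Notation K := gramK.
Local Notation Z := gramZ.

Lemma gramA_sym : A^T = A. Proof. exact: speed_gram_sym. Qed.

(** The derivative of G at 0 is H + W with W the left-hand side; it is symmetric and W is
    antisymmetric, so H + W = H^T - W. *)
Lemma gramW : e1 0 *m Om *m (e1 0)^T = 2^-1 *: (H^T - H).
Proof.
have W := omT (e1 0) (e1 0); have := G1_sym 0; rewrite /G1 linearD/= W.
rewrite -/H => E; apply/matrixP => i j; move/matrixP: E => /(_ i j).
by rewrite !mxE => E; lra.
Qed.

Lemma gramG1 : G1 0 = 2^-1 *: (H + H^T).
Proof.
rewrite /G1 gramW -/H; apply/matrixP => i j; rewrite !mxE; lra.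
Qed.

Let G2E : G2 0 = K + 2 *: Z - Z^T.
Proof.
have E : e1 0 *m Om *m (e2 0)^T = - Z^T by rewrite /Z omT opprK.
rewrite /G2 E -/K -/Z; apply/matrixP => i j; rewrite !mxE; lra.
Qed.

Hypothesis Au : A \in unitmx.

Let AiT : (invmx A)^T = invmx A.
Proof. by rewrite trmx_inv gramA_sym. Qed.

(** Pairing of the subspace at time t with the one at time 0. Its invertibility expresses
    transversality; it vanishes at t = 0, with derivative A. *)
Let Lam t := e t *m Om *m (e 0)^T.

Lemma cvg_dnbhs_cont (W : normedModType R) (f : R -> W) :
  {for 0, continuous f} -> f t @[t --> (0 : R)^'] --> f 0.
Proof. by move=> fc; apply: cvg_trans fc; apply: cvg_app; exact: nbhs_dnbhs. Qed.

Let Lam_expand : exists2 r : R -> 'M[R]_n, r t @[t --> (0 : R)^'] --> (0 : 'M[R]_n) &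
  forall t, t != 0 -> Lam t = t *: (A + t *: (2^-1 *: H + t *: (6^-1 *: K + r t))).
Proof.
pose L1 t := e1 t *m Om *m (e 0)^T; pose L2 t := e2 t *m Om *m (e 0)^T.
pose L3 t := e3 t *m Om *m (e 0)^T.
have d0 t := is_derive_const (e 0) t (1 : R).
have dL (a b : R -> 'M[R]_(n, N)) t : is_derive t (1 : R) a (b t) ->
    is_derive t (1:R) (fun s => a s *m Om *m (e 0)^T) (b t *m Om *m (e 0)^T).
  move=> h; have := @dom _ _ _ _ (fun=> e 0) (fun=> 0) t h (d0 t).
  by rewrite trmx0 mulmx0 addr0.
have cL3 : {for 0, continuous L3}.
  by apply: cvg_mulmx; [apply: cvg_mulmx => //; exact: cvg_cst|exact: cvg_cst].
have := peano3_mx (fun t => dL _ _ t (de t)) (fun t => dL _ _ t (de1 t))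
  (fun t => dL _ _ t (de2 t)) cL3.
set r := (X in X @ _ --> _) => rc; exists r => // t t0.
rewrite /r isoe -/(speed_gram 0) -/A -/H -/K -/(Lam t) add0r.
apply/matrixP => i j; rewrite !mxE; field.
by rewrite t0.
Qed.

Let G_expand : exists2 r : R -> 'M[R]_n, r t @[t --> (0 : R)^'] --> (0 : 'M[R]_n) &
  forall t, t != 0 -> G t = A + t *: (G1 0 + t *: (2^-1 *: G2 0 + r t)).
Proof.
have cG2 : {for 0, continuous G2}.
  have c0 := is_derive_continuous (de 0); have c1 := is_derive_continuous (de1 0).
  have c2 := is_derive_continuous (de2 0).
  have co (a b : R -> 'M[R]_(n, N)) : {for 0, continuous a} -> {for 0, continuous b} ->
      {for 0, continuous (fun t => a t *m Om *m (b t)^T)}.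
    move=> ca cb; apply: cvg_mulmx; first by apply: cvg_mulmx => //; exact: cvg_cst.
    exact: cvg_trmx.
  by apply: cvgD; apply: cvgD; exact: co.
have := peano2_mx dG dG1 cG2.
set r := (X in X @ _ --> _) => rc; exists r => // t t0.
rewrite /r -/A; apply/matrixP => i j; rewrite !mxE; field.
by rewrite t0.
Qed.

(* For e = (1, S(t)) this is, up to sign, (S''' - 3/2 S'' S'^-1 S'') / 6, a matrix
   Schwarzian derivative; it turns out to be one third of the curvature form. *)
Definition schwarzian : 'M[R]_n :=
  2^-1 *: (K + 2 *: Z - Z^T) - (6^-1 *: (K + K^T) + 4^-1 *: (H *m invmx A *m H^T)).

(** The orders 0 and 1 in t cancel, the latter because the derivative of G at 0 is (H + H^T) / 2,
    twice the symmetric part of the second Taylor coefficient of [Lam]. The coefficient of t^2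
    remains. *)
Lemma schwarzian_limit :
  t ^- 2 *: (G t - (t^-1 *: Lam t) *m invmx A *m (t^-1 *: Lam t)^T) @[t --> (0 : R)^'] -->
  schwarzian.
Proof.
rewrite /schwarzian; have [r rc LE] := Lam_expand; have [r' rc' GE] := G_expand.
pose Nt t := 6^-1 *: K + r t; pose M t := 2^-1 *: H + t *: Nt t.
have t0 : t @[t --> (0 : R)^'] --> (0 : R) by exact: nbhs_dnbhs.
have Nc : Nt t @[t --> (0 : R)^'] --> 6^-1 *: K.
  rewrite -(addr0 (6^-1 *: K)).
  exact: (cvg_addmx (cvg_cstmx (6^-1 *: K)) rc).
have Mc : M t @[t --> (0 : R)^'] --> 2^-1 *: H.
  have : M t @[t --> (0 : R)^'] --> 2^-1 *: H + 0 *: (6^-1 *: K).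
    exact: (cvg_addmx (cvg_cstmx (2^-1 *: H)) (cvg_scalemx t0 Nc)).
  by rewrite scale0r addr0.
have lim : 2^-1 *: G2 0 + r' t - (Nt t + (Nt t)^T + M t *m invmx A *m (M t)^T)
   @[t --> (0 : R)^'] --> 2^-1 *: G2 0 + 0 - (6^-1 *: K + (6^-1 *: K)^T
     + (2^-1 *: H) *m invmx A *m (2^-1 *: H)^T).
  exact: (cvg_submx (cvg_addmx (cvg_cstmx (2^-1 *: G2 0)) rc')
    (cvg_addmx (cvg_addmx Nc (cvg_trmx Nc))
      (cvg_mulmx (cvg_mulmx Mc (cvg_cstmx (invmx A))) (cvg_trmx Mc)))).
have E : 2^-1 *: G2 0 + 0 - (6^-1 *: K + (6^-1 *: K)^T
     + (2^-1 *: H) *m invmx A *m (2^-1 *: H)^T) =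
  2^-1 *: (K + 2 *: Z - Z^T) - (6^-1 *: (K + K^T) + 4^-1 *: (H *m invmx A *m H^T)).
  have TZ (a : R) (B : 'M[R]_n) : (a *: B)^T = a *: B^T by rewrite linearZ.
  rewrite G2E addr0 !TZ -!scalemxAl -scalemxAr scalerA.
  have -> : 4^-1 = 2^-1 * 2^-1 :> R by field.
  by rewrite [6^-1 *: (_ + _)]scalerDr.
rewrite -E; apply: cvg_trans lim; apply: near_eq_cvg; near=> t.
have tn0 : t != 0 by near: t; exact: nbhs_dnbhs_neq.
rewrite (GE t tn0) (LE t tn0) scalerA mulVf// scale1r -/(Nt t) -/(M t).
have TD (B C : 'M[R]_n) : (B + C)^T = B^T + C^T by rewrite linearD.
have TZ (a : R) (B : 'M[R]_n) : (a *: B)^T = a *: B^T by rewrite linearZ.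
have prod : (A + t *: M t) *m invmx A *m (A + t *: (M t)^T) =
    A + t *: (M t + (M t)^T) + t ^+ 2 *: (M t *m invmx A *m (M t)^T).
  rewrite [in LHS]mulmxDl mulmxV// [LHS]mulmxDl mul1mx [X in _ + X]mulmxDr.
  rewrite -!scalemxAl -scalemxAr mulmxKV// scalerA -expr2.
  rewrite [t *: (M t + _)]scalerDr !addrA. congr (_ + _); exact: addrAC.
rewrite [(A + _)^T]TD TZ gramA_sym prod gramG1.
set X := _ *m invmx A *m _; rewrite /M !TD !TZ.
apply/matrixP => i j; rewrite !mxE; field.
by rewrite tn0.
Unshelve. all: by end_near. Qed.

Hypothesis Omu : Om \in unitmx.

Lemma near_speed_gram_unit : \forall t \near (0 : R), G t \in unitmx.
Proof. exact: (near_unitmx (is_derive_continuous (dG 0)) Au). Qed.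

Lemma row_free_speed t : G t \in unitmx -> row_free (e t).
Proof.
move=> Gu; apply/row_freeP; exists (Om *m (e1 t)^T *m - invmx (G t)).
by rewrite !mulmxA speed_gramN mulmxN mulNmx opprK mulmxV.
Qed.

(** Although [Lam] vanishes at 0, its quotient by t tends to the invertible matrix A. *)
Lemma near_crossing_unit : \forall t \near (0 : R)^', Lam t \in unitmx.
Proof.
have [r rc LE] := Lam_expand.
have t0 : t @[t --> (0 : R)^'] --> (0 : R) by exact: nbhs_dnbhs.
pose f t := A + t *: (2^-1 *: H + t *: (6^-1 *: K + r t)).
have lim : f t @[t --> (0 : R)^'] --> A + 0 *: (2^-1 *: H + 0 *: (6^-1 *: K + 0)).
  exact: (cvg_addmx (cvg_cstmx A) (cvg_scalemx t0 (cvg_addmx (cvg_cstmx (2^-1 *: H))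
    (cvg_scalemx t0 (cvg_addmx (cvg_cstmx (6^-1 *: K)) rc))))).
rewrite scale0r addr0 in lim.
have un := cvg_unitmx Au lim; near=> t.
have tn0 : t != 0 by near: t; exact: nbhs_dnbhs_neq.
have ut : f t \in unitmx by near: t; exact: un.
by rewrite (LE t tn0) unitmxZ ?unitfE.
Unshelve. all: by end_near. Qed.

Variable J : R -> {vspace 'rV[R]_N}.
Hypothesis JE : \forall t \near (0 : R), forall w, w \in J t <-> exists p, w = p *m e t.

(** The projection a of w is sought as p e(s) with w - a orthogonal to e(t). This determines p, and
    by maximality of Lagrangian subspaces orthogonality puts w - a into J(t). *)
Lemma near_projection (s : R) (y : 'rV[R]_n) : Lam s \in unitmx ->
  (forall w, w \in J s <-> exists p, w = p *m e s) ->
  \forall t \near (0 : R), proj_parallel (J t) (J s) (y *m e 0) =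
    (y *m e 0) *m Om *m (e t)^T *m invmx (e s *m Om *m (e t)^T) *m e s.
Proof.
move=> Lu Js.
have cL : {for (0 : R), continuous (fun t => e s *m Om *m (e t)^T)}.
  by apply: cvg_mulmx; [exact: cvg_cst|exact: (cvg_trmx (is_derive_continuous (de 0)))].
have cu := near_unitmx cL Lu.
near=> t.
have cut : e s *m Om *m (e t)^T \in unitmx by near: t.
have Jt : forall w, w \in J t <-> exists p, w = p *m e t by near: t.
have et : row_free (e t).
  by apply: row_free_speed; near: t; exact: near_speed_gram_unit.
set w := y *m e 0; set a := _ *m e s.
rewrite /proj_parallel -{1}(subrK a w) addrC; apply: daddv_piE.
- apply/eqP; rewrite -subv0; apply/subvP => u /memv_capP[/Js[p ->] /Jt[q E]].
  have : p *m (e s *m Om *m (e t)^T) = 0 by rewrite !mulmxA E isoL.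
  by move=> /(congr1 (mulmx^~ (invmx (e s *m Om *m (e t)^T)))); rewrite mulmxK// mul0mx => ->; rewrite mul0mx mem0v.
- by apply/Js; eexists.
apply/Jt; apply: (lagrangian_maximal Omu et (isoe t)).
by rewrite !mulmxBl /a -[_ *m e s *m Om]mulmxA -[_ *m (e s *m Om) *m _]mulmxA mulmxKV// subrr.
Unshelve. all: by end_near. Qed.

Lemma projection_velocity (s : R) (y : 'rV[R]_n) : Lam s \in unitmx ->
  (forall w, w \in J s <-> exists p, w = p *m e s) ->
  derive1 (fun t => proj_parallel (J t) (J s) (y *m e 0)) 0 =
  - (y *m A *m invmx (Lam s) *m e s).
Proof.
move=> Lu Js.
have dI : is_derive (0 : R) (1 : R) (fun t => (y *m e 0) *m Om *m (e t)^T)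
   ((y *m e 0) *m Om *m (e1 0)^T).
  have h := is_derive_mulmx (is_derive_const (y *m e 0 *m Om) (0:R) (1:R)) (is_derive_trmx (de 0)).
  by apply: (is_derive_eq h); rewrite mul0mx add0r.
have dC : is_derive (0 : R) (1 : R) (fun t => e s *m Om *m (e t)^T) (e s *m Om *m (e1 0)^T).
  have h := is_derive_mulmx (is_derive_const (e s *m Om) (0:R) (1:R)) (is_derive_trmx (de 0)).
  by apply: (is_derive_eq h); rewrite mul0mx add0r.
have d := is_derive_mulmx (is_derive_mulmx dI
  (@is_derive_invmx R n (fun t => e s *m Om *m (e t)^T) _ 0 Lu dC)) (is_derive_const (e s) (0:R) (1:R)).
rewrite derive1E; have nE := near_projection y Lu Js.
rewrite (near_eq_derive _ nE) (@derive_val _ _ _ _ _ _ _ d) mulmx0 addr0.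
(* At time 0 the factor y e(0) Om e(0)^T vanishes by isotropy, so the derivative of the inverse
   matrix does not contribute. *)
rewrite isoL mul0mx addr0 -/(Lam s).
have -> : y *m e 0 *m Om *m (e1 0)^T = - (y *m A).
  by have := congr1 (mulmx y) (speed_gramN 0); rewrite mulmxN !mulmxA.
by rewrite !mulNmx.
Qed.

Let Lam1 t := e1 t *m Om *m (e 0)^T.

Let dLam t : is_derive t (1 : R) Lam (Lam1 t).
Proof.
have := @dom _ _ _ _ (fun=> e 0) (fun=> 0) t (de t) (is_derive_const (e 0) t (1 : R)).
by rewrite trmx0 mulmx0 addr0.
Qed.

Lemma projection_acceleration :
  \forall t \near (0 : R)^', forall y : 'rV[R]_n,
  derive1 (fun s => derive1 (fun tau => proj_parallel (J tau) (J s) (y *m e 0)) 0) t =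
  y *m A *m invmx (Lam t) *m (Lam1 t *m invmx (Lam t) *m e t - e1 t).
Proof.
have Jn : \forall s \near (0 : R)^', Lam s \in unitmx /\
    (forall w, w \in J s <-> exists p, w = p *m e s).
  near=> s; split; near: s; [exact: near_crossing_unit|exact: nbhs_dnbhs].
(* The outer derivative at t needs the formula for the inner one at all s near t, not only at t. *)
have Jnn := near_dnbhs_near Jn.
apply: filterS Jnn => t Jt y.
have [Lt _] := nbhs_singleton Jt.
rewrite derive1E.
have nE : \forall s \near t,
    derive1 (fun tau => proj_parallel (J tau) (J s) (y *m e 0)) 0 =
    - (y *m A *m invmx (Lam s) *m e s).
  by apply: filterS Jt => s [Ls Js]; exact: projection_velocity.
rewrite (near_eq_derive _ nE).
have d := is_derive_opp (is_derive_mulmx (is_derive_mulmx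
  (is_derive_const (y *m A) t (1:R)) (is_derive_invmx Lt (dLam t))) (de t)).
rewrite (@derive_val _ _ _ _ _ _ _ d) mul0mx add0r.
rewrite mulmxN mulNmx opprD opprK mulmxBr; congr (_ - _).
by rewrite !mulmxA.
Unshelve. all: by end_near. Qed.

Let cvg_quot : t^-1 *: Lam t @[t --> (0 : R)^'] --> A.
Proof.
have [r rc LE] := Lam_expand.
have t0 : t @[t --> (0 : R)^'] --> (0 : R) by exact: nbhs_dnbhs.
pose f t := A + t *: (2^-1 *: H + t *: (6^-1 *: K + r t)).
have lim : f t @[t --> (0 : R)^'] --> A + 0 *: (2^-1 *: H + 0 *: (6^-1 *: K + 0)).
  exact: (cvg_addmx (cvg_cstmx A) (cvg_scalemx t0 (cvg_addmx (cvg_cstmx (2^-1 *: H))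
    (cvg_scalemx t0 (cvg_addmx (cvg_cstmx (6^-1 *: K)) rc))))).
rewrite scale0r addr0 in lim.
apply: cvg_trans lim; apply: near_eq_cvg; near=> t.
have tn0 : t != 0 by near: t; exact: nbhs_dnbhs_neq.
by rewrite (LE t tn0) scalerA mulVf// scale1r.
Unshelve. all: by end_near. Qed.

(** The hypothesis is the defining expansion of the curvature operator in the frame, with rho its
    matrix. The error r(t) is o(t), since the vector y(t) e(0) to which the expansion is applied
    tends to 0. Moreover r(t) is orthogonal to e(0), so its pairing with e(t) equals the one with
    e(t) - e(0), which is O(t). Hence this pairing is o(t^2), and dividing by t^2 leaves the
    Schwarzian against rho A / 3. *)
Lemma curvature_schwarzian (rho : 'M[R]_n) (C : R) :
  (\forall t \near (0 : R)^', forall y : 'rV[R]_n,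
    `|y *m A *m invmx (Lam t) *m (Lam1 t *m invmx (Lam t) *m e t - e1 t) -
      (t ^- 2 *: (y *m e 0) + 3^-1 *: (y *m rho *m e 0))| <= C * `|t| * `|y *m e 0|) ->
  3^-1 *: (rho *m A) = schwarzian.
Proof.
move=> hC; suff E (z : 'rV[R]_n) : z *m (3^-1 *: (rho *m A)) = z *m schwarzian.
  by apply/row_matrixP => i; rewrite !rowE E.
(* Testing on this moving vector and pairing with [e t] avoids any expansion of the
   inverse of [Lam t]. *)
pose y t := z *m Lam t *m invmx A.
pose r t := z *m (Lam1 t *m invmx (Lam t) *m e t - e1 t) -
      (t ^- 2 *: (y t *m e 0) + 3^-1 *: (y t *m rho *m e 0)).
have t0 : t @[t --> (0 : R)^'] --> (0 : R) by exact: nbhs_dnbhs.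
have cLam : Lam t @[t --> (0 : R)^'] --> (0 : 'M[R]_n).
  have c := cvg_dnbhs_cont (is_derive_continuous (dLam 0)).
  by rewrite /Lam isoe in c.
have rE : \forall t \near (0 : R)^',
    t ^- 2 *: (z *m (G t - (t^-1 *: Lam t) *m invmx A *m (t^-1 *: Lam t)^T)) =
    3^-1 *: (z *m (t^-1 *: Lam t) *m invmx A *m rho *m (t^-1 *: Lam t)^T)
    - (t^-1 *: r t) *m Om *m (t^-1 *: (e t - e 0))^T.
  near=> t.
  have tn0 : t != 0 by near: t; exact: nbhs_dnbhs_neq.
  have Lu : Lam t \in unitmx by near: t; exact: near_crossing_unit.
  have e0 : r t *m Om *m (e 0)^T = 0.
    rewrite /r mulmxBl mulmxBl mulmxDl mulmxDl -!scalemxAl !isoL !scaler0 addr0 subr0.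
    rewrite mulmxBr mulmxBl mulmxBl.
    have -> : z *m (Lam1 t *m invmx (Lam t) *m e t) *m Om *m (e 0)^T =
       z *m Lam1 t *m (invmx (Lam t) *m Lam t) by rewrite !mulmxA.
    by rewrite mulVmx// mulmx1 /Lam1 !mulmxA subrr.
  have LT : e 0 *m Om *m (e t)^T = - (Lam t)^T by rewrite /Lam omT opprK.
  have e1E : r t *m Om *m (e t)^T = - (z *m G t) +
      (t ^- 2 *: (y t *m (Lam t)^T) + 3^-1 *: (y t *m rho *m (Lam t)^T)).
    have LTl q (a : 'M[R]_(q, n)) : a *m e 0 *m Om *m (e t)^T = - (a *m (Lam t)^T).
      by rewrite -mulmxN -LT !mulmxA.
    rewrite /r mulmxBl mulmxBl mulmxDl mulmxDl -!scalemxAl !LTl !scalerN -opprD opprK.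
    congr (_ + _).
    rewrite mulmxBr mulmxBl mulmxBl.
    have -> : z *m (Lam1 t *m invmx (Lam t) *m e t) *m Om *m (e t)^T = 0.
      by rewrite !mulmxA isoL.
    by rewrite sub0r /G !mulmxA.
  have TB (a b : 'M[R]_(n, N)) : (a - b)^T = a^T - b^T by rewrite linearB.
  have TZ p q (a : R) (b : 'M[R]_(p, q)) : (a *: b)^T = a *: b^T by rewrite linearZ.
  have R1 : (t^-1 *: r t) *m Om *m (t^-1 *: (e t - e 0))^T = t ^- 2 *: (r t *m Om *m (e t)^T).
    by rewrite TZ TB -!scalemxAl -scalemxAr mulmxBr e0 subr0 scalerA -invfM -expr2.
  have R2 : z *m (t^-1 *: Lam t) *m invmx A *m rho *m (t^-1 *: Lam t)^T =
      t ^- 2 *: (y t *m rho *m (Lam t)^T).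
    by rewrite TZ -[z *m (_ *: _)]scalemxAr -!scalemxAl -scalemxAr scalerA -invfM -expr2.
  have R3 : z *m ((t^-1 *: Lam t) *m invmx A *m (t^-1 *: Lam t)^T) =
      t ^- 2 *: (y t *m (Lam t)^T).
    by rewrite !mulmxA TZ -[z *m (_ *: _)]scalemxAr -!scalemxAl -scalemxAr scalerA -invfM -expr2.
  rewrite R1 R2 mulmxBr R3 e1E.
  move: (z *m G t) (y t *m (Lam t)^T) (y t *m rho *m (Lam t)^T) => X1 X2 X3.
  apply/rowP => j; rewrite !mxE; field.
  by rewrite tn0.
have rc : t^-1 *: r t @[t --> (0 : R)^'] --> (0 : 'rV[R]_N).
  have cy : y t *m e 0 @[t --> (0 : R)^'] --> z *m (0 : 'M[R]_n) *m invmx A *m e 0.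
    exact: (cvg_mulmx (cvg_mulmx (cvg_mulmx (cvg_cstmx z) cLam) (cvg_cstmx (invmx A)))
      (cvg_cstmx (e 0))).
  rewrite mulmx0 !mul0mx in cy.
  apply/cvgr0Pnorm_le => eps eps0; move/cvgr0Pnorm_le : cy => cy.
  have C1 : 0 < `|C| + 1 by rewrite ltr_wpDl.
  have {}cy := cy _ (divr_gt0 eps0 C1).
  near=> t.
  have tn0 : t != 0 by near: t; exact: nbhs_dnbhs_neq.
  have Lu : Lam t \in unitmx by near: t; exact: near_crossing_unit.
  have yt : `|y t *m e 0| <= eps / (`|C| + 1) by near: t.
  have h : forall y : 'rV[R]_n,
    `|y *m A *m invmx (Lam t) *m (Lam1 t *m invmx (Lam t) *m e t - e1 t) -
      (t ^- 2 *: (y *m e 0) + 3^-1 *: (y *m rho *m e 0))| <= C * `|t| * `|y *m e 0|.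
    by near: t.
  have := h (y t); rewrite {1}/y mulmxKV// mulmxK// -/(r t) => h1.
  rewrite normrZ normfV ler_pdivrMl ?normr_gt0// (le_trans h1)//.
  rewrite mulrAC [leRHS]mulrC ler_wpM2r//.
  rewrite (@le_trans _ _ ((`|C| + 1) * `|y t *m e 0|))//.
    by rewrite ler_wpM2r// (le_trans (ler_norm C))// lerDl.
  by rewrite mulrC -ler_pdivlMr.
have de0 : t^-1 *: (e t - e 0) @[t --> (0 : R)^'] --> e1 0.
  have [/cvg_ex[/= l hl] hd] := de 0.
  have <- : l = e1 0.
    by rewrite -hd; apply/esym; exact: (cvg_lim (@norm_hausdorff _ _) hl).
  apply: cvg_trans hl; apply: near_eq_cvg; near=> t => /=.
  by rewrite [t%:A](mulr1) addr0.
have lim2 : 3^-1 *: (z *m (t^-1 *: Lam t) *m invmx A *m rho *m (t^-1 *: Lam t)^T)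
    - (t^-1 *: r t) *m Om *m (t^-1 *: (e t - e 0))^T @[t --> (0 : R)^'] -->
    3^-1 *: (z *m A *m invmx A *m rho *m A^T) - 0 *m Om *m (e1 0)^T.
  apply: cvg_submx; last exact: (cvg_mulmx (cvg_mulmx rc (cvg_cstmx Om)) (cvg_trmx de0)).
  apply: cvg_scalemx; first exact: cvg_cst.
  exact: (cvg_mulmx (cvg_mulmx (cvg_mulmx (cvg_mulmx (cvg_cstmx z) cvg_quot)
    (cvg_cstmx (invmx A))) (cvg_cstmx rho)) (cvg_trmx cvg_quot)).
rewrite !mul0mx subr0 mulmxK// gramA_sym in lim2.
have lim1 : z *m (t ^- 2 *: (G t - (t^-1 *: Lam t) *m invmx A *m (t^-1 *: Lam t)^T))
    @[t --> (0 : R)^'] --> z *m schwarzian.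
  exact: (cvg_mulmx (cvg_cstmx z) schwarzian_limit).
rewrite -scalemxAr mulmxA.
refine (cvg_unique (@norm_hausdorff _ _) _ lim1).
apply: cvg_trans lim2; apply: near_eq_cvg.
by apply: filterS rE => t <-; rewrite -scalemxAr.
Unshelve. all: by end_near. Qed.

Let bf_alt u : bf Om u u = 0.
Proof. by have := bfT Om u u; rewrite OmT bfNm => h; lra. Qed.

Let bfe m k (a : 'M[R]_(m, N)) (b : 'M[R]_(k, N)) p q :
  bf Om (p *m a) (q *m b) = bf (a *m Om *m b^T) p q.
Proof. by rewrite bf_mull bf_mulr. Qed.

(** The trial curve is p(s) e(s) with p(s) = y + s c, where A(y, .) represents Om(. e(0), v); up to
    the sign [eps], y is the maximizer at s = 0. Writing v = al e(0) - y e1(0) and h = y H A^-1, the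
    second derivative at 0 is 2 eps A(al - h/2, al - h/2) - 2 eps (rho A)(y, y). The first term is
    nonnegative, the second adds a nonnegative amount, and v <> 0 prevents both from vanishing. *)
Lemma touching_function (rho : 'M[R]_n) (eps : R) (v : 'rV[R]_N) :
  3^-1 *: (rho *m A) = schwarzian ->
  (forall p, p != 0 -> 0 < eps * bf A p p) ->
  (forall p, p != 0 -> eps * bf (rho *m A) p p < 0) -> v != 0 ->
  exists (p : R -> 'rV[R]_n) (m1 : R -> R) (m2 : R),
  [/\ forall s, is_derive s (1 : R)
        (fun s => eps * (2 * bf Om (p s *m e s) v - bf (G s) (p s) (p s))) (m1 s),
      is_derive (0 : R) (1 : R) m1 m2, 0 < m2 &
      forall q, bf A (p 0) q = bf Om (q *m e 0) v].
Proof.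
move=> rhoS posA negR vn0.
pose Ai := invmx A.
pose y := (e 0 *m Om *m v^T)^T *m Ai.
have yE : y *m A = - (v *m Om *m (e 0)^T).
  by rewrite /y mulmxKV// omT.
(* The vector v + y e1(0) is orthogonal to e(0) by the choice of y, hence lies in the Lagrangian
   subspace at time 0. *)
have [al alE] : exists al, v + y *m e1 0 = al *m e 0.
  apply: (lagrangian_maximal Omu (row_free_speed Au) (isoe 0)).
  rewrite !mulmxDl -[_ *m e1 0 *m Om]mulmxA -[_ *m (e1 0 *m Om) *m _]mulmxA -/(G 0) -/A yE.
  by rewrite addrN.
have vE : v = al *m e 0 - y *m e1 0 by rewrite -alE addrK.
(* The velocity [c] is a critical point of the second derivative [m2] below. *)
pose h := y *m H *m Ai; pose c := al - h.
pose p s := y + s *: c.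
have p0 : p 0 = y by rewrite /p scale0r addr0.
have dp s : is_derive s (1 : R) p c.
  have hd := is_derive_add (is_derive_const y s (1 : R))
    (is_derive_scale (is_derive_id s (1 : R)) (is_derive_const c s (1 : R))).
  by apply: (is_derive_eq hd); rewrite scaler0 !add0r scale1r.
have dce (a b : R -> 'M[R]_(n, N)) s : is_derive s (1 : R) a (b s) ->
    is_derive s (1 : R) (fun s => c *m a s) (c *m b s).
  move=> ha; have hd := is_derive_mulmx (is_derive_const c s (1 : R)) ha.
  by apply: (is_derive_eq hd); rewrite mul0mx add0r.
pose z0 s := p s *m e s.
pose z1 s := c *m e s + p s *m e1 s.
pose z2 s := c *m e1 s + (c *m e1 s + p s *m e2 s).
pose z3 s := c *m e2 s + (c *m e2 s + (c *m e2 s + p s *m e3 s)).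
have d0 s : is_derive s (1 : R) z0 (z1 s) by exact: is_derive_mulmx (dp s) (de s).
have d1 s : is_derive s (1 : R) z1 (z2 s).
  exact: is_derive_add (dce _ _ _ (de s)) (is_derive_mulmx (dp s) (de1 s)).
have d2 s : is_derive s (1 : R) z2 (z3 s).
  exact: is_derive_add (dce _ _ _ (de1 s)) (is_derive_add (dce _ _ _ (de1 s))
    (is_derive_mulmx (dp s) (de2 s))).
have dv s (a b : R -> 'rV[R]_N) : is_derive s (1 : R) a (b s) ->
    is_derive s (1 : R) (fun s => bf Om (a s) v) (bf Om (b s) v).
  move=> ha; have hd := is_derive_bf Om ha (is_derive_const v s (1 : R)).
  by apply: (is_derive_eq hd); rewrite bf0r addr0.
(* By isotropy of e, Om(z1, z0) equals G(p, p). In this form the derivatives stay short, because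
   Om(z1, z1) = 0. *)
pose m0 s := eps * (2 * bf Om (z0 s) v - bf Om (z1 s) (z0 s)).
pose m1 s := eps * (2 * bf Om (z1 s) v - bf Om (z2 s) (z0 s)).
pose m2 := eps * (2 * bf Om (z2 0) v - (bf Om (z3 0) (z0 0) + bf Om (z2 0) (z1 0))).
have dcm s (a : R) f df : is_derive s (1 : R) (f : R -> R) df ->
    is_derive s (1 : R) (fun s => a * f s) (a * df).
  move=> hf; have hd := is_derive_mul (is_derive_const a s (1 : R)) hf.
  by apply: (is_derive_eq hd); rewrite mul0r addr0.
exists p, m1, m2; split.
- move=> s.
  have -> : (fun s => eps * (2 * bf Om (p s *m e s) v - bf (G s) (p s) (p s))) = m0.
    apply/funext => t; rewrite /m0 -/(z0 t); congr (_ * (_ - _)).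
    by rewrite /z1 /z0 [in RHS]bfDl [in RHS]bfe [in RHS]bfe isoe bf0m add0r.
  have hd := dcm s eps _ _ (is_derive_sub (dcm s 2 _ _ (dv s _ _ (d0 s)))
    (is_derive_bf Om (d1 s) (d0 s))).
  apply: (is_derive_eq hd).
  by rewrite bf_alt addr0.
- exact: (dcm 0 eps _ _ (is_derive_sub (dcm 0 2 _ _ (dv 0 _ _ (d1 0)))
    (is_derive_bf Om (d2 0) (d0 0)))).
(* After all pairings are reduced to A, H, K and Z, the matrices K and Z enter only through the
   Schwarzian evaluated at y, and the other terms complete a square. *)
- have E : m2 = 2 * (eps * bf A (al - 2^-1 *: h) (al - 2^-1 *: h)) -
      2 * (eps * bf (rho *m A) y y).
    have hA q : bf A h q = bf H y q.
      by rewrite /h -mulmxA bf_mull /Ai -mulmxA mulVmx// mulmx1.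
    have Asym q q' : bf A q q' = bf A q' q by rewrite -[in LHS]gramA_sym bfT.
    have Wcy : bf (e1 0 *m Om *m (e1 0)^T) c y = 2^-1 * (bf H y c - bf H c y).
      by rewrite gramW bfZm bfDm bfNm bfT.
    have rE : bf (rho *m A) y y =
       3 * (2^-1 * (bf K y y + bf Z y y) - (3^-1 * bf K y y + 4^-1 * bf H y h)).
      have -> : rho *m A = 3 *: schwarzian by rewrite -rhoS scalerA mulfV// scale1r.
      rewrite bfZm; congr (_ * _).
      rewrite /schwarzian !(bfDm, bfNm, bfZm) !bfT.
      have -> : bf (H *m invmx A *m H^T) y y = bf H y h.
        transitivity (bf (H *m (H *m invmx A)^T) y y).
          by rewrite [(H *m invmx A)^T]trmx_mul AiT mulmxA.
        by rewrite -bf_mulr mulmxA.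
      lra.
    rewrite /m2 /z0 /z1 /z2 /z3 p0 [in bf Om _ v]vE.
    rewrite !(bfDl, bfDr, bfNl, bfNr) !bfe.
    rewrite Wcy !(bfZl, bfZr) rE.
    rewrite -/(G 0) -/A -/H -/K -/Z.
    have -> : bf A c al = bf A al al - bf H y al by rewrite /c bfDl bfNl hA.
    have -> : bf A c c = bf A al al - 2 * bf H y al + bf H y h.
      by rewrite /c !(bfDl, bfDr, bfNl, bfNr) (Asym al h) !hA; ring.
    have -> : bf H y c = bf H y al - bf H y h by rewrite /c bfDr bfNr.
    rewrite (Asym al h) !hA. by field.
  (* For y = 0 the curvature term is zero, but then v = al e(0) forces al <> 0 and the square is
     positive. For y <> 0 the curvature term alone is enough. *)
  have [y0|yn0] := eqVneq y 0.
    have h0 : h = 0 by rewrite /h y0 !mul0mx.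
    have aln0 : al != 0.
      by apply: contra_neq vn0 => al0; rewrite vE y0 al0 !mul0mx subrr.
    rewrite E h0 scaler0 subr0 y0 bf0l mulr0 mulr0 subr0 mulr_gt0//; exact: posA.
  rewrite E subr_gt0 (@lt_le_trans _ _ 0)//.
    by rewrite pmulr_rlt0//; exact: negR.
  rewrite mulr_ge0//; have [->|nz] := eqVneq (al - 2^-1 *: h) 0.
    by rewrite bf0l mulr0.
  by apply: ltW; exact: posA.
- move=> q; rewrite p0.
  have -> : bf A y q = (y *m A *m q^T) 0 0 by [].
  rewrite yE.
  have -> : bf Om (q *m e 0) v = - bf Om v (q *m e 0) by rewrite -[LHS]bfT OmT bfNm.
  by rewrite bf_mulr /bf mulNmx [LHS]mxE mulmxA.
Qed.

End LagrangianCurve.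

(** * The flow in charts *)

Lemma continuous_at_pair (T U V : topologicalType) (f : T -> U) (g : T -> V) (x : T) :
  {for x, continuous f} -> {for x, continuous g} ->
  {for x, continuous (fun y => (f y, g y))}.
Proof.
move=> fc gc; exact: (@cvg_pair _ _ _ (nbhs x) (nbhs (f x)) (nbhs (g x)) _ _ _ f g fc gc).
Qed.

Section ChainRule.
Context {R : realType}.

Lemma is_derive_comp_diff (V W : normedModType R) (g : V -> W) (f : R -> V) (t : R) df :
  is_derive t (1 : R) f df -> differentiable g (f t) ->
  is_derive t (1 : R) (g \o f) ('d g (f t) df).
Proof.
move=> [/derivable1_diffP dft <-] dg; apply: DeriveDef.
  by apply: diff_derivable; exact: differentiable_comp.
rewrite deriveE; last exact: differentiable_comp.
by rewrite diff_comp//= deriveE.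
Qed.

Lemma is_derive_pair (V W : normedModType R) (f : R -> V) (g : R -> W) (t : R) df dg :
  is_derive t (1 : R) f df -> is_derive t (1 : R) g dg ->
  is_derive t (1 : R) (fun s => (f s, g s)) (df, dg).
Proof.
move=> [/derivable1_diffP dft <-] [/derivable1_diffP dgt <-]; apply: DeriveDef.
  by apply: diff_derivable; exact: differentiable_pair.
rewrite deriveE; last exact: differentiable_pair.
by rewrite diff_pair// !deriveE.
Qed.

Lemma is_diff_pair_cst (V W : normedModType R) (a : V) (w : W) :
  is_diff w (fun w => (a, w)) (fun u => (0, u)).
Proof. exact: is_diff_pair (is_diff_cst a w) (is_diff_id w). Qed.

Lemma differentiable_pair_cst (V W : normedModType R) (a : V) (w : W) :
  differentiable (fun w => (a, w)) w.
Proof. by case: (is_diff_pair_cst a w). Qed.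

Lemma diff_slice (V V' W : normedModType R) (f : V * V' -> W) (a : V) (w u : V') :
  differentiable f (a, w) ->
  differentiable (fun w => f (a, w)) w /\ 'd (fun w => f (a, w)) w u = 'd f (a, w) (0, u).
Proof.
move=> df; have dp := differentiable_pair_cst a w.
split; first exact: (differentiable_comp dp df).
rewrite (diff_comp dp df)/=; congr ('d f (a, w) _).
by case: (is_diff_pair_cst a w) => _ ->.
Qed.

Lemma open_slice (V V' : normedModType R) (O : set (V * V')) (a : V) :
  open O -> open [set w | O (a, w)].
Proof.
move=> oO; apply: (@open_comp _ _ (fun w => (a, w))) => // w _.
exact: differentiable_continuous (differentiable_pair_cst a w).
Qed.

Lemma Ck_slice (V V' W : normedModType R) k (O : set (V * V')) (f : V * V' -> W) (a : V) :
  open O -> Ck k O f -> Ck k [set w | O (a, w)] (fun w => f (a, w)).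
Proof.
move=> oO; elim: k f => [|k IH] f.
  move=> fc w Ow; apply: (@continuous_comp _ _ _ (fun w => (a, w)) f); last exact: fc.
  by apply: differentiable_continuous; exact: differentiable_pair_cst.
move=> [df fk]; split=> [w Ow|u]; first by have [] := diff_slice 0 (df _ Ow).
apply: (Ck_ext (open_slice a oO) _ (IH _ (fk (0, u)))) => w Ow.
have [d1 d2] := diff_slice u (df _ Ow).
by rewrite [RHS]deriveE// d2 deriveE//; exact: df.
Qed.

End ChainRule.

Section Flow.
Context {R : realType} {m : nat} {M : topologicalType}.
Variables (A : smooth_atlas R m M) (X : M -> 'rV[R]_m) (phi : R -> M -> M).
Hypothesis flow : is_flow A X phi.
Local Notation E := 'rV[R]_m.
Local Notation ch := (chart_at A).

Lemma ch_charts x : charts A (ch x). Proof. exact: chart_at_charts. Qed.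
Lemma ch_dom x : cdom (ch x) x. Proof. exact: chart_at_dom. Qed.

Lemma cinv_dom (c : chart R m M) z : (cmap c @` cdom c) z -> cdom c (cinv c z).
Proof. by case=> x cx <-; rewrite cmapK. Qed.

Lemma cinvK (c : chart R m M) z : (cmap c @` cdom c) z -> cmap c (cinv c z) = z.
Proof. by case=> x cx <-; rewrite cmapK. Qed.

Lemma cimg (c : chart R m M) x : cdom c x -> (cmap c @` cdom c) (cmap c x).
Proof. by exists x. Qed.

Lemma cinv_continuous (c : chart R m M) z : (cmap c @` cdom c) z ->
  {for z, continuous (cinv c)}.
Proof.
have : {within cmap c @` cdom c, continuous (cinv c)} by exact: cinv_cont.
rewrite continuous_open_subspace; last exact: cimg_open.
by move=> h zc; apply: h; rewrite inE.
Qed.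

Lemma cmap_continuous (c : chart R m M) x : cdom c x -> {for x, continuous (cmap c)}.
Proof.
have : {within cdom c, continuous (cmap c)} by exact: cmap_cont.
rewrite continuous_open_subspace; last exact: cdom_open.
by move=> h xc; apply: h; rewrite inE.
Qed.

Lemma near_cdom (c : chart R m M) x : cdom c x -> \forall y \near x, cdom c y.
Proof. by move=> cx; exact: (open_nbhs_nbhs (conj (@cdom_open _ _ _ c) cx)). Qed.

Lemma near_cimg (c : chart R m M) z : (cmap c @` cdom c) z ->
  \forall w \near z, (cmap c @` cdom c) w.
Proof. by move=> cz; exact: (open_nbhs_nbhs (conj (@cimg_open _ _ _ c) cz)). Qed.

Lemma flow_continuous2 : continuous (fun p : R * M => phi p.1 p.2).
Proof. exact: (flow_cont flow). Qed.

Lemma orbit_continuous x : continuous (fun t => phi t x).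
Proof.
move=> t; apply: (@continuous_comp _ _ _ (fun t => (t, x)) (fun p => phi p.1 p.2)).
  have c1 : {for t, continuous (@id R)} by exact: cvg_id.
  have c2 : {for t, continuous (fun _ : R => x)} by exact: cvg_cst.
  exact: (continuous_at_pair c1 c2).
exact: flow_continuous2.
Qed.

Lemma flow_continuous t : continuous (phi t).
Proof.
move=> x; apply: (@continuous_comp _ _ _ (fun x => (t, x)) (fun p => phi p.1 p.2)).
  have c1 : {for x, continuous (@id M)} by exact: cvg_id.
  have c2 : {for x, continuous (fun _ : M => t)} by exact: cvg_cst.
  exact: (continuous_at_pair c2 c1).
exact: flow_continuous2.
Qed.

(* The maps [tcoord], [tvect] (at time 0) and [tmap] are all differentials of [cflow],
   so that a single chain rule covers them. *)
Definition cflow (c c' : chart R m M) (t : R) (z : E) : E := cmap c' (phi t (cinv c z)).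

Definition spacetime (c c' : chart R m M) : set (R * E) :=
  [set p : R * E | (cmap c @` cdom c) p.2 /\ cdom c' (phi p.1 (cinv c p.2))].

Definition cflow2 (c c' : chart R m M) (p : R * E) : E := cmap c' (phi p.1 (cinv c p.2)).

Lemma spacetime_open c c' : open (spacetime c c').
Proof.
rewrite openE => -[t z] [/= cz c'z].
have h1 : \forall p \near (t, z), (cmap c @` cdom c) p.2.
  exact: (@cvg_snd _ _ (nbhs t) (nbhs z) _ _ (near_cimg cz)).
have c2 : {for (t, z), continuous (fun p : R * E => phi p.1 (cinv c p.2))}.
  apply: (@continuous_comp _ _ _ (fun p : R * E => (p.1, cinv c p.2)) (fun p => phi p.1 p.2)).
    apply: continuous_at_pair; first exact: cvg_fst.
    apply: (@continuous_comp _ _ _ (fun p : R * E => p.2) (cinv c)); first exact: cvg_snd.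
    exact: cinv_continuous.
  exact: flow_continuous2.
have h2 : \forall p \near (t, z), cdom c' (phi p.1 (cinv c p.2)).
  exact: (c2 _ (near_cdom c'z)).
by apply: filterS2 h1 h2 => p.
Qed.

Lemma cflow2_smooth c c' k : charts A c -> charts A c' -> Ck k (spacetime c c') (cflow2 c c').
Proof. by move=> cA c'A; exact: (flow_smooth flow cA c'A). Qed.

Lemma spacetimeP c c' t x : cdom c x -> cdom c' (phi t x) -> spacetime c c' (t, cmap c x).
Proof. by move=> cx c'x; split; [exact: cimg|rewrite /= cmapK]. Qed.

Lemma cflow2_differentiable c c' p : charts A c -> charts A c' -> spacetime c c' p ->
  differentiable (cflow2 c c') p.
Proof. by move=> cA c'A; case: (@cflow2_smooth c c' 1 cA c'A) => + _; exact. Qed.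

Lemma cflow_differentiable c c' t x : charts A c -> charts A c' ->
  cdom c x -> cdom c' (phi t x) -> differentiable (cflow c c' t) (cmap c x).
Proof.
move=> cA c'A cx c'x.
by have [] := diff_slice 0 (cflow2_differentiable cA c'A (spacetimeP cx c'x)).
Qed.

Definition dcflow c c' t x u : E := 'd (cflow c c' t) (cmap c x) u.

(** The differential at fixed time is a partial derivative of the joint map of time and space, and
    as such can be differentiated in time. *)
Lemma dcflowE c c' t x u : charts A c -> charts A c' ->
  cdom c x -> cdom c' (phi t x) -> dcflow c c' t x u = 'D_(0, u) (cflow2 c c') (t, cmap c x).
Proof.
move=> cA c'A cx c'x; have d2 := cflow2_differentiable cA c'A (spacetimeP cx c'x).
by have [_ h] := diff_slice u d2; rewrite deriveE// -h.
Qed.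

(** The group law of the flow, differentiated in charts. With s = 0 or t = 0 it is the rule for a
    change of chart. *)
Lemma dcflow_comp c c' c'' s t x u : charts A c -> charts A c' -> charts A c'' ->
  cdom c x -> cdom c' (phi t x) -> cdom c'' (phi (s + t) x) ->
  dcflow c' c'' s (phi t x) (dcflow c c' t x u) = dcflow c c'' (s + t) x u.
Proof.
move=> cA c'A c''A cx c'x c''x.
have c''x' : cdom c'' (phi s (phi t x)) by rewrite -(flowD flow).
have d1 := cflow_differentiable cA c'A cx c'x.
have d2 := cflow_differentiable c'A c''A c'x c''x'.
have PE : cflow c c' t (cmap c x) = cmap c' (phi t x) by rewrite /cflow cmapK.
rewrite -PE in d2.
have := differentiable_comp d1 d2.
have nE : \forall z \near cmap c x, (cflow c' c'' s \o cflow c c' t) z = cflow c c'' (s + t) z.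
  have h : \forall z \near cmap c x, spacetime c c' (t, z).
    apply: (@open_nbhs_nbhs _ _ [set z | spacetime c c' (t, z)]).
    split; last exact: spacetimeP.
    exact: (open_slice t (@spacetime_open c c')).
  by apply: filterS h => z [/= cz c'z]; rewrite /cflow /= /cflow cmapK// (flowD flow).
move=> d12; have [_ E'] := near_eq_diff nE d12.
apply: (etrans _ (esym (congr1 (fun f => f u) E'))).
apply: (etrans _ (esym (congr1 (fun f => f u) (diff_comp d1 d2)))).
by rewrite /comp PE.
Qed.

Lemma dcflow_id c x u : cdom c x -> dcflow c c 0 x u = u.
Proof.
move=> cx; have nE : \forall z \near cmap c x, id z = cflow c c 0 z.
  by apply: filterS (near_cimg (cimg cx)) => z cz; rewrite /cflow (flow0 flow) cinvK.
have dd : is_diff (cmap c x) (id : E -> E) id by exact: is_diff_id.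
have [_] := near_eq_diff nE (ex_diff (is_diff_def := dd)).
by rewrite /dcflow => ->; rewrite diff_val.
Qed.

Lemma tcoordE c x u : tcoord A c x u = dcflow (ch x) c 0 x u.
Proof.
rewrite /tcoord /mdiff /dcflow; congr ('d _ (cmap (ch x) x) u).
by apply/funext => z; rewrite /cflow (flow0 flow).
Qed.

Lemma tvectE c x u : tvect A c x u = dcflow c (ch x) 0 x u.
Proof.
rewrite /tvect /dcflow; congr ('d _ (cmap c x) u).
by apply/funext => z; rewrite /cflow (flow0 flow).
Qed.

Lemma tmapE t x u : tmap A (phi t) x u = dcflow (ch x) (ch (phi t x)) t x u.
Proof. by []. Qed.

End Flow.

(** * Time derivatives of the flow and of its differential *)

Section FlowCalculus.
Context {R : realType} {m : nat} {M : topologicalType}.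
Variables (A : smooth_atlas R m M) (X : M -> 'rV[R]_m) (phi : R -> M -> M).
Hypothesis flow : is_flow A X phi.
Local Notation E := 'rV[R]_m.
Local Notation ch := (chart_at A).

Lemma near_orbit (c : chart R m M) t x : cdom c (phi t x) ->
  \forall s \near t, cdom c (phi s x).
Proof. by move=> cx; have := @orbit_continuous _ _ _ _ _ _ flow x t; apply; exact: near_cdom. Qed.

Lemma near_orbit0 (c : chart R m M) x : cdom c x -> \forall s \near (0 : R), cdom c (phi s x).
Proof. by move=> cx; apply: near_orbit; rewrite (flow0 flow). Qed.

Lemma vf_in_chartE (c : chart R m M) (v : M -> E) x : cdom c x ->
  vf_in_chart A c v (cmap c x) = tcoord A c x (v x).
Proof. by move=> cx; rewrite /vf_in_chart cmapK. Qed.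

Lemma velocity c t x : charts A c -> cdom c (phi t x) ->
  is_derive t (1 : R) (fun s => cmap c (phi s x)) (vf_in_chart A c X (cmap c (phi t x))).
Proof.
move=> cA cx; rewrite vf_in_chartE//; set y := phi t x.
have df := flow_velocity flow t x.
have dg : differentiable (cmap c \o cinv (ch y)) (cmap (ch y) y).
  have cy0 : cdom c (phi 0 y) by rewrite (flow0 flow).
  have := @cflow_differentiable _ _ _ _ _ _ flow _ _ 0 _ (ch_charts A y) cA (ch_dom A y) cy0.
  suff -> : cflow phi (ch y) c 0 = cmap c \o cinv (ch y) by [].
  by apply/funext => z; rewrite /cflow (flow0 flow).
have h := is_derive_comp_diff df dg.
apply: near_eq_is_derive h.
have := near_orbit (ch_dom A y); apply: filterS => s sy.
by rewrite /= cmapK.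
Qed.

Lemma diff_pair_time (W : normedModType R) (F : R * E -> W) t z :
  differentiable F (t, z) ->
  is_derive t (1 : R) (fun s => F (s, z)) ('d F (t, z) (1, 0)).
Proof.
move=> dF; have dp := is_derive_pair (is_derive_id t (1 : R)) (is_derive_const z t (1 : R)).
exact: (is_derive_comp_diff dp dF).
Qed.

Lemma derive_time c c' p : charts A c -> charts A c' -> spacetime phi c c' p ->
  'D_(1, 0) (cflow2 phi c c') p = vf_in_chart A c' X (cflow2 phi c c' p).
Proof.
case: p => t z cA c'A Op; have dF := cflow2_differentiable flow cA c'A Op.
rewrite deriveE//; apply: (is_derive_uniq (diff_pair_time dF)).
exact: (@velocity c' t (cinv c z) c'A (proj2 Op)).
Qed.

(** The smoothness of X comes from that of the flow: in a chart, X is the time derivative at t =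
    0. *)
Lemma smooth_in_chart_slice c k : charts A c ->
  Ck k (cmap c @` cdom c) (vf_in_chart A c X).
Proof.
move=> cA; have [_ /(_ (1, 0)) h] := @cflow2_smooth _ _ _ _ _ _ flow c c k.+1 cA cA.
have oO := @spacetime_open _ _ _ _ _ _ flow c c.
have {}h := Ck_slice 0 oO h.
have UO : cmap c @` cdom c `<=` [set z | spacetime phi c c (0, z)].
  by move=> z cz; split => //=; rewrite (flow0 flow); exact: cinv_dom.
apply: (Ck_ext (@cimg_open _ _ _ c) _ (Ck_subset UO h)) => z cz.
rewrite (derive_time cA cA (UO _ cz)) /cflow2/= (flow0 flow) cinvK//.
Qed.

(** By symmetry of second derivatives the time derivative may be taken first, and at time 0 it is
    X. *)
Lemma derive_time_space c x u : charts A c -> cdom c x ->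
  'D_(1, 0) (fun p => 'D_(0, u) (cflow2 phi c c) p) (0, cmap c x) =
  'D_u (vf_in_chart A c X) (cmap c x).
Proof.
move=> cA cx; have oO := @spacetime_open _ _ _ _ _ _ flow c c.
have Ox : spacetime phi c c (0, cmap c x).
  by apply: (spacetimeP (phi := phi)) => //; rewrite (flow0 flow).
pose e0 : R * E := (0, u); pose e1 : R * E := (1, 0).
rewrite (schwarz_mx e0 e1 oO Ox (cflow2_smooth flow 2 cA cA)) /e0 /e1.
have [_ /(_ (1, 0)) h] := @cflow2_smooth _ _ _ _ _ _ flow c c 2 cA cA.
have dF : differentiable (fun p => 'D_(1, 0) (cflow2 phi c c) p) (0, cmap c x).
  by case: h => + _; exact.
have [d1 d2] := diff_slice u dF.
rewrite deriveE// -d2 -deriveE//; apply: near_eq_derive.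
apply: filterS (near_cimg (cimg cx)) => z cz.
have UO : spacetime phi c c (0, z) by split => //=; rewrite (flow0 flow); exact: cinv_dom.
by rewrite (derive_time cA cA UO) /cflow2/= (flow0 flow) cinvK.
Qed.

Lemma is_derive_dcflow c x u : charts A c -> cdom c x ->
  is_derive (0 : R) (1 : R) (fun s => dcflow phi c c s x u) ('D_u (vf_in_chart A c X) (cmap c x)).
Proof.
move=> cA cx.
have Ox : spacetime phi c c (0, cmap c x).
  by apply: (spacetimeP (phi := phi)) => //; rewrite (flow0 flow).
have [_ /(_ (0, u)) h] := @cflow2_smooth _ _ _ _ _ _ flow c c 2 cA cA.
have dF : differentiable (fun p => 'D_(0, u) (cflow2 phi c c) p) (0, cmap c x).
  by case: h => + _; exact.
have dt := diff_pair_time dF.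
rewrite -derive_time_space// deriveE//; apply: near_eq_is_derive dt.
have := near_orbit0 cx; apply: filterS => s sx.
by rewrite (dcflowE flow).
Qed.

Definition local_bracket (c : chart R m M) (v : M -> E) (z : E) : E :=
  'D_(vf_in_chart A c X z) (vf_in_chart A c v) z -
  'D_(vf_in_chart A c v z) (vf_in_chart A c X) z.

Lemma derive_basis (W : normedModType R) (f : E -> W) (z u : E) : differentiable f z ->
  'D_u f z = \sum_i u 0 i *: 'D_(delta_mx 0 i) f z.
Proof.
move=> df; rewrite deriveE// {1}[u]row_sum_delta linear_sum; apply: eq_bigr => i _.
by rewrite linearZ/= deriveE.
Qed.

(** The vector v is expanded in the coordinate basis along the orbit, and [F i (- s, orb s)] is the
    image of the i-th basis vector under the differential of the flow at time -s. The coefficients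
    contribute the derivative of v along X, and the time dependence of [F i] contributes the
    derivative of X along v. *)
Lemma is_derive_transport c x (v : M -> E) : charts A c -> cdom c x ->
  differentiable (vf_in_chart A c v) (cmap c x) ->
  is_derive (0 : R) (1 : R)
    (fun s => dcflow phi c c (- s) (phi s x) (vf_in_chart A c v (cmap c (phi s x))))
    (local_bracket c v (cmap c x)).
Proof.
move=> cA cx dv; set z := cmap c x.
have cx0 : cdom c (phi 0 x) by rewrite (flow0 flow).
have dX : differentiable (vf_in_chart A c X) z.
  by have [+ _] := smooth_in_chart_slice 1 cA; apply; exact: cimg.
have Oz : spacetime phi c c (0, z) by apply: (spacetimeP (phi := phi)).
pose F i := fun p => 'D_(0, delta_mx 0 i) (cflow2 phi c c) p.
have dF i : differentiable (F i) (0, z).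
  have [_ /(_ (0, delta_mx 0 i)) h] := @cflow2_smooth _ _ _ _ _ _ flow c c 2 cA cA.
  by case: h => + _; exact.
have F0 i w : (cmap c @` cdom c) w -> F i (0, w) = delta_mx 0 i.
  move=> cw; have cw' := cinv_dom cw; rewrite -(cinvK cw) /F -(dcflowE flow)// ?(flow0 flow)//.
  exact: (dcflow_id flow _ cw').
pose orb s := cmap c (phi s x).
have orb0 : orb 0 = z by rewrite /orb (flow0 flow).
have dorb : is_derive (0 : R) (1 : R) orb (vf_in_chart A c X z).
  by rewrite -orb0; exact: velocity.
have dFi i : is_derive (0 : R) (1 : R) (fun s => F i (- s, orb s))
    (- 'D_(delta_mx 0 i) (vf_in_chart A c X) z).
  have dp := is_derive_pair (is_derive_opp (is_derive_id (0 : R) (1 : R))) dorb.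
  have dF' : differentiable (F i) (- (0 : R), orb 0) by rewrite oppr0 orb0.
  apply: (is_derive_eq (is_derive_comp_diff dp dF')).
  rewrite oppr0 orb0.
  have -> : ((- 1 : R), vf_in_chart A c X z) = - (1, 0) + (0, vf_in_chart A c X z) :> R * E.
    transitivity ((- 1 + 0 : R), (- 0 + vf_in_chart A c X z : E)); last by [].
    by rewrite addr0 oppr0 add0r.
  rewrite linearD linearN/= -!(deriveE _ (dF i)) derive_time_space//.
  have [d1 d2] := diff_slice (vf_in_chart A c X z) (dF i).
  rewrite [X in _ + X]deriveE// -d2 -deriveE//.
  (* At time 0 the differential of the flow is the identity, so [F i] is constant in space there and
     its spatial derivative vanishes. *)
  have -> : 'D_(vf_in_chart A c X z) (fun w => F i (0, w)) z =
      'D_(vf_in_chart A c X z) (fun _ => delta_mx 0 i : E) z.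
    apply: near_eq_derive; apply: filterS (near_cimg (cimg cx)) => w cw; exact: F0.
  by rewrite derive_cst addr0.
have dvi i : is_derive (0 : R) (1 : R) (fun s => vf_in_chart A c v (orb s) 0 i)
    ('D_(vf_in_chart A c X z) (vf_in_chart A c v) z 0 i).
  have dv' : differentiable (vf_in_chart A c v) (orb 0) by rewrite orb0.
  have := is_derive_comp_diff dorb dv'; rewrite orb0 -deriveE// => /is_derive_mxP/(_ 0 i).
  exact.
have dsum := @is_derive_bigsum _ _ _ _ (index_enum 'I_m) xpredT _ _ _ _
   (fun i _ => is_derive_scale (dvi i) (dFi i)).
have dsum' : is_derive (0 : R) (1 : R)
    (fun s => \sum_(i < m) vf_in_chart A c v (orb s) 0 i *: F i (- s, orb s))
    (local_bracket c v z).
  apply: (is_derive_eq dsum).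
  rewrite oppr0 orb0 big_split/= addrC /local_bracket; congr (_ + _).
    rewrite [RHS]row_sum_delta; apply: eq_bigr => i _; rewrite F0//; exact: cimg.
  rewrite [in RHS]derive_basis// -sumrN; apply: eq_bigr => i _.
  by rewrite scalerN.
apply: near_eq_is_derive dsum'.
have := near_orbit0 cx; apply: filterS => s sx.
have sx' : cdom c (phi (- s) (phi s x)) by rewrite -(flowD flow) addNr (flow0 flow).
have dPs : differentiable (cflow phi c c (- s)) (cmap c (phi s x)).
  exact: (cflow_differentiable flow).
rewrite /dcflow [X in _ = 'd _ _ X]row_sum_delta linear_sum; apply: eq_bigr => i _.
by rewrite linearZ/=; congr (_ *: _); rewrite /F -(dcflowE flow).
Qed.

End FlowCalculus.

(** * Pullbacks of vector fields along the flow *)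

Section Transport.
Context {R : realType} {m : nat} {M : topologicalType}.
Variables (A : smooth_atlas R m M) (X : M -> 'rV[R]_m) (phi : R -> M -> M).
Hypothesis flow : is_flow A X phi.
Local Notation E := 'rV[R]_m.
Local Notation ch := (chart_at A).
Local Notation smooth_vf := (smooth_vf_on A setT).

Lemma smooth_vf_in_chart c k (v : M -> E) : charts A c -> smooth_vf v ->
  Ck k (cmap c @` cdom c) (vf_in_chart A c v).
Proof. by move=> cA /(_ c cA); rewrite setIT; exact. Qed.

Lemma smooth_vf_differentiable c (v : M -> E) x : charts A c -> cdom c x -> smooth_vf v ->
  differentiable (vf_in_chart A c v) (cmap c x).
Proof.
by move=> cA cx vs; have [+ _] := smooth_vf_in_chart 1 cA vs; apply; exact: cimg.
Qed.

Lemma smooth_field : smooth_vf X.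
Proof. by move=> c cA k; rewrite setIT; exact: (smooth_in_chart_slice flow). Qed.

Lemma tcoord_id x u : tcoord A (ch x) x u = u.
Proof. by rewrite (tcoordE flow); exact: (dcflow_id flow u (ch_dom A x)). Qed.

Lemma tcoord_tmap c t x u : charts A c -> cdom c (phi t x) ->
  tcoord A c (phi t x) (tmap A (phi t) x u) = dcflow phi (ch x) c t x u.
Proof.
move=> cA cx; rewrite (tcoordE flow) tmapE.
have cx' : cdom c (phi (0 + t) x) by rewrite add0r.
have := dcflow_comp flow u (ch_charts A x) (ch_charts A (phi t x)) cA (ch_dom A x) (ch_dom A _) cx'.
by rewrite add0r.
Qed.

Lemma dcflow_tcoord c c' t x u : charts A c -> charts A c' -> cdom c x -> cdom c' (phi t x) ->
  dcflow phi c c' t x (tcoord A c x u) = dcflow phi (ch x) c' t x u.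
Proof.
move=> cA c'A cx c'x; rewrite (tcoordE flow).
have cx0 : cdom c (phi 0 x) by rewrite (flow0 flow).
have c'x0 : cdom c' (phi (t + 0) x) by rewrite addr0.
have := dcflow_comp flow u (ch_charts A x) cA c'A (ch_dom A x) cx0 c'x0.
by rewrite addr0 (flow0 flow).
Qed.

Lemma tvect_tcoord c x u : charts A c -> cdom c x -> tvect A c x (tcoord A c x u) = u.
Proof.
move=> cA cx; have cx0 : cdom (ch x) (phi 0 x) by rewrite (flow0 flow); exact: ch_dom.
rewrite (tvectE flow) (dcflow_tcoord u cA (ch_charts A x) cx cx0).
exact: (dcflow_id flow u (ch_dom A x)).
Qed.

Lemma flowK t x : phi (- t) (phi t x) = x.
Proof. by rewrite -(flowD flow) addNr (flow0 flow). Qed.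

Lemma tmapD s t x u : tmap A (phi s) (phi t x) (tmap A (phi t) x u) = tmap A (phi (s + t)) x u.
Proof.
have cx : cdom (ch (phi s (phi t x))) (phi (s + t) x).
  by rewrite (flowD flow); exact: ch_dom.
rewrite [RHS]tmapE (flowD flow).
exact: (dcflow_comp flow u (ch_charts A x) (ch_charts A (phi t x))
  (ch_charts A (phi s (phi t x))) (ch_dom A x) (ch_dom A (phi t x)) cx).
Qed.

Lemma tmap0 x u : tmap A (phi 0) x u = u.
Proof.
rewrite tmapE (flow0 flow); exact: (dcflow_id flow u (ch_dom A x)).
Qed.

Lemma tmap_linear t x : linear (tmap A (phi t) x).
Proof. by move=> a u v; rewrite !tmapE /dcflow linearP. Qed.

Lemma differentiable_dcflow c c' t x (u : E) : charts A c -> charts A c' -> cdom c x ->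
  cdom c' (phi t x) -> is_diff u (dcflow phi c c' t x) (dcflow phi c c' t x).
Proof.
move=> cA c'A cx c'x; have d := cflow_differentiable flow cA c'A cx c'x.
have cont : continuous (dcflow phi c c' t x) by exact: diff_continuous.
by apply: DiffDef; [exact: linear_differentiable|exact: diff_lin].
Qed.

Definition pullback (v : M -> E) x t : E := tmap A (phi (- t)) (phi t x) (v (phi t x)).

Lemma pullback0 v x : pullback v x 0 = v x.
Proof. by rewrite /pullback oppr0 (flow0 flow) tmap0. Qed.

Lemma tmap_pullback v x t : tmap A (phi t) x (pullback v x t) = v (phi t x).
Proof.
rewrite /pullback; have := tmapD t (- t) (phi t x) (v (phi t x)).
by rewrite flowK addrN tmap0.
Qed.

Lemma pullbackD v x t s : pullback v x (s + t) = tmap A (phi (- t)) (phi t x) (pullback v (phi t x) s).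
Proof.
rewrite /pullback (flowD flow).
have := tmapD (- t) (- s) (phi s (phi t x)) (v (phi s (phi t x))).
by rewrite flowK => ->; rewrite opprD addrC.
Qed.

Lemma pullback_in_chart c x v s : charts A c -> cdom c x -> cdom c (phi s x) ->
  tcoord A c x (pullback v x s) =
  dcflow phi c c (- s) (phi s x) (vf_in_chart A c v (cmap c (phi s x))).
Proof.
move=> cA cx csx; have csx' : cdom c (phi (- s) (phi s x)) by rewrite flowK.
rewrite (vf_in_chartE _ _ csx) (dcflow_tcoord _ cA cA csx csx').
apply: (etrans _ (tcoord_tmap (v (phi s x)) cA csx')).
exact: (congr1 (fun y => tcoord A c y (pullback v x s)) (esym (flowK s x))).
Qed.

Lemma vf_in_chart_id (v : M -> E) x : vf_in_chart A (ch x) v (cmap (ch x) x) = v x.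
Proof. by rewrite vf_in_chartE ?tcoord_id//; exact: ch_dom. Qed.

Lemma diff_mx_coord (V : normedModType R) p q (F : V -> 'M[R]_(p, q)) (x u : V) i j :
  differentiable F x -> 'd (fun y => F y i j) x u = 'd F x u i j.
Proof.
move=> dF; rewrite -deriveE; last exact: differentiable_mx_coord.
by rewrite -deriveE// derive_mx_coord//; exact: diff_derivable.
Qed.

Lemma mdiff_coord c x u i : charts A c -> cdom c x ->
  mdiff A (fun y => cmap c y 0 i : R) x u = tcoord A c x u 0 i.
Proof.
move=> cA cx; rewrite /tcoord /mdiff.
apply: (@diff_mx_coord _ _ _ (cmap c \o cinv (ch x)) (cmap (ch x) x) u 0 i).
have cx0 : cdom c (phi 0 x) by rewrite (flow0 flow).
have := cflow_differentiable flow (ch_charts A x) cA (ch_dom A x) cx0.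
suff -> : cflow phi (ch x) c 0 = cmap c \o cinv (ch x) by [].
by apply/funext => z; rewrite /cflow (flow0 flow).
Qed.

Lemma mdiff_mdiff_coord (v : M -> E) x u i : smooth_vf v ->
  let f := fun z : M => cmap (ch x) z 0 i : R in
  mdiff A (fun y => mdiff A f y (v y)) x u =
  'D_u (vf_in_chart A (ch x) v) (cmap (ch x) x) 0 i.
Proof.
move=> vs f; set c := ch x; have cA := ch_charts A x; have cx := ch_dom A x.
have dv := smooth_vf_differentiable cA cx vs.
have nE : \forall z \near cmap c x,
   (fun z => vf_in_chart A c v z 0 i) z = ((fun y => mdiff A f y (v y)) \o cinv c) z.
  apply: filterS (near_cimg (cimg cx)) => z cz.
  by rewrite /= (mdiff_coord _ _ cA (cinv_dom cz)).
have [_ E'] := near_eq_diff nE (differentiable_mx_coord 0 i dv).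
rewrite /mdiff; apply: (etrans (congr1 (fun f => f u) E')).
by rewrite deriveE//; exact: diff_mx_coord.
Qed.

Lemma lie_bracketE (v : M -> E) x : smooth_vf v ->
  lie_bracket A X v x = local_bracket A X (ch x) v (cmap (ch x) x).
Proof.
move=> vs; apply/rowP => i; apply: (etrans (mxE _ _ _ _)).
apply: (etrans (congr2 (fun a b => a - b) (mdiff_mdiff_coord x (X x) i vs)
  (mdiff_mdiff_coord x (v x) i smooth_field))).
by rewrite /local_bracket !vf_in_chart_id !mxE.
Qed.

Lemma is_derive_pullback0 (v : M -> E) x : smooth_vf v ->
  is_derive (0 : R) (1 : R) (pullback v x) (lie_bracket A X v x).
Proof.
move=> vs; rewrite lie_bracketE//.
have dv := smooth_vf_differentiable (ch_charts A x) (ch_dom A x) vs.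
apply: near_eq_is_derive (is_derive_transport flow (ch_charts A x) (ch_dom A x) dv).
apply: filterS (near_orbit0 flow (ch_dom A x)) => s sx.
rewrite -pullback_in_chart ?tcoord_id//; [exact: ch_charts|exact: ch_dom].
Qed.

(** Both sides are the derivative at 0 of the same curve of pullbacks, read in the chart c. Chart
    independence of the bracket thus follows without second derivatives of transition maps. *)
Lemma lie_bracket_in_chart c (v : M -> E) x : charts A c -> cdom c x -> smooth_vf v ->
  vf_in_chart A c (lie_bracket A X v) (cmap c x) = local_bracket A X c v (cmap c x).
Proof.
move=> cA cx vs; rewrite vf_in_chartE// (tcoordE flow).
have cx0 : cdom c (phi 0 x) by rewrite (flow0 flow).
have dT := differentiable_dcflow (pullback v x 0) (ch_charts A x) cA (ch_dom A x) cx0.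
have h := is_derive_comp_diff (is_derive_pullback0 x vs) (ex_diff (is_diff_def := dT)).
have dv := smooth_vf_differentiable cA cx vs.
have h' := is_derive_transport flow cA cx dv.
have h'' : is_derive (0 : R) (1 : R) (dcflow phi (ch x) c 0 x \o pullback v x)
    (local_bracket A X c v (cmap c x)).
  apply: near_eq_is_derive h'; apply: filterS (near_orbit0 flow cx) => s sx.
  exact: (etrans (esym (pullback_in_chart v cA cx sx)) (tcoordE flow c x _)).
exact: (etrans (esym (congr1 (fun f => f (lie_bracket A X v x)) (@diff_val _ _ _ _ _ _ _ dT)))
  (is_derive_uniq h h'')).
Qed.

Lemma smooth_lie_bracket (v : M -> E) : smooth_vf v -> smooth_vf (lie_bracket A X v).
Proof.
move=> vs c cA k; rewrite setIT; have oU := @cimg_open _ _ _ c.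
pose Y := vf_in_chart A c X; pose V := vf_in_chart A c v.
have YS j : Ck j (cmap c @` cdom c) Y by exact: (smooth_in_chart_slice flow).
have VS j : Ck j (cmap c @` cdom c) V by exact: smooth_vf_in_chart.
have DS (F : E -> E) (u : E) : (forall j, Ck j (cmap c @` cdom c) F) ->
    Ck k (cmap c @` cdom c) (fun z => 'D_u F z).
  by move=> FS; have [_ /(_ u)] := FS k.+1.
(* In the bracket the direction of differentiation varies with the point, while [Ck] speaks of fixed
   directions; hence the expansion along the coordinate basis. *)
have h : Ck k (cmap c @` cdom c) (fun z =>
    (\sum_i Y z 0 i *: 'D_(delta_mx 0 i) V z) - (\sum_i V z 0 i *: 'D_(delta_mx 0 i) Y z)).
  apply: CkD => //; last apply: CkN => //.
    apply: Ck_bigsum => // i; apply: Ck_scale => //; first exact: Ck_mx_coord.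
    exact: DS.
  apply: Ck_bigsum => // i; apply: Ck_scale => //; first exact: Ck_mx_coord.
  exact: DS.
apply: (Ck_ext oU _ h) => z [x cx <-].
rewrite lie_bracket_in_chart// /local_bracket.
have dV : differentiable V (cmap c x) by have [+ _] := VS 1; apply; exact: cimg.
have dY : differentiable Y (cmap c x) by have [+ _] := YS 1; apply; exact: cimg.
by rewrite (derive_basis _ dV) (derive_basis _ dY).
Qed.

(** By the group law, the pullback at time s + t is a fixed linear map applied to the pullback at
    time s based at [phi t x], so the derivative at 0 suffices. Iteration gives higher derivatives
    as pullbacks of iterated brackets. *)
Lemma is_derive_pullback (v : M -> E) x t : smooth_vf v ->
  is_derive t (1 : R) (pullback v x) (pullback (lie_bracket A X v) x t).
Proof.
move=> vs; have h0 := is_derive_pullback0 (phi t x) vs.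
have c'x : cdom (ch (phi (- t) (phi t x))) (phi (- t) (phi t x)) by exact: ch_dom.
have dT := differentiable_dcflow (pullback v (phi t x) 0) (ch_charts A (phi t x))
   (ch_charts A (phi (- t) (phi t x))) (ch_dom A (phi t x)) c'x.
have h := is_derive_comp_diff h0 (ex_diff (is_diff_def := dT)).
have {}h := is_derive_eq h (congr1 (fun f => f (lie_bracket A X v (phi t x)))
  (@diff_val _ _ _ _ _ _ _ dT)).
have -> : pullback (lie_bracket A X v) x t = dcflow phi (ch (phi t x))
   (ch (phi (- t) (phi t x))) (- t) (phi t x) (lie_bracket A X v (phi t x)) by [].
have sh : is_derive t (1 : R) (fun s : R => s - t) 1.
  have := is_derive_sub (is_derive_id t (1 : R)) (is_derive_const t t (1 : R)).
  by rewrite subr0.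
have h1 : is_derive (t - t) (1 : R) (dcflow phi (ch (phi t x)) (ch (phi (- t) (phi t x))) (- t) (phi t x)
    \o pullback v (phi t x)) (dcflow phi (ch (phi t x)) (ch (phi (- t) (phi t x))) (- t) (phi t x)
    (lie_bracket A X v (phi t x))) by rewrite subrr; exact: h.
have [/derivable1_diffP d1 E1] := h1.
have := is_derive_comp_diff sh d1.
rewrite -deriveE// E1.
apply: near_eq_is_derive; near=> s.
by have E2 := pullbackD v x t (s - t); rewrite subrK in E2; exact: (esym E2).
Unshelve. all: by end_near. Qed.

End Transport.

(** * Invariance of the symplectic form under the flow *)

Section Invariance.
Context {R : realType} {m : nat} {M : topologicalType}.
Variables (A : smooth_atlas R m M) (X : M -> 'rV[R]_m) (phi : R -> M -> M).
Hypothesis flow : is_flow A X phi.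
Local Notation E := 'rV[R]_m.
Local Notation ch := (chart_at A).
Variables (sigma : M -> 'M[R]_m) (h : M -> R).
Hypothesis symp : symplectic A sigma.
Hypothesis h_smooth : smooth_fun A h.
Hypothesis hamX : hamiltonian_field A sigma h X.
Local Notation S := (form_in_chart A sigma).

Lemma bf_delta (n k : nat) (B : 'M[R]_(n, k)) i j : bf B (delta_mx 0 i) (delta_mx 0 j) = B i j.
Proof. by rewrite /bf -rowE trmx_delta -colE !mxE. Qed.

Lemma bf_expand (n k : nat) (B : 'M[R]_(n, k)) u w :
  bf B u w = \sum_i \sum_j u 0 i * w 0 j * B i j.
Proof.
rewrite {1}[u]row_sum_delta bf_suml; apply: eq_bigr => i _.
rewrite {1}[w]row_sum_delta bf_sumr; apply: eq_bigr => j _.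
by rewrite bfZl bfZr bf_delta mulrA.
Qed.

Lemma tvect_expand c x a :
  tvect A c x a = \sum_i a 0 i *: tvect A c x (delta_mx 0 i).
Proof.
rewrite /tvect {1}[a]row_sum_delta linear_sum; apply: eq_bigr => i _.
by rewrite linearZ.
Qed.

Lemma bf_form_in_chart c x a b : cdom c x ->
  bf (S c (cmap c x)) a b = form_at sigma x (tvect A c x a) (tvect A c x b).
Proof.
move=> cx; rewrite bf_expand -/(bf (sigma x) _ _).
rewrite /form_at -/(bf (sigma x) _ _) (tvect_expand c x a) (tvect_expand c x b).
rewrite bf_suml; apply: eq_bigr => i _; rewrite bf_sumr; apply: eq_bigr => j _.
by rewrite bfZl bfZr mulrA /form_in_chart mxE cmapK.
Qed.

Lemma form_tcoord c x u w : charts A c -> cdom c x ->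
  form_at sigma x u w = bf (S c (cmap c x)) (tcoord A c x u) (tcoord A c x w).
Proof. by move=> cA cx; rewrite bf_form_in_chart// !(tvect_tcoord flow). Qed.

Lemma form_alt x u w : form_at sigma x u w = - form_at sigma x w u.
Proof.
have := symp_alt symp x (u + w); have := symp_alt symp x u; have := symp_alt symp x w.
rewrite /form_at -!/(bf _ _ _) => h1 h2; rewrite !(bfDl, bfDr) => h3; lra.
Qed.

Lemma sigma_unit x : sigma x \in unitmx.
Proof.
rewrite -row_free_unit -kermx_eq0; apply/rowV0P => u /sub_kermxP us.
by apply: (symp_nondeg symp (x := x)) => w; rewrite /form_at us mul0mx mxE.
Qed.

Lemma sigmaT x : (sigma x)^T = - sigma x.
Proof.
apply/matrixP => i j; rewrite !mxE -!bf_delta.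
exact: (form_alt x (delta_mx 0 j) (delta_mx 0 i)).
Qed.

Lemma hamiltonian_in_chart c x u : charts A c -> cdom c x ->
  'D_u (h \o cinv c) (cmap c x) = bf (S c (cmap c x)) u (vf_in_chart A c X (cmap c x)).
Proof.
move=> cA cx; have cx0 : cdom (ch x) (phi 0 x) by rewrite (flow0 flow); exact: ch_dom.
have dh c' : charts A c' -> cdom c' x -> differentiable (h \o cinv c') (cmap c' x).
  by move=> c'A c'x; have [+ _] := h_smooth c'A 1; apply; exact: cimg.
have d1 := cflow_differentiable flow cA (ch_charts A x) cx cx0.
have PE : cflow phi c (ch x) 0 (cmap c x) = cmap (ch x) x by rewrite /cflow cmapK// (flow0 flow).
have d2 := dh _ (ch_charts A x) (ch_dom A x).
rewrite -PE in d2.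
have nE : \forall z \near cmap c x,
    ((h \o cinv (ch x)) \o cflow phi c (ch x) 0) z = (h \o cinv c) z.
  have hO : \forall z \near cmap c x, spacetime phi c (ch x) (0, z).
    apply: (@open_nbhs_nbhs _ _ [set z | spacetime phi c (ch x) (0, z)]).
    split; last exact: spacetimeP.
    exact: (open_slice 0 (@spacetime_open _ _ _ _ _ _ flow c (ch x))).
  apply: filterS hO => z [/= cz c'z]; rewrite /cflow /=.
  by move: c'z; rewrite (flow0 flow) => c'z; rewrite cmapK.
have [_ E'] := near_eq_diff nE (differentiable_comp d1 d2).
rewrite deriveE; last exact: dh.
apply: (etrans (congr1 (fun f => f u) E')).
apply: (etrans (congr1 (fun f => f u) (diff_comp d1 d2))).
rewrite /comp PE.
have Q := hamX x (tvect A c x u).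
rewrite -(tvect_tcoord flow (X x) cA cx) -(bf_form_in_chart _ _ cx) -(vf_in_chartE _ _ cx) in Q.
by rewrite -Q /mdiff (tvectE flow).
Qed.

Lemma form_in_chart_differentiable c x : charts A c -> cdom c x ->
  differentiable (S c) (cmap c x).
Proof.
by move=> cA cx; have [+ _] := symp_smooth symp cA 1; apply; exact: cimg.
Qed.

Lemma field_differentiable c x : charts A c -> cdom c x ->
  differentiable (vf_in_chart A c X) (cmap c x).
Proof. by move=> cA cx; exact: (smooth_vf_differentiable cA cx (smooth_field flow)). Qed.

Lemma is_derive_bf_chart c x (u : E) (w : E) : charts A c -> cdom c x ->
  'D_w (fun z => bf (S c z) u (vf_in_chart A c X z)) (cmap c x) =
  bf ('D_w (S c) (cmap c x)) u (vf_in_chart A c X (cmap c x)) +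
  bf (S c (cmap c x)) u ('D_w (vf_in_chart A c X) (cmap c x)).
Proof.
move=> cA cx.
have hS := is_derive_D w (form_in_chart_differentiable cA cx).
have hY := is_derive_D w (field_differentiable cA cx).
have hd := is_derive_bf_mx hS (is_derive_const u (cmap c x) w) hY.
by rewrite (@derive_val _ _ _ _ _ _ _ hd) bf0l add0r .
Qed.

Lemma derive_formT c x u : charts A c -> cdom c x ->
  ('D_u (S c) (cmap c x))^T = - 'D_u (S c) (cmap c x).
Proof.
move=> cA cx; have hS := is_derive_D u (form_in_chart_differentiable cA cx).
apply: (is_derive_uniq (is_derive_trmx hS)).
have -> : (fun z => (S c z)^T) = (fun z => - S c z).
  by apply/funext => z; apply/matrixP => i j; rewrite !mxE form_alt.
exact: is_derive_opp.
Qed.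

Lemma sum_rotate (I : finType) (F : I -> I -> I -> R) :
  \sum_b \sum_e \sum_a F a b e = \sum_a \sum_b \sum_e F a b e.
Proof. by under eq_bigr do rewrite exchange_big; rewrite exchange_big. Qed.

Lemma form_closed c x u v w : charts A c -> cdom c x ->
  bf ('D_u (S c) (cmap c x)) v w + bf ('D_v (S c) (cmap c x)) w u +
  bf ('D_w (S c) (cmap c x)) u v = 0.
Proof.
move=> cA cx; have dS := form_in_chart_differentiable cA cx.
pose T a b e := 'D_(delta_mx 0 a : E) (fun z => S c z b e : R) (cmap c x).
have TE u' v' w' : bf ('D_u' (S c) (cmap c x)) v' w' =
    \sum_a \sum_b \sum_e u' 0 a * v' 0 b * w' 0 e * T a b e.
  rewrite (derive_basis _ dS) /bf mulmx_sumr mulmx_suml summxE; apply: eq_bigr => a _.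
  rewrite -/(bf _ _ _) bfZm bf_expand mulr_sumr; apply: eq_bigr => b _.
  rewrite mulr_sumr; apply: eq_bigr => e _; rewrite !mulrA; congr (_ * _).
  by apply: derive_mx_coord; exact: diff_derivable.
have Tc a b e : T a b e + T b e a + T e a b = 0.
  exact: (symp_closed symp cA (cimg cx) a b e).
have T2 := etrans (TE v w u) (sum_rotate (fun a b e => v 0 b * w 0 e * u 0 a * T b e a)).
have T3 := etrans (TE w u v)
  (esym (sum_rotate (fun e a b => w 0 e * u 0 a * v 0 b * T e a b))).
apply: (etrans (congr2 (fun p q => p + q) (congr2 (fun p q => p + q) (TE u v w) T2) T3)).
rewrite -!big_split big1// => a _; rewrite -!big_split big1// => b _.
rewrite -!big_split big1// => e _ /=.
transitivity (u 0 a * v 0 b * w 0 e * (T a b e + T b e a + T e a b)); first by ring.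
by rewrite Tc mulr0.
Qed.

(** The vanishing of the Lie derivative of sigma along X, in coordinates. The symmetry of the second
    derivatives of h says that sigma(., X) is closed, and the closedness of sigma converts this into
    the stated identity. *)
Lemma lie_derivative_form c x a b : charts A c -> cdom c x ->
  let Y := vf_in_chart A c X in let z := cmap c x in
  bf (S c z) ('D_a Y z) b + bf ('D_(Y z) (S c) z) a b + bf (S c z) a ('D_b Y z) = 0.
Proof.
move=> cA cx Y z.
have sw u w : bf ('D_w (S c) z) u (Y z) + bf (S c z) u ('D_w Y z) =
    bf ('D_u (S c) z) w (Y z) + bf (S c z) w ('D_u Y z).
  apply: (etrans (esym (is_derive_bf_chart u w cA cx))).
  apply: (etrans _ (is_derive_bf_chart w u cA cx)).
  have E (u' : E) : \forall z' \near z, 'D_u' (h \o cinv c) z' = bf (S c z') u' (Y z').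
    apply: filterS (near_cimg (cimg cx)) => _ [x' cx' <-].
    exact: hamiltonian_in_chart.
  apply: (etrans (esym (near_eq_derive _ (E u)))).
  apply: (etrans _ (near_eq_derive _ (E w))).
  exact: (schwarz u w (@cimg_open _ _ _ c) (cimg cx) (h_smooth cA 2)).
have anti u w : bf (S c z) u w = - bf (S c z) w u.
  by rewrite !bf_form_in_chart// form_alt.
have danti u v w : bf ('D_u (S c) z) v w = - bf ('D_u (S c) z) w v.
  by rewrite -[LHS]bfT derive_formT// bfNm.
have alg (D1 D2 D3 D3' S1 S1' S2 : R) : D1 + D2 + D3 = 0 -> D2 + S1' = D3' + S2 ->
  S1 = - S1' -> D3 = - D3' -> S1 + D1 + S2 = 0 by lra.
exact: (alg _ _ _ _ _ _ _ (form_closed (Y z) a b cA cx) (sw b a) (anti ('D_a Y z) b)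
  (danti b (Y z) a)).
Qed.

Lemma is_derive_form_flow0 y a b :
  is_derive (0 : R) (1 : R)
    (fun s => form_at sigma (phi s y) (tmap A (phi s) y a) (tmap A (phi s) y b)) 0.
Proof.
set c := ch y; have cA := ch_charts A y; have cy := ch_dom A y.
have cy0 : cdom c (phi 0 y) by rewrite (flow0 flow).
have y0 : cmap c (phi 0 y) = cmap c y by rewrite (flow0 flow).
pose orb s := cmap c (phi s y).
have dorb : is_derive (0 : R) (1 : R) orb (vf_in_chart A c X (cmap c y)).
  by have := velocity flow cA cy0; rewrite y0.
have dS0 := form_in_chart_differentiable cA cy.
have dS : differentiable (S c) (orb 0) by rewrite /orb y0.
have dSE : 'd (S c) (orb 0) (vf_in_chart A c X (cmap c y)) =
    'D_(vf_in_chart A c X (cmap c y)) (S c) (cmap c y) by rewrite /orb y0 deriveE.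
have hS := is_derive_eq (is_derive_comp_diff dorb dS) dSE.
have hd := is_derive_bf_mx hS (is_derive_dcflow flow a cA cy) (is_derive_dcflow flow b cA cy).
have S0 : (S c \o orb) 0 = S c (cmap c y) by rewrite /= /orb y0.
rewrite S0 !(dcflow_id flow _ cy) in hd.
have hd0 := is_derive_eq hd (lie_derivative_form a b cA cy).
apply: near_eq_is_derive hd0; apply: filterS (near_orbit0 flow cy) => s sy.
by rewrite (form_tcoord _ _ cA sy) !(tcoord_tmap flow _ cA sy).
Qed.

Lemma is_derive_shift0 (W : normedModType R) (f g : R -> W) (t : R) d :
  is_derive (0 : R) (1 : R) g d -> (forall s, f (s + t) = g s) -> is_derive t (1 : R) f d.
Proof.
move=> hg fg.
have sh : is_derive t (1 : R) (fun s : R => s - t) 1.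
  by have := is_derive_sub (is_derive_id t (1 : R)) (is_derive_const t t (1 : R)); rewrite subr0.
have [/derivable1_diffP dg gd] := hg.
have dg' : differentiable g (t - t) by rewrite subrr.
have := is_derive_comp_diff sh dg'; rewrite subrr -deriveE// gd.
apply: near_eq_is_derive; near=> s.
by rewrite /= -fg subrK.
Unshelve. all: by end_near. Qed.

Lemma form_flow t y a b :
  form_at sigma (phi t y) (tmap A (phi t) y a) (tmap A (phi t) y b) = form_at sigma y a b.
Proof.
pose q t := form_at sigma (phi t y) (tmap A (phi t) y a) (tmap A (phi t) y b).
have q0 : q 0 = form_at sigma y a b by rewrite /q (flow0 flow) !(tmap0 flow).
rewrite -q0; apply: (@is_derive_0_is_cst _ q) => {}t.
apply: (is_derive_shift0 (is_derive_form_flow0 (phi t y) (tmap A (phi t) y a) (tmap A (phi t) y b))).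
by move=> s; rewrite /q !(tmapD flow) (flowD flow).
Qed.

End Invariance.

(** * The Lyapunov function *)

Section Frames.
Context {R : realType} {n : nat} {M : topologicalType}.
Local Notation m := (2 * n)%N.
Local Notation E := 'rV[R]_m.
Variables (A : smooth_atlas R m M) (X : M -> E) (phi : R -> M -> M).
Hypothesis flow : is_flow A X phi.
Local Notation ch := (chart_at A).
Variables (sigma : M -> 'M[R]_m) (h : M -> R).
Hypothesis symp : symplectic A sigma.
Hypothesis h_smooth : smooth_fun A h.
Hypothesis hamX : hamiltonian_field A sigma h X.
Variable Delta : M -> {vspace E}.
Hypothesis lagr : lagrange_distribution A sigma Delta n.
Hypothesis mono : forall x, monotone_at A sigma Delta X x.
Local Notation form := (form_at sigma).
Local Notation brk := (lie_bracket A X).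
Local Notation dsec := (dsection A Delta).
Local Notation gf := (gform A sigma Delta X).

Let flow_form := form_flow flow symp h_smooth hamX.

Lemma form_pullback v w x t :
  form x (pullback A phi v x t) (pullback A phi w x t) = form (phi t x) (v (phi t x)) (w (phi t x)).
Proof. by rewrite -(flow_form t) !(tmap_pullback flow). Qed.

(** Pulled back along the flow, two sections of [Delta] have pairing identically 0; the derivative
    of this relation at t = 0 is the symmetry. *)
Lemma bracket_form_sym v w x : dsec v -> dsec w ->
  form x (brk v x) (w x) = form x (brk w x) (v x).
Proof.
move=> [vs vD] [ws wD].
have hd := is_derive_bf (sigma x) (is_derive_pullback0 flow x vs) (is_derive_pullback0 flow x ws).
have h0 : is_derive (0 : R) (1 : R)
    (fun t => bf (sigma x) (pullback A phi v x t) (pullback A phi w x t)) 0.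
  have -> : (fun t => bf (sigma x) (pullback A phi v x t) (pullback A phi w x t)) = fun=> 0.
    by apply/funext => t; apply: etrans (form_pullback v w x t) _; exact: (lagr_isotropic lagr).
  exact: is_derive_const.
have := is_derive_uniq hd h0; rewrite !(pullback0 flow).
move=> E0; have {}E0 : form x (brk v x) (w x) + form x (v x) (brk w x) = 0 by exact: E0.
rewrite (form_alt symp x (v x) (brk w x)) in E0.
by apply/eqP; rewrite -subr_eq0; apply/eqP.
Qed.

(** Independence of the chosen sections: by symmetry each section can be moved out of the bracket,
    to the place where only its value at x counts. *)
Lemma gformE v w x : dsec v -> dsec w -> gf x (v x) (w x) = form x (brk v x) (w x).
Proof.
move=> dv dw.
have [v1 [w1 [dv1 dw1 vE wE ->]]] : [set r | exists v1 v2, [/\ dsec v1, dsec v2,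
    v1 x = v x, v2 x = w x & r = form x (brk v1 x) (v2 x)]] (gf x (v x) (w x)).
  by apply: xgetPex; exists (form x (brk v x) (w x)), v, w.
rewrite wE (bracket_form_sym x dv1 dw) vE.
exact: bracket_form_sym.
Qed.

Lemma gform0 x xi : gf x 0 xi = 0.
Proof.
rewrite /gform; case: xgetP => // r -> [v [w [dv dw v0 wE ->]]].
by rewrite (bracket_form_sym x dv dw) v0 /form_at trmx0 mulmx0 mxE.
Qed.

(* [gform] is 0 by default, so a nonzero value of g(xi, xi) provides actual sections
   through xi. *)
Lemma section_through x xi : xi \in Delta x -> xi != 0 -> exists v, dsec v /\ v x = xi.
Proof.
move=> xiD xi0; have gn0 : gf x xi xi != 0.
  by have [_ [/(_ xi xiD xi0)|/(_ xi xiD xi0)]] := mono x; [move/gt_eqF->|move/lt_eqF->].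
move: gn0; rewrite /gform; case: xgetP => [r -> [v [w [dv dw vE wE _]]] _|_].
  by exists v.
by rewrite eqxx.
Qed.

Lemma dsection_lincomb (v : 'I_n -> M -> E) (p : 'rV[R]_n) : (forall i, dsec (v i)) ->
  dsec (fun y => \sum_i p 0 i *: v i y).
Proof.
move=> dv; split=> [c cA k|x]; last first.
  by apply: memv_suml => i _; apply: memvZ; case: (dv i).
rewrite setIT; have oU := @cimg_open _ _ _ c.
have hs : Ck k (cmap c @` cdom c) (fun z => \sum_i p 0 i *: vf_in_chart A c (v i) z).
  apply: Ck_bigsum => // i; apply: Ck_scale => //; first exact: Ck_cst.
  by apply: smooth_vf_in_chart => //; case: (dv i).
apply: (Ck_ext oU _ hs) => z cz.
rewrite /vf_in_chart /tcoord /mdiff linear_sum; apply: eq_bigr => i _.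
by rewrite linearZ.
Qed.

Definition frame (v : 'I_n -> M -> E) (y : M) : 'M[R]_(n, m) := \matrix_(i, j) v i y 0 j.

Lemma frame_row v y i : row i (frame v y) = v i y.
Proof. by apply/rowP => j; rewrite !mxE. Qed.

Lemma frame_mul v y (p : 'rV[R]_n) : p *m frame v y = \sum_i p 0 i *: v i y.
Proof. by rewrite mulmx_sum_row; apply: eq_bigr => i _; rewrite frame_row. Qed.

Definition gram (v : 'I_n -> M -> E) (y : M) : 'M[R]_n :=
  frame (fun i => brk (v i)) y *m sigma y *m (frame v y)^T.

Lemma gramE v y i j : gram v y i j = form y (brk (v i) y) (v j y).
Proof. by rewrite /gram bf_rows !frame_row. Qed.

Lemma gform_frame v y p q : (forall i, dsec (v i)) ->
  gf y (p *m frame v y) (q *m frame v y) = bf (gram v y) p q.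
Proof.
move=> dv; rewrite !frame_mul.
have dp := dsection_lincomb p dv; have dq := dsection_lincomb q dv.
have sumr u (c : 'rV[R]_n) : form y u (\sum_i c 0 i *: v i y) = \sum_i c 0 i * form y u (v i y).
  rewrite /form_at -/(bf _ _ _) bf_sumr; apply: eq_bigr => i _; exact: bfZr.
have h1 j : form y (brk (fun y => \sum_i p 0 i *: v i y) y) (v j y) =
    \sum_i p 0 i * gram v y i j.
  apply: (etrans (bracket_form_sym y dp (dv j))); rewrite sumr; apply: eq_bigr => i _.
  by rewrite gramE (bracket_form_sym y (dv i) (dv j)).
rewrite (gformE y dp dq) sumr bf_expand exchange_big; apply: eq_bigr => j _.
rewrite h1 mulr_sumr; apply: eq_bigr => i _.
by rewrite mulrA [q 0 j * _]mulrC.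
Qed.

Lemma Delta_frame v y : (forall i, dsec (v i)) -> row_free (frame v y) ->
  forall w, w \in Delta y <-> exists p, w = p *m frame v y.
Proof.
move=> dv fv w; split=> [wD|[p ->]]; last first.
  by rewrite frame_mul; apply: memv_suml => i _; apply: memvZ; case: (dv i).
apply: (lagrangian_maximal (sigma_unit symp y) fv).
  by apply/matrixP => i j; rewrite bf_rows !frame_row [RHS]mxE; apply: (lagr_isotropic lagr);
    [case: (dv i)|case: (dv j)].
apply/matrixP => i j; rewrite ord1 bf_rows row_id frame_row [RHS]mxE.
by apply: (lagr_isotropic lagr) => //; case: (dv j).
Qed.

Lemma frame_free v y : gram v y \in unitmx -> row_free (frame v y).
Proof.
move=> Gu; apply/row_freeP.
exists (- (sigma y *m (frame (fun i => brk (v i)) y)^T *m (invmx (gram v y))^T)).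
rewrite mulmxN !mulmxA.
have -> : frame v y *m sigma y *m (frame (fun i => brk (v i)) y)^T = - (gram v y)^T.
  by rewrite /gram !trmx_mul trmxK (sigmaT symp) mulNmx mulmxN opprK mulmxA.
by rewrite mulNmx opprK -trmx_mul mulVmx// trmx1.
Qed.

(** With eps = 1 or -1 the positive and the negative definite case are handled together. *)
Definition definite (eps : R) (G : 'M[R]_n) := forall p : 'rV[R]_n, p != 0 -> 0 < eps * bf G p p.

Lemma definite_unit eps G : definite eps G -> G \in unitmx.
Proof.
move=> dG; rewrite -row_free_unit -kermx_eq0; apply/rowV0P => u /sub_kermxP us.
by apply/eqP/negPn/negP => /dG; rewrite /bf us mul0mx mxE mulr0 ltxx.
Qed.

(** The frame has to consist of global sections, through which [gform] is defined; the definiteness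
    of g supplies one through each vector of a basis of [Delta x]. *)
Lemma frame_exists x : exists v, (forall i, dsec (v i)) /\ row_free (frame v x).
Proof.
have bx := vbasisP (Delta x).
have dimx := lagr_dim lagr x.
pose b (i : 'I_n) := (vbasis (Delta x))`_i.
have bi i : b i \in Delta x /\ b i != 0.
  have ib : b i \in vbasis (Delta x).
    by apply: mem_nth; rewrite size_tuple dimx.
  split; first exact: vbasis_mem.
  apply: contraTneq (basis_free bx) => b0; apply/negP => /free_not0 h'.
  by have := h' (b i) ib; rewrite b0 eqxx.
have /choice[v vP] i : exists v, dsec v /\ v x = b i.
  by have [b1 b2] := bi i; exact: section_through.
exists v; split; first by move=> i; case: (vP i).
rewrite -kermx_eq0; apply/rowV0P => p /sub_kermxP; rewrite frame_mul => p0.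
pose b' : n.-tuple E := tcast dimx (vbasis (Delta x)).
have fb : free b' by rewrite /b' val_tcast; exact: basis_free bx.
apply/rowP => i; rewrite mxE.
move/freeP: fb => fb; apply: (fb (fun i => p 0 i)); rewrite -[RHS]p0; apply: eq_bigr => j _.
by rewrite /b' val_tcast; have [_ ->] := vP j.
Qed.

Lemma mono_sign x : exists eps, (eps = 1 \/ eps = -1) /\
  forall v, (forall i, dsec (v i)) -> row_free (frame v x) -> definite eps (gram v x).
Proof.
have Dn v p : (forall i, dsec (v i)) -> row_free (frame v x) -> p != 0 ->
    (p *m frame v x) \in Delta x /\ p *m frame v x != 0.
  move=> dv fv p0; split; first by apply/(Delta_frame dv fv); exists p.
  apply: contra_neq p0 => p0; apply: (row_free_inj fv).
  by rewrite mul0mx.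
have [_ [pos|neg]] := mono x.
  exists 1; split; first by left.
  move=> v dv fv p p0; have [h1 h2] := Dn v p dv fv p0.
  by rewrite mul1r -gform_frame//; exact: pos.
exists (-1); split; first by right.
move=> v dv fv p p0; have [h1 h2] := Dn v p dv fv p0.
by rewrite mulN1r oppr_gt0 -gform_frame//; exact: neg.
Qed.

Lemma form_continuous v w : smooth_vf_on A setT v -> smooth_vf_on A setT w ->
  continuous (fun y => form y (v y) (w y)).
Proof.
move=> vs ws x; set c := ch x; have cA := ch_charts A x; have cx := ch_dom A x.
pose q z := bf (form_in_chart A sigma c z) (vf_in_chart A c v z) (vf_in_chart A c w z).
have cq : {for cmap c x, continuous q}.
  have cS := differentiable_continuous (form_in_chart_differentiable symp cA cx).
  have cv := differentiable_continuous (smooth_vf_differentiable cA cx vs).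
  have cw := differentiable_continuous (smooth_vf_differentiable cA cx ws).
  apply: (@cvg_mx_coord _ _ _ _ _
    (fun z => vf_in_chart A c v z *m form_in_chart A sigma c z *m (vf_in_chart A c w z)^T)
    _ 0 0).
  exact: (cvg_mulmx (cvg_mulmx cv cS) (cvg_trmx cw)).
have cc : {for x, continuous (q \o cmap c)}.
  by apply: continuous_comp; [exact: cmap_continuous|exact: cq].
have nE : \forall y \near x, (q \o cmap c) y = form y (v y) (w y).
  apply: filterS (near_cdom cx) => y cy.
  by rewrite /= /q !(vf_in_chartE _ _ cy) (form_tcoord flow sigma _ _ cA cy).
rewrite /continuous_at -(nbhs_singleton nE).
by apply: cvg_trans cc; apply: near_eq_cvg.
Qed.

Lemma gram_continuous v : (forall i, dsec (v i)) -> continuous (gram v).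
Proof.
move=> dv x; apply: cvg_mx => i j.
rewrite gramE; under eq_fun do rewrite gramE.
apply: form_continuous; last by case: (dv j).
by apply: (smooth_lie_bracket flow); case: (dv i).
Qed.

(** By monotonicity g is definite at every nearby point with some sign. Its value on one fixed
    coordinate vector is continuous and nonzero at x, and this identifies the sign with the one at
    x. *)
Lemma near_definite v x eps : (forall i, dsec (v i)) -> (eps = 1 \/ eps = -1) ->
  definite eps (gram v x) -> \forall y \near x, definite eps (gram v y).
Proof.
move=> dv eps1 dx.
have Gc := @gram_continuous v dv x.
have un := near_unitmx Gc (definite_unit dx).
(* For n = 0 there is no vector to test on, and the claim is vacuous. *)
have [n0|npos] := posnP n.
  near=> y; move=> p p0; suff p00 : p = 0 by rewrite p00 eqxx in p0.
  apply/rowP => j; have := leq_ltn_trans (leq0n j) (ltn_ord j).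
  by rewrite [X in (0 < X)%N]n0.
pose e0 : 'rV[R]_n := delta_mx 0 (Ordinal npos).
have e00 : e0 != 0.
  apply/eqP => /rowP/(_ (Ordinal npos)); rewrite !mxE !eqxx/=; apply/eqP; exact: oner_neq0.
have gc : {for x, continuous (fun y => eps * bf (gram v y) e0 e0)}.
  apply: cvgM; first exact: cvg_cst.
  under eq_fun do rewrite bf_delta.
  rewrite bf_delta; exact: cvg_mx_coord.
have gpos : \forall y \near x, 0 < eps * bf (gram v y) e0 e0.
  have := dx e0 e00; exact: (cvgr_gt _ gc).
near=> y.
have Gy : gram v y \in unitmx by near: y.
have gy : 0 < eps * bf (gram v y) e0 e0 by near: y.
have [eps' [eps'1 h']] := mono_sign y.
have dy := h' v dv (frame_free Gy).
suff -> : eps = eps' by [].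
have := dy e0 e00; have := gy; case: eps1 => ->; case: eps'1 => -> // h1 h2; lra.
Unshelve. all: by end_near. Qed.

End Frames.

Section Lyapunov.
Context {R : realType} {n : nat} {M : topologicalType}.
Local Notation m := (2 * n)%N.
Local Notation E := 'rV[R]_m.
Variables (A : smooth_atlas R m M) (X : M -> E) (phi : R -> M -> M).
Hypothesis flow : is_flow A X phi.
Local Notation ch := (chart_at A).
Variables (sigma : M -> 'M[R]_m) (h : M -> R).
Hypothesis symp : symplectic A sigma.
Hypothesis h_smooth : smooth_fun A h.
Hypothesis hamX : hamiltonian_field A sigma h X.
Variable Delta : M -> {vspace E}.
Hypothesis lagr : lagrange_distribution A sigma Delta n.
Hypothesis mono : forall x, monotone_at A sigma Delta X x.
Local Notation form := (form_at sigma).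
Local Notation brk := (lie_bracket A X).
Local Notation dsec := (dsection A Delta).
Local Notation gf := (gform A sigma Delta X).
Local Notation gram := (gram A X sigma).
Local Notation frame := (@frame R n M).

Let gframe := gform_frame flow symp h_smooth hamX lagr.
Let brk_sym := bracket_form_sym flow symp h_smooth hamX lagr.
Let flow_form := form_flow flow symp h_smooth hamX.

(* In a frame with Gram matrix G this is |p G^-1 p^T|, with p the coordinates of
   sigma(., w); every xi yields a lower bound. *)
Definition lyapunov (y : M) (w : E) : R :=
  sup [set r | exists xi, xi \in Delta y /\ r = 2 * form y xi w - `|gf y xi xi|].

Lemma sup_of_max (S : set R) a : S a -> ubound S a -> sup S = a.
Proof.
move=> Sa ua; apply/eqP; rewrite eq_le; apply/andP; split.
  by apply: ge_sup => //; exists a.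
by apply: ub_le_sup => //; exists a.
Qed.

Lemma gram_sym v y p q : (forall i, dsec (v i)) -> bf (gram v y) p q = bf (gram v y) q p.
Proof.
move=> dv; rewrite -[RHS]bfT; congr (bf _ p q); apply/matrixP => i j.
by rewrite [RHS]mxE !gramE; exact: brk_sym.
Qed.

(** As |g| = eps g, the bound is eps G(q - eps p, q - eps p) >= 0, with equality at p = eps q. The
    second part uses the trial vector eps p, which brings the lower bound into the form of the
    function in [touching_function]. *)
Lemma lyapunov_frame y w v eps q : (forall i, dsec (v i)) -> eps = 1 \/ eps = -1 ->
  definite eps (gram v y) -> (forall p, bf (gram v y) q p = form y (p *m frame v y) w) ->
  lyapunov y w = eps * bf (gram v y) q q /\
  forall p, eps * (2 * form y (p *m frame v y) w - bf (gram v y) p p) <= lyapunov y w.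
Proof.
move=> dv eps1 dG qE.
have ee : eps * eps = 1 by case: eps1 => ->; rewrite ?mulr1// mulrNN mulr1.
have fv := frame_free symp (definite_unit dG).
have pos p : 0 <= eps * bf (gram v y) p p.
  have [->|p0] := eqVneq p 0; first by rewrite bf0l mulr0.
  by apply: ltW; exact: dG.
have absE p : `|bf (gram v y) p p| = eps * bf (gram v y) p p.
  have e1 : `|eps| = 1 by case: eps1 => ->; rewrite ?normrN normr1.
  by rewrite -[LHS]mul1r -e1 -normrM ger0_norm.
have valE p : 2 * form y (p *m frame v y) w - `|gf y (p *m frame v y) (p *m frame v y)| =
    2 * bf (gram v y) q p - eps * bf (gram v y) p p.
  by rewrite gframe// absE qE.
have le p : 2 * bf (gram v y) q p - eps * bf (gram v y) p p <= eps * bf (gram v y) q q.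
  have := pos (q - eps *: p); rewrite !(bfDl, bfDr, bfNl, bfNr, bfZl, bfZr) (gram_sym y p q dv).
  move: (bf (gram v y) q q) (bf (gram v y) q p) (bf (gram v y) p p) => a b c.
  have -> : eps * (a - eps * b + (- (eps * b) - - (eps * (eps * c)))) =
     eps * a - 2 * (eps * eps) * b + eps * (eps * eps) * c by ring.
  by rewrite ee; lra.
have E0 : lyapunov y w = eps * bf (gram v y) q q.
  apply: sup_of_max.
    exists ((eps *: q) *m frame v y); split.
      by apply/(Delta_frame symp lagr dv fv); exists (eps *: q).
    rewrite valE bfZr !bfZl bfZr.
    have -> : eps * (eps * (eps * bf (gram v y) q q)) = eps * eps * (eps * bf (gram v y) q q) by ring.
    by rewrite ee; lra.
  move=> _ [xi [/(Delta_frame symp lagr dv fv)[p ->] ->]].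
  by rewrite valE.
split => // p; rewrite E0 -qE.
have := le (eps *: p); rewrite bfZr bfZl bfZr.
move: (bf (gram v y) q q) (bf (gram v y) q p) (bf (gram v y) p p) => a b c.
have -> : 2 * (eps * b) - eps * (eps * (eps * c)) = 2 * (eps * b) - eps * eps * (eps * c) by ring.
rewrite ee; lra.
Qed.

Definition momentum v y w : 'rV[R]_n := (frame v y *m sigma y *m w^T)^T *m invmx (gram v y).

Lemma momentumP v y w p : gram v y \in unitmx ->
  bf (gram v y) (momentum v y w) p = form y (p *m frame v y) w.
Proof.
move=> Gu; rewrite /bf /momentum mulmxKV// -trmx_mul mxE /form_at.
by rewrite !mulmxA.
Qed.

(** Near a given point a single frame and a single sign serve, and there the supremum equals an
    explicit continuous expression. *)
Lemma lyapunov_field_continuous : continuous (fun y => lyapunov y (X y)).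
Proof.
move=> x.
have [v [dv fv]] := frame_exists lagr mono x.
have [eps [eps1 hv]] := mono_sign flow symp h_smooth hamX lagr mono x.
have dx := hv v dv fv.
have nd := near_definite flow symp h_smooth hamX lagr mono dv eps1 dx.
have Gc := @gram_continuous _ _ _ _ _ _ flow _ symp _ v dv x.
have uc : {for x, continuous (fun y => (frame v y *m sigma y *m (X y)^T)^T)}.
  apply: cvg_trmx; apply: cvg_mx => i j.
  have E0 y : (frame v y *m sigma y *m (X y)^T) i j = form y (v i y) (X y).
    rewrite -[X y in LHS]trmxK trmxK ord1.
    have := bf_rows (sigma y) (frame v y) (X y) i 0.
    by rewrite frame_row row_id.
  rewrite E0; under eq_fun do rewrite E0.
  apply: (form_continuous flow symp); first by case: (dv i).
  exact: (smooth_field flow).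
have Gi : {for x, continuous (fun y => invmx (gram v y))}.
  exact: (cvg_invmx (definite_unit dx) Gc).
have qc : {for x, continuous (fun y => momentum v y (X y))} by exact: (cvg_mulmx uc Gi).
have kc : {for x, continuous (fun y => eps * bf (gram v y) (momentum v y (X y)) (momentum v y (X y)))}.
  apply: cvgM; first exact: cvg_cst.
  apply: (@cvg_mx_coord _ _ _ _ _ (fun y => momentum v y (X y) *m gram v y *m (momentum v y (X y))^T) _ 0 0).
  exact: (cvg_mulmx (cvg_mulmx qc Gc) (cvg_trmx qc)).
have nE : \forall y \near x, eps * bf (gram v y) (momentum v y (X y)) (momentum v y (X y)) =
    lyapunov y (X y).
  apply: filterS nd => y dy.
  have [-> _] := lyapunov_frame dv eps1 dy (fun p => momentumP (X y) p (definite_unit dy)).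
  by [].
rewrite /continuous_at -(nbhs_singleton nE).
by apply: cvg_trans kc; apply: near_eq_cvg.
Qed.

Lemma jacobi_curve_frame v x t : (forall i, dsec (v i)) -> gram v (phi t x) \in unitmx ->
  forall w, w \in jacobi_curve A Delta phi x t <->
    exists p, w = p *m (\matrix_(i, j) pullback A phi (v i) x t 0 j).
Proof.
move=> dv Gu w.
pose L : {linear E -> E} := HB.pack (tmap A (phi (- t)) (phi t x))
  (GRing.isLinear.Build _ _ _ _ (tmap A (phi (- t)) (phi t x)) (@tmap_linear _ _ _ A phi (- t) (phi t x))).
have LE u : linfun (tmap A (phi (- t)) (phi t x)) u = L u by exact: (lfunE L u).
have pE p : L (p *m frame v (phi t x)) = p *m (\matrix_(i, j) pullback A phi (v i) x t 0 j).
  rewrite frame_mul linear_sum mulmx_sum_row; apply: eq_bigr => i _.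
  rewrite linearZ; congr (_ *: _); by apply/rowP => j; rewrite !mxE.
have DF := Delta_frame symp lagr dv (frame_free symp Gu).
split.
  move=> /memv_imgP[u /DF[p ->] ->]; exists p.
  by rewrite LE pE.
move=> [p ->]; rewrite -pE -LE; apply: memv_img; apply/DF; by exists p.
Qed.

End Lyapunov.

(** * Strictly convex lower bounds along the flow *)

Section Touching.
Context {R : realType} {n : nat} {M : topologicalType}.
Local Notation m := (2 * n)%N.
Local Notation E := 'rV[R]_m.
Variables (A : smooth_atlas R m M) (X : M -> E) (phi : R -> M -> M).
Hypothesis flow : is_flow A X phi.
Local Notation ch := (chart_at A).
Variables (sigma : M -> 'M[R]_m) (h : M -> R).
Hypothesis symp : symplectic A sigma.
Hypothesis h_smooth : smooth_fun A h.
Hypothesis hamX : hamiltonian_field A sigma h X.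
Variable Delta : M -> {vspace E}.
Hypothesis lagr : lagrange_distribution A sigma Delta n.
Hypothesis mono : forall x, monotone_at A sigma Delta X x.
Local Notation form := (form_at sigma).
Local Notation brk := (lie_bracket A X).
Local Notation dsec := (dsection A Delta).
Local Notation gf := (gform A sigma Delta X).
Local Notation gram := (gram A X sigma).
Local Notation frame := (@frame R n M).

Let gframe := gform_frame flow symp h_smooth hamX lagr.
Local Notation lyap := (lyapunov A X sigma Delta).
Local Notation jac := (jacobi_curve A Delta phi).

Definition pframe (v : 'I_n -> M -> E) (x : M) (t : R) : 'M[R]_(n, m) :=
  \matrix_(i, j) pullback A phi (v i) x t 0 j.

Lemma pframe_row v x t i : row i (pframe v x t) = pullback A phi (v i) x t.
Proof. by apply/rowP => j; rewrite !mxE. Qed.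

Lemma pframe0 v x : pframe v x 0 = frame v x.
Proof. by apply/row_matrixP => i; rewrite pframe_row frame_row (pullback0 flow). Qed.

Lemma is_derive_pframe v x t : (forall i, smooth_vf_on A setT (v i)) ->
  is_derive t (1 : R) (pframe v x) (pframe (fun i => brk (v i)) x t).
Proof.
move=> vs; apply/is_derive_mxP => i j; rewrite mxE; under eq_fun do rewrite mxE.
exact: ((is_derive_mxP _ _ _ _).1 (is_derive_pullback flow x t (vs i)) 0 j).
Qed.

Lemma pframe_form v w x t :
  pframe v x t *m sigma x *m (pframe w x t)^T =
  frame v (phi t x) *m sigma (phi t x) *m (frame w (phi t x))^T.
Proof.
apply/matrixP => i j; rewrite !bf_rows !pframe_row !frame_row.
exact: (form_pullback flow symp h_smooth hamX).
Qed.

Lemma tmap_pframe v x t p : tmap A (phi t) x (p *m pframe v x t) = p *m frame v (phi t x).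
Proof.
pose L : {linear E -> E} := HB.pack (tmap A (phi t) x)
  (GRing.isLinear.Build _ _ _ _ (tmap A (phi t) x) (@tmap_linear _ _ _ A phi t x)).
rewrite -[LHS]/(L (p *m pframe v x t)) mulmx_sum_row linear_sum frame_mul.
apply: eq_bigr => i _; rewrite linearZ pframe_row; congr (_ *: _).
exact: (tmap_pullback flow).
Qed.

(** The computation takes place in the fixed symplectic space T_xM, with a frame of [Delta] pulled
    back along the orbit of x. Negative curvature makes [touching_function] applicable, and the
    invariance of sigma reads its result as a lower bound for the supremum at [phi s x]. *)
Lemma lyapunov_touching x w0 : negative_curvature_at A sigma Delta X phi x -> w0 != 0 ->
  exists (m0 m1 : R -> R) (m2 : R),
  [/\ forall s, is_derive s (1 : R) m0 (m1 s), is_derive (0 : R) (1 : R) m1 m2, 0 < m2,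
      m0 0 = lyap x w0 &
      \forall s \near (0 : R), m0 s <= lyap (phi s x) (tmap A (phi s) x w0)].
Proof.
move=> neg w0n0.
have [v [dv fv]] := frame_exists lagr mono x.
have [eps [eps1 hv]] := mono_sign flow symp h_smooth hamX lagr mono x.
have dx := hv v dv fv.
have nd := near_definite flow symp h_smooth hamX lagr mono dv eps1 dx.
have ee : eps * eps = 1 by case: eps1 => ->; rewrite ?mulr1// mulrNN mulr1.
(* Each derivative of the pulled-back frame is the pullback of one more bracket with X. *)
pose b1 i := brk (v i); pose b2 i := brk (b1 i); pose b3 i := brk (b2 i).
have vs i : smooth_vf_on A setT (v i) by case: (dv i).
have bs u : (forall i, smooth_vf_on A setT (u i)) ->
   forall i : 'I_n, smooth_vf_on A setT (brk (u i)).
  by move=> us i; exact: (smooth_lie_bracket flow).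
have b1s := bs _ vs; have b2s := bs _ b1s; have b3s := bs _ b2s.
pose e := pframe v x; pose e1 := pframe b1 x; pose e2 := pframe b2 x; pose e3 := pframe b3 x.
have de t : is_derive t (1 : R) e (e1 t) by exact: is_derive_pframe.
have de1 t : is_derive t (1 : R) e1 (e2 t) by exact: is_derive_pframe.
have de2 t : is_derive t (1 : R) e2 (e3 t) by exact: is_derive_pframe.
have ce3 : {for (0 : R), continuous e3} by exact: is_derive_continuous (is_derive_pframe x 0 b3s).
have OmT := sigmaT symp x.
have Omu := sigma_unit symp x.
have isoe t : e t *m sigma x *m (e t)^T = 0.
  rewrite /e pframe_form; apply/matrixP => i j; rewrite bf_rows !frame_row [RHS]mxE.
  by apply: (lagr_isotropic lagr); [case: (dv i)|case: (dv j)].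
have GE t : speed_gram (sigma x) e e1 t = gram v (phi t x).
  by rewrite /speed_gram /e1 /e pframe_form.
have AE : gramA (sigma x) e e1 = gram v x by rewrite /gramA GE (flow0 flow).
have Au : gramA (sigma x) e e1 \in unitmx by rewrite AE; exact: definite_unit dx.
have e0E : e 0 = frame v x by exact: pframe0.
have DF := Delta_frame symp lagr dv fv.
(* A nonzero w0 excludes n = 0, so there is a nonzero vector of [Delta x] on which negativity of the
   curvature can be tested. *)
have npos : (0 < n)%N.
  rewrite lt0n; apply: contra_neq w0n0 => n0; apply/rowP => j.
  by have := leq_ltn_trans (leq0n j) (ltn_ord j); rewrite [X in (0 < 2 * X)%N]n0.
pose C := curvature_operator A sigma Delta X phi x.
have inD (y : 'rV[R]_n) : y *m frame v x \in Delta x by apply/DF; exists y.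
pose xi (y : 'rV[R]_n) : subvs_of (Delta x) := vsproj (Delta x) (y *m frame v x).
have xiE y : vsval (xi y) = y *m frame v x by rewrite /xi vsprojK.
have xi0 y : y != 0 -> xi y != 0.
  apply: contra_neq => y0; apply: (row_free_inj fv); rewrite mul0mx -xiE y0.
  exact: linear0.
(* A curvature operator exists: otherwise its default value 0 would have to be negative. *)
have isC : is_curvature_operator A sigma X phi C.
  rewrite /C /curvature_operator; case: xgetP => [C' -> //|noC].
  exfalso; pose d0 : 'rV[R]_n := delta_mx 0 (Ordinal npos).
  have d00 : d0 != 0.
    apply/eqP => /rowP/(_ (Ordinal npos)); rewrite !mxE !eqxx/=; apply/eqP; exact: oner_neq0.
  have := neg (xi d0) (xi0 _ d00); rewrite /curvature_form /curvature_operator.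
  rewrite xgetPN ?zero_lfunE ?linear0; last first.
    by move=> C' C'P; exact: (noC C').
  by rewrite (gform0 flow symp h_smooth hamX lagr) mul0r ltxx.
have /choice[r rE] i : exists r : 'rV[R]_n, vsval (C (xi (delta_mx 0 i))) = r *m frame v x.
  by apply/DF; exact: subvsP.
(* The matrix of the curvature operator in the frame at x. *)
pose rho : 'M[R]_n := \matrix_i r i.
have CE y : vsval (C (xi y)) = y *m rho *m frame v x.
  have -> : xi y = \sum_i y 0 i *: xi (delta_mx 0 i).
    rewrite /xi {1}[y]row_sum_delta mulmx_suml linear_sum; apply: eq_bigr => i _.
    by rewrite -scalemxAl linearZ.
  rewrite !linear_sum [y *m rho]mulmx_sum_row mulmx_suml; apply: eq_bigr => i _.
  by rewrite !linearZ/= rE rowK scalemxAl.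
have ndt : \forall t \near (0 : R), definite eps (gram v (phi t x)).
  have cont0 : {for (0 : R), continuous (fun t => phi t x)} by exact: (orbit_continuous flow).
  have nd0 : \forall y \near phi 0 x, definite eps (gram v y) by rewrite (flow0 flow).
  exact: (cont0 _ nd0).
have JE : \forall t \near (0 : R), forall w, w \in jac x t <-> exists p, w = p *m e t.
  apply: filterS ndt => t dt.
  exact: (jacobi_curve_frame symp lagr dv (definite_unit dt)).
have PA := projection_acceleration OmT de de1 de2 ce3 isoe Au Omu JE.
have [_ [K hK]] := isC.
have rhoS : 3^-1 *: (rho *m gramA (sigma x) e e1) = schwarzian (sigma x) e e1 e2 e3.
  apply: (curvature_schwarzian (C := K) OmT de de1 de2 ce3 isoe Au).
  apply: filterS2 PA hK => t PAt hKt y.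
  have := hKt (xi y); rewrite xiE CE -e0E -(PAt y).
  exact.
have negR p : p != 0 -> eps * bf (rho *m gramA (sigma x) e e1) p p < 0.
  move=> p0; have := neg (xi p) (xi0 _ p0); rewrite /curvature_form -/C CE xiE.
  rewrite !gframe// bf_mull AE => h1.
  have h2 := dx p p0.
  have h3 : (eps * bf (rho *m gram v x) p p) * (eps * bf (gram v x) p p) < 0.
    have -> : eps * bf (rho *m gram v x) p p * (eps * bf (gram v x) p p) =
      eps * eps * (bf (rho *m gram v x) p p * bf (gram v x) p p) by ring.
    by rewrite ee mul1r.
  by rewrite pmulr_llt0 in h3.
have posA p : p != 0 -> 0 < eps * bf (gramA (sigma x) e e1) p p by rewrite AE; exact: dx.
have [p [m1 [m2 [dm0 dm1 m2pos pE]]]] :=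
  touching_function OmT de de1 de2 isoe Au Omu rhoS posA negR w0n0.
(* Invariance of sigma: a pairing in T_xM with w0 is a pairing at [phi s x] with the transported
   vector. *)
have fE s q : bf (sigma x) (q *m e s) w0 =
    form (phi s x) (q *m frame v (phi s x)) (tmap A (phi s) x w0).
  rewrite -tmap_pframe; apply: esym; exact: (form_flow flow symp h_smooth hamX).
exists (fun s => eps * (2 * bf (sigma x) (p s *m e s) w0
   - bf (speed_gram (sigma x) e e1 s) (p s) (p s))), m1, m2; split => //.
  rewrite AE e0E in pE.
  have [-> _] := lyapunov_frame flow symp h_smooth hamX lagr dv eps1 dx pE.
  rewrite e0E -pE GE (flow0 flow); congr (_ * _).
  by rewrite mulrDl mul1r addrK.
apply: filterS ndt => s ds.
have [_ hl] := lyapunov_frame flow symp h_smooth hamX lagr dv eps1 ds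
  (fun q => momentumP (tmap A (phi s) x w0) q (definite_unit ds)).
by rewrite fE GE; exact: hl.
Qed.

End Touching.

(** * Equilibria and limit sets *)

Section ConvexTouching.
Context {R : realType}.

(** Strict convexity is asked only infinitesimally at the point of contact: m1 is differentiable at
    0 with positive derivative. *)
Definition convex_touching (f : R -> R) : Prop := exists (m0 m1 : R -> R) (m2 : R),
  [/\ forall s, is_derive s (1 : R) m0 (m1 s), is_derive (0 : R) (1 : R) m1 m2, 0 < m2,
      m0 0 = f 0 & \forall s \near (0 : R), m0 s <= f s].

(** Under the line, m0 - k s has a local maximum at 0, so m1 0 = k. As m2 > 0, m1 exceeds k just to
    the right of 0, and by the mean value theorem m0 - k s increases there, against the maximum. *)
Lemma convex_touching_not_below_line f k : convex_touching f ->
  (\forall s \near (0 : R), f s <= f 0 + k * s) -> False.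
Proof.
move=> [m0 [m1 [m2 [d0 d1 m2p m00 le]]]] lin.
have : \forall s \near (0 : R), m0 s <= m0 0 + k * s.
  by apply: filterS2 le lin => s h1 h2; rewrite m00; exact: le_trans h1 h2.
move=> /nbhs_ballP[e /= e0 he].
have hb s : - e < s -> s < e -> m0 s - k * s <= m0 0.
  move=> s1 s2; have : ball 0 e s by rewrite /ball/= sub0r normrN ltr_norml s1 s2.
  by move/he; lra.
pose g s := m0 s - k * s.
have dg s : is_derive s (1 : R) g (m1 s - k).
  have h1 := is_derive_mul (is_derive_const k s (1 : R)) (is_derive_id s (1 : R)).
  have h2 : is_derive s (1 : R) (fun y => k * y) k.
    by apply: (is_derive_eq h1); rewrite mulr1 mul0r addr0.
  exact: (is_derive_sub (d0 s) h2).
have ee : - e < e by lra.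
have g0 : is_derive (0 : R) (1 : R) g 0.
  apply: (@derive1_at_max R g (- e) e 0 (ltW ee)).
  - by move=> t _; have [] := dg t.
  - by rewrite in_itv/=; apply/andP; split; lra.
  - by move=> t; rewrite in_itv/= => /andP[t1 t2]; have := hb t t1 t2; rewrite /g; lra.
have m1k : m1 0 = k by have := is_derive_uniq g0 (dg 0); lra.
have : \forall s \near (0 : R)^', 0 < s^-1 * (m1 s - k).
  have [dm em] := d1; have := dm; rewrite /derivable => /cvg_ex[l hl].
  have lE : l = m2 by rewrite -em; apply: esym; exact: (cvg_lim _ hl).
  move: hl; rewrite lE => hl.
  have := hl _ (lt_nbhsr m2p); rewrite !near_simpl.
  apply: filterS => s /=; rewrite /shift/= addr0 m1k.
  suff -> : s *: (1 : R) = s by [].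
  by rewrite /GRing.scale/= mulr1.
move=> /nbhs_ballP[r /= r0 hr].
pose s0 := Num.min e r / 2.
have mp : 0 < Num.min e r by rewrite lt_min e0 r0.
have s0p : 0 < s0 by rewrite /s0; lra.
have [s0e s0r] : s0 < e /\ s0 < r.
  have : s0 < Num.min e r by rewrite /s0; lra.
  by rewrite lt_min => /andP[].
have cg : {within `[0, s0], continuous g}.
  apply: continuous_subspaceT => y; exact: is_derive_continuous (dg y).
have [c cin cE] := MVT s0p (fun x _ => dg x) cg.
move: cin; rewrite in_itv/= => /andP[c0 cs].
have cpos : 0 < m1 c - k.
  have : ball 0 r c by rewrite /ball/= sub0r normrN gtr0_norm//; exact: lt_trans s0r.
  move/hr => /(_ (lt0r_neq0 c0)); by rewrite pmulr_rgt0// invr_gt0.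
have hs := hb s0 (lt_trans _ s0p) s0e.
have : 0 < (m1 c - k) * (s0 - 0) by rewrite mulr_gt0// subr0.
rewrite -cE /g => h1.
have : - e < 0 by lra.
move/hs; lra.
Qed.

(* If f is not constant, subtracting a line of small slope creates an interior
   maximum. *)
Lemma bounded_convex_touching f C : continuous f -> (forall t, `|f t| <= C) ->
  (forall t, convex_touching (fun s => f (s + t))) -> False.
Proof.
move=> fc fb ft.
have nomax k p q r : p < q -> q < r -> f p - k * p < f q - k * q ->
    f r - k * r < f q - k * q -> False.
  move=> pq qr hp hr.
  have gc : {within `[p, r], continuous (fun t => f t - k * t)}.
    apply: continuous_subspaceT => y.
    apply: cvgB; first exact: fc.
    apply: cvgM; [exact: cvg_cst|exact: cvg_id].
  have [t] := EVT_max (ltW (lt_trans pq qr)) gc.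
  rewrite in_itv/= => /andP[pt tr] tmax.
  have hq : f q - k * q <= f t - k * t by apply: tmax; rewrite in_itv/= !ltW.
  have tp : p < t by rewrite lt_neqAle pt andbT; apply/eqP => E; rewrite -E in hq; lra.
  have tr' : t < r by rewrite lt_neqAle tr andbT; apply/eqP => E; rewrite E in hq; lra.
  apply: (@convex_touching_not_below_line _ k (ft t)).
  have c0 : {for 0, continuous (fun s : R => s + t)}.
    by apply: cvgD; [exact: cvg_id|exact: cvg_cst].
  have : \forall s \near (0 : R), (s + t) \in `]p, r[.
    have : \forall y \near 0 + t, y \in `]p, r[.
      by rewrite add0r; apply: near_in_itvoo; rewrite in_itv/= tp tr'.
    exact: c0.
  apply: filterS => s; rewrite in_itv/= => /andP[s1 s2].
  have : f (s + t) - k * (s + t) <= f t - k * t by apply: tmax; rewrite in_itv/= !ltW.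
  by rewrite add0r mulrDr; lra.
have C0 : 0 <= C by apply: le_trans (fb 0); exact: normr_ge0.
have fle t : - C <= f t <= C by rewrite -ler_norml.
have [[b fneq]|/forallNP fcst] := pselect (exists b, f b != f 0); last first.
  apply: (@convex_touching_not_below_line _ 0 (ft 0)).
  have h s : f (s + 0) <= f (0 + 0) + 0 * s.
    by rewrite mul0r !addr0; have /negP/negPn/eqP -> := fcst s.
  by apply: (filterS _ (@filterT _ (nbhs (0 : R)) _)) => s _; exact: h.
have [a [c [ac fac]]] : exists a c : R, a < c /\ f a != f c.
  have [b0|b0|b0] := ltgtP b (0 : R); first by exists b, 0.
    by exists 0, b; split => //; rewrite eq_sym.
  by rewrite b0 eqxx in fneq.
(* The slope k is half the mean slope between a and c, so f - k t still grows from a to c. The third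
   point r satisfies k (r - c) = 2C + 1, which exceeds the oscillation 2C of f; thus c beats both
   ends and the maximum is interior. The decreasing case is the mirror image, with slope -k and r to
   the left of a. *)
have [lt|gt|eq] := ltgtP (f a) (f c); last by rewrite eq eqxx in fac.
  pose k := (f c - f a) / (2 * (c - a)).
  have kp : 0 < k by rewrite divr_gt0// ?mulr_gt0//; lra.
  have kE : k * (c - a) = (f c - f a) / 2 by rewrite /k; field; lra.
  pose r := c + (2 * C + 1) / k.
  have rE : k * (r - c) = 2 * C + 1 by rewrite /r; field; rewrite gt_eqF.
  apply: (@nomax k a c r) => //.
  - by rewrite /r ltrDl divr_gt0//; lra.
  - by move: kE; rewrite mulrBr; lra.
  - move: rE; rewrite mulrBr; have /andP[] := fle r; have /andP[] := fle c; lra.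
pose k := (f a - f c) / (2 * (c - a)).
have kp : 0 < k by rewrite divr_gt0// ?mulr_gt0//; lra.
have kE : k * (c - a) = (f a - f c) / 2 by rewrite /k; field; lra.
pose r := a - (2 * C + 1) / k.
have rE : k * (a - r) = 2 * C + 1 by rewrite /r; field; rewrite gt_eqF.
apply: (@nomax (- k) r a c) => //.
- by rewrite /r gtrDl oppr_lt0 divr_gt0//; lra.
- move: rE; rewrite mulrBr; have /andP[] := fle r; have /andP[] := fle a; lra.
- by move: kE; rewrite mulrBr; lra.
Qed.

End ConvexTouching.

(** * The flow at zeros of the field, and the linearization *)

Section Equilibria.
Context {R : realType} {m : nat} {M : topologicalType}.
Variables (A : smooth_atlas R m M) (X : M -> 'rV[R]_m) (phi : R -> M -> M).
Hypothesis flow : is_flow A X phi.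
Local Notation E := 'rV[R]_m.
Local Notation ch := (chart_at A).

(** The derivative in s at 0 of the relation phi t (phi s x) = phi (s + t) x. *)
Lemma tmap_field t x : tmap A (phi t) x (X x) = X (phi t x).
Proof.
have h0 : is_derive (0 : R) (1 : R) (fun s => cmap (ch x) (phi s x)) (X x).
  have cx0 : cdom (ch x) (phi 0 x) by rewrite (flow0 flow); exact: ch_dom.
  apply: (is_derive_eq (velocity flow (ch_charts A x) cx0)).
  by rewrite (flow0 flow) (vf_in_chart_id flow).
have dP := cflow_differentiable flow (ch_charts A x) (ch_charts A (phi t x))
  (ch_dom A x) (ch_dom A (phi t x)).
have dP' : differentiable (cflow phi (ch x) (ch (phi t x)) t) (cmap (ch x) (phi 0 x)).
  by rewrite (flow0 flow).
have h1 := is_derive_comp_diff h0 dP'.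
have h2 : is_derive (0 : R) (1 : R) (fun s => cmap (ch (phi t x)) (phi (s + t) x))
   (tmap A (phi t) x (X x)).
  have h3 : is_derive (0 : R) (1 : R)
      (cflow phi (ch x) (ch (phi t x)) t \o (fun s => cmap (ch x) (phi s x)))
      (tmap A (phi t) x (X x)).
    apply: (is_derive_eq h1); rewrite tmapE /dcflow.
    exact: (congr1 (fun y => 'd (cflow phi (ch x) (ch (phi t x)) t) (cmap (ch x) y) (X x))
      (flow0 flow x)).
  apply: near_eq_is_derive h3; apply: filterS (near_orbit0 flow (ch_dom A x)) => s sx.
  by rewrite /= /cflow cmapK// addrC (flowD flow).
have h4 := is_derive_shift0 (f := fun s => cmap (ch (phi t x)) (phi s x)) h2 (fun s => erefl).
exact: (is_derive_uniq h4 (flow_velocity flow t x)).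
Qed.

Lemma tmap_zero t x : tmap A (phi t) x 0 = 0.
Proof. by rewrite tmapE /dcflow linear0. Qed.

Lemma field0_orbit t x : X x = 0 -> X (phi t x) = 0.
Proof. by move=> x0; rewrite -tmap_field x0 tmap_zero. Qed.

(** X vanishes along the whole orbit, because the flow transports X to itself, so the coordinates of
    the orbit are constant while it stays in the chart at x. This settles short times, and every t
    is an integer multiple of a short time. *)
Lemma equilibrium_fixed t x : X x = 0 -> phi t x = x.
Proof.
move=> x0; have vel s : cdom (ch x) (phi s x) ->
    is_derive s (1 : R) (fun s => cmap (ch x) (phi s x)) 0.
  move=> cs; apply: (is_derive_eq (velocity flow (ch_charts A x) cs)).
  rewrite vf_in_chartE// (field0_orbit _ x0).
  by rewrite (tcoordE flow) /dcflow linear0.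
have /nbhs_ballP[e /= e0 he] := near_orbit0 flow (ch_dom A x).
have dom s : - e < s -> s < e -> cdom (ch x) (phi s x).
  by move=> s1 s2; apply: he; rewrite /ball/= sub0r normrN ltr_norml s1 s2.
have small s : 0 <= s -> s < e -> phi s x = x.
  move=> s0 se; have cs : cdom (ch x) (phi s x) by apply: dom => //; lra.
  rewrite -(cmapK cs) -[RHS](cmapK (ch_dom A x)); congr (cinv _ _).
  apply/rowP => i; pose f r : R := cmap (ch x) (phi r x) 0 i.
  have df r : - e < r -> r < e -> is_derive r (1 : R) f 0.
    move=> r1 r2; have /is_derive_mxP/(_ 0 i) := vel r (dom r r1 r2).
    by rewrite mxE.
  have cf : {within `[0, s], continuous f}.
    apply: continuous_in_subspaceT => r; rewrite inE/= in_itv/= => /andP[r1 r2].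
    by apply: (is_derive_continuous (df r _ _)); lra.
  have df' r : r \in `]0, s[ -> is_derive r (1 : R) f 0.
    by rewrite in_itv/= => /andP[r1 r2]; apply: df; lra.
  have [c _] := MVT_segment s0 df' cf.
  by rewrite mul0r => /subr0_eq; rewrite /f (flow0 flow).
have smallN s : - e < s -> s < e -> phi s x = x.
  move=> s1 s2; have [s0|s0] := leP 0 s; first exact: small.
  have h : phi (- s) x = x by apply: small; lra.
  by rewrite -{1}h -(flowD flow) addrN (flow0 flow).
have iter k s : phi s x = x -> phi (k%:R * s) x = x.
  move=> h; elim: k => [|k IH]; first by rewrite mul0r (flow0 flow).
  by rewrite -natr1 mulrDl mul1r (flowD flow) h.
pose k := Num.bound `|t / e|.
have hk : `|t / e| < k.+1%:R.
  apply: (@lt_trans _ _ k%:R); last by rewrite ltr_nat.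
  exact: (archi_boundP (normr_ge0 _)).
have k0 : (0 : R) < k.+1%:R by rewrite ltr0n.
have -> : t = k.+1%:R * (t / k.+1%:R) by rewrite mulrC divfK// gt_eqF.
apply: iter; have : `|t / k.+1%:R| < e.
  move: hk; rewrite !normrM !normfV (gtr0_norm e0) (gtr0_norm k0).
  by rewrite ltr_pdivrMr// ltr_pdivrMr// mulrC.
by rewrite ltr_norml => /andP[]; exact: smallN.
Qed.

Lemma linearizationE x u :
  'D_u (vf_in_chart A (ch x) X) (cmap (ch x) x) = u *m linearization A X x.
Proof.
rewrite deriveEjacobian//.
exact: (smooth_vf_differentiable (ch_charts A x) (ch_dom A x) (smooth_field flow)).
Qed.

Lemma is_derive_tmap_equilibrium t x u : X x = 0 ->
  is_derive t (1 : R) (fun s => tmap A (phi s) x u) (tmap A (phi t) x (u *m linearization A X x)).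
Proof.
move=> x0; have fx s := equilibrium_fixed s x0.
have h0 : is_derive (0 : R) (1 : R) (fun s => tmap A (phi s) x u) (u *m linearization A X x).
  have := is_derive_dcflow flow u (ch_charts A x) (ch_dom A x).
  rewrite linearizationE; apply: near_eq_is_derive.
  near=> s; rewrite tmapE.
  exact: (congr1 (fun y => dcflow phi (ch x) (ch y) s x u) (esym (fx s))).
have dT := differentiable_dcflow flow (tmap A (phi 0) x u) (ch_charts A x) (ch_charts A x)
   (ch_dom A x) (c' := ch x) (t := t).
have cx : cdom (ch x) (phi t x) by rewrite fx; exact: ch_dom.
have {}dT := dT cx.
have h1 := is_derive_comp_diff h0 (ex_diff (is_diff_def := dT)).
have {}h1 := is_derive_eq h1 (congr1 (fun f => f (u *m linearization A X x))
  (@diff_val _ _ _ _ _ _ _ dT)).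
have tE w : dcflow phi (ch x) (ch x) t x w = tmap A (phi t) x w.
  by rewrite tmapE; exact: (congr1 (fun y => dcflow phi (ch x) (ch y) t x w) (esym (fx t))).
rewrite -tE; apply: (is_derive_shift0 h1) => s.
rewrite /= tE addrC; have := tmapD flow t s x u; rewrite [phi s x]fx => <-.
by [].
Unshelve. all: by end_near. Qed.

End Equilibria.

Section ImaginaryEigenvector.
Context {R : realType} {m : nat}.

Lemma imaginary_eigenvector (L : 'M[R]_m) (z : R[i]) :
  eigenvalue (map_mx (real_complex R) L) z -> complex.Re z = 0 ->
  exists a b : 'rV[R]_m, [/\ a *m L = - complex.Im z *: b, b *m L = complex.Im z *: a
    & a != 0 \/ b != 0].
Proof.
move=> /eigenvalueP[v vL v0] rez.
have ReD (s : seq 'I_m) (F : 'I_m -> R[i]) :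
    complex.Re (\sum_(i <- s) F i) = \sum_(i <- s) complex.Re (F i).
  elim: s => [|i s IH]; first by rewrite !big_nil.
  by rewrite !big_cons -IH; case: (F i) => ? ?; case: (\sum_(j <- s) _).
have ImD (s : seq 'I_m) (F : 'I_m -> R[i]) :
    complex.Im (\sum_(i <- s) F i) = \sum_(i <- s) complex.Im (F i).
  elim: s => [|i s IH]; first by rewrite !big_nil.
  by rewrite !big_cons -IH; case: (F i) => ? ?; case: (\sum_(j <- s) _).
have ReM (x : R[i]) (r : R) : complex.Re (x * real_complex R r) = complex.Re x * r.
  by case: x => a b /=; rewrite mulr0 subr0.
have ImM (x : R[i]) (r : R) : complex.Im (x * real_complex R r) = complex.Im x * r.
  by case: x => a b /=; rewrite mulr0 add0r.
have Rez (x : R[i]) : complex.Re (z * x) = - complex.Im z * complex.Im x.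
  by move: rez; case: x z {vL} => [c d] [p q] /= ->; rewrite mul0r sub0r mulNr.
have Imz (x : R[i]) : complex.Im (z * x) = complex.Im z * complex.Re x.
  by move: rez; case: x z {vL Rez} => [c d] [p q] /= ->; rewrite mul0r add0r.
exists (map_mx (@complex.Re R) v), (map_mx (@complex.Im R) v); split.
- apply/rowP => j; have /rowP/(_ j) := vL; rewrite !mxE => /(congr1 (@complex.Re R)).
  rewrite Rez ReD => <-; apply: eq_bigr => k _.
  by rewrite !mxE ReM.
- apply/rowP => j; have /rowP/(_ j) := vL; rewrite !mxE => /(congr1 (@complex.Im R)).
  rewrite Imz ImD => <-; apply: eq_bigr => k _.
  by rewrite !mxE ImM.
have [r0|] := eqVneq (map_mx (@complex.Re R) v) 0; last by left.
right; apply: contra_neq v0 => i0; apply/rowP => j; rewrite mxE.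
move/rowP/(_ j): r0; move/rowP/(_ j): i0; rewrite !mxE.
by case: (v 0 j) => a b /= -> ->.
Qed.

Lemma hyperbolic_unit (L : 'M[R]_m) : hyperbolic L -> L \in unitmx.
Proof.
move=> hL; rewrite -row_free_unit -kermx_eq0; apply/rowV0P => u /sub_kermxP us.
apply/eqP/negPn/negP => u0.
have /eqP : complex.Re (real_complex R (0 : R)) != 0.
  apply: hL; rewrite eigenvalue_map; apply/eigenvalueP; exists u => //.
  by rewrite us scale0r.
by [].
Qed.

End ImaginaryEigenvector.

Section QuadraticRotation.
Context {R : realType} {m : nat}.

(** In the derivative, the mixed terms Q(f, g) and Q(g, f) coming from the two summands cancel. *)
Lemma quadratic_rotation_constant (Q : 'M[R]_m) (f g : R -> 'rV[R]_m) (w : R) :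
  (forall t, is_derive t (1 : R) f (- w *: g t)) ->
  (forall t, is_derive t (1 : R) g (w *: f t)) ->
  forall t, bf Q (f t) (f t) + bf Q (g t) (g t) = bf Q (f 0) (f 0) + bf Q (g 0) (g 0).
Proof.
move=> df dg t.
have dS s : is_derive s (1 : R) (fun t => bf Q (f t) (f t) + bf Q (g t) (g t)) 0.
  apply: (is_derive_eq (is_derive_add (is_derive_bf Q (df s) (df s)) (is_derive_bf Q (dg s) (dg s)))).
  rewrite !(bfZl, bfZr); move: (bf Q (f s) (g s)) (bf Q (g s) (f s)) => a b; ring.
exact: (@is_derive_0_is_cst R (fun t => bf Q (f t) (f t) + bf Q (g t) (g t)) t 0 dS).
Qed.

End QuadraticRotation.

Section Hyperbolic.
Context {R : realType} {n : nat} {M : topologicalType}.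
Local Notation m := (2 * n)%N.
Local Notation E := 'rV[R]_m.
Variables (A : smooth_atlas R m M) (X : M -> E) (phi : R -> M -> M).
Hypothesis flow : is_flow A X phi.
Local Notation ch := (chart_at A).
Variables (sigma : M -> 'M[R]_m) (h : M -> R).
Hypothesis symp : symplectic A sigma.
Hypothesis h_smooth : smooth_fun A h.
Hypothesis hamX : hamiltonian_field A sigma h X.
Variable Delta : M -> {vspace E}.
Hypothesis lagr : lagrange_distribution A sigma Delta n.
Hypothesis mono : forall x, monotone_at A sigma Delta X x.
Local Notation lyap := (lyapunov A X sigma Delta).

Lemma lyapunov_quadratic x : exists Q : 'M[R]_m, forall w, lyap x w = bf Q w w.
Proof.
have [v [dv fv]] := frame_exists lagr mono x.
have [eps [eps1 hv]] := mono_sign flow symp h_smooth hamX lagr mono x.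
have dx := hv v dv fv.
pose N := (sigma x)^T *m (frame v x)^T *m invmx (gram A X sigma v x).
exists (N *m (eps *: gram A X sigma v x) *m N^T) => w.
have [-> _] := lyapunov_frame flow symp h_smooth hamX lagr dv eps1 dx
  (fun q => momentumP w q (definite_unit dx)).
have -> : momentum A X sigma v x w = w *m N.
  by rewrite /momentum !trmx_mul trmxK /N !mulmxA.
by rewrite bf_mull bf_mulr -bfZm -scalemxAr -scalemxAl.
Qed.

(** At a fixed point the touching property concerns a single quadratic form along the linearized
    flow. Lower bounds for the real and the imaginary part of the eigenvector add up, whereas the
    sum they touch is constant and so lies under a line of slope 0. *)
Lemma hyperbolic_equilibrium x : negative_curvature_at A sigma Delta X phi x -> X x = 0 ->
  hyperbolic (linearization A X x).
Proof.
move=> neg x0 z ez; apply/eqP => rez.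
have [a [b [aL bL ab]]] := imaginary_eigenvector ez rez.
set w := complex.Im z in aL bL.
have fx s := equilibrium_fixed flow s x0.
have [Q QE] := lyapunov_quadratic x.
pose T u s : E := tmap A (phi s) x u.
have dT u t := is_derive_tmap_equilibrium flow t u x0.
have TZ t c u : tmap A (phi t) x (c *: u) = c *: tmap A (phi t) x u.
  have := tmap_linear A phi t x c u 0; rewrite !addr0 => ->.
  by rewrite [X in _ + X]tmap_zero addr0.
have da t : is_derive t (1 : R) (T a) (- w *: T b t).
  by apply: (is_derive_eq (dT a t)); rewrite aL TZ.
have db t : is_derive t (1 : R) (T b) (w *: T a t).
  by apply: (is_derive_eq (dT b t)); rewrite bL TZ.
have cst := quadratic_rotation_constant Q da db.
have touch u : u != 0 -> convex_touching (fun s => bf Q (T u s) (T u s)).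
  move=> u0; have [m0 [m1 [m2 [d0 d1 m2p m00 le]]]] :=
    lyapunov_touching flow symp h_smooth hamX lagr mono neg u0.
  exists m0, m1, m2; split=> //.
    by rewrite m00 QE /T (tmap0 flow).
  by apply: filterS le => s; rewrite fx QE.
have zero u : u = 0 -> forall s, bf Q (T u s) (T u s) = 0.
  by move=> -> s; rewrite /T tmap_zero bf0l.
suff : convex_touching (fun s => bf Q (T a s) (T a s) + bf Q (T b s) (T b s)).
  move=> tS; apply: (@convex_touching_not_below_line _ _ 0 tS).
  apply: (filterS _ (@filterT _ (nbhs (0 : R)) _)) => s _.
  have cl (p q r : R) : p = q -> p <= q + 0 * r by move=> ->; rewrite mul0r addr0.
  exact: (cl _ _ _ (cst s)).
(* [lyapunov_touching] requires a nonzero vector. If one part of the eigenvector vanishes, its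
   summand is identically 0 and the other part alone provides the bound. *)
have [a0|an0] := eqVneq a 0.
  have [//|bn0] := ab; first by rewrite a0 eqxx.
  suff -> : (fun s => bf Q (T a s) (T a s) + bf Q (T b s) (T b s)) =
    (fun s => bf Q (T b s) (T b s)) by exact: touch.
  by apply/funext => s; rewrite (zero _ a0) add0r.
have [b0|bn0] := eqVneq b 0.
  suff -> : (fun s => bf Q (T a s) (T a s) + bf Q (T b s) (T b s)) =
    (fun s => bf Q (T a s) (T a s)) by exact: touch.
  by apply/funext => s; rewrite (zero _ b0) addr0.
have [m0 [m1 [m2 [d0 d1 m2p m00 le]]]] := touch a an0.
have [n0 [n1 [n2 [e0 e1 n2p n00 le']]]] := touch b bn0.
exists (fun s => m0 s + n0 s), (fun s => m1 s + n1 s), (m2 + n2); split.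
- by move=> s; exact: is_derive_add (d0 s) (e0 s).
- exact: is_derive_add d1 e1.
- exact: addr_gt0.
- by rewrite m00 n00.
- by apply: filterS2 le le' => s; exact: lerD.
Qed.

End Hyperbolic.

(** Composed with L^-1, the map V has the identity as differential at z0. Near z0 its error is at
    most half of |z - z0|, so a zero z satisfies |z - z0| <= |z - z0| / 2. *)
Lemma isolated_zero (R : realType) (m : nat) (V : 'rV[R]_m -> 'rV[R]_m) (L : 'M[R]_m) z0 :
  differentiable V z0 -> (forall u, 'D_u V z0 = u *m L) -> L \in unitmx -> V z0 = 0 ->
  \forall z \near z0, V z = 0 -> z = z0.
Proof.
move=> dV DV Lu V0.
pose P : {linear 'rV[R]_m -> 'rV[R]_m} := mulmxr (invmx L).
have Pc : continuous P.
  move=> u; have c1 : {for u, continuous (@id 'rV[R]_m)} by exact: cvg_id.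
  have c2 := @cvg_cstmx R _ _ (nbhs_filter u) m m (invmx L).
  exact: (cvg_mulmx c1 c2).
have dP : differentiable P (V z0) by exact: linear_differentiable.
have dPV := differentiable_comp dV dP.
have dPVE u : 'd (P \o V) z0 u = u.
  apply: (etrans (congr1 (fun f => f u) (diff_comp dV dP))).
  have e1 : 'd V z0 u = u *m L by rewrite -DV; exact: esym (deriveE u dV).
  have e2 : P (u *m L) = u by exact: mulmxK.
  apply: (etrans (congr1 (fun f => f ('d V z0 u)) (diff_lin (V z0) Pc))).
  by rewrite e1 e2.
have h2 : (0 : R) < 2^-1 by rewrite invr_gt0.
have near0 : \forall u \near (0 : 'rV[R]_m), `|P (V (u + z0)) - (P (V z0) + u)| <= 2^-1 * `|u|.
  have /eqaddoP h := diff_locally dPV; have := h _ h2; apply: filterS => u.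
  rewrite /shift /= => le; apply: le_trans le.
  by rewrite le_eqVlt; apply/orP; left; apply/eqP; congr (`|_ - (_ + _)|); exact: esym.
have near2 : \forall z \near z0,
   `|P (V (z - z0 + z0)) - (P (V z0) + (z - z0))| <= 2^-1 * `|z - z0|.
  move: near0; rewrite (near_shift z0); apply: filterS => z.
  by rewrite /comp/shift sub0r.
apply: filterS near2 => z le Vz.
have {}le : `|z - z0| <= 2^-1 * `|z - z0|.
  by move: le; rewrite subrK Vz V0 linear0 sub0r normrN add0r.
have : `|z - z0| <= 0 by have := normr_ge0 (z - z0); lra.
by rewrite normr_le0 subr_eq0 => /eqP.
Qed.

(** * Omega-limit sets and repeated crossings *)

Section OmegaLimit.
Context {R : realType} {M : topologicalType}.
Implicit Type c : R -> M.

Definition omega_limit c : set M :=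
  [set y | forall N : set M, nbhs y N -> forall T : R, exists2 t, T <= t & N (c t)].

Lemma omega_limit_closure c T : omega_limit c `<=` closure [set c t | t in [set t : R | T <= t]].
Proof.
move=> y oy N /oy/(_ T)[t Tt Nt]; exists (c t); split => //.
by exists t.
Qed.

Lemma omega_limit_cluster c (s : nat -> R) (K : set M) : compact K ->
  (forall k, k%:R <= s k) -> (forall k, K (c (s k))) -> omega_limit c `&` K !=set0.
Proof.
move=> cK sk Ks.
have PF : ProperFilter ((fun k => c (s k)) @ \oo) by exact: fmap_proper_filter.
have FK : ((fun k => c (s k)) @ \oo) K by exists 0%N => // k _ /=; exact: Ks.
have [y [Ky cy]] := cK _ PF FK.
exists y; split => // N Ny T.
have FT : ((fun k => c (s k)) @ \oo) [set c t | t in [set t : R | T <= t]].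
  have := nbhs_infty_ger T; apply: filterS => k Tk /=.
  by exists (s k) => //=; exact: le_trans (sk k).
have [_ [[t Tt <-] Nt]] := cy _ _ FT Ny.
by exists t.
Qed.

(** If there were no such time after T, the curve would be in B exactly when it is in D from T on.
    On a segment between a time in B and a later time outside B, the preimage of B would be open,
    closed, nonempty and proper. *)
Lemma crossing c (B D : set M) : continuous c -> open B -> closed D -> B `<=` D ->
  (forall T : R, exists2 t, T <= t & B (c t)) ->
  (forall T : R, exists2 t, T <= t & ~ B (c t)) ->
  forall T : R, exists2 t, T <= t & D (c t) /\ ~ B (c t).
Proof.
move=> cc oB cD BD inB outB T; apply: contrapT => no.
have DB t : T <= t -> D (c t) -> B (c t).
  by move=> Tt Dt; apply: contrapT => nB; apply: no; exists t.
have [t1 T1 B1] := inB T; have [t2 T2 B2] := outB t1.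
apply: B2; pose I : set R := `[t1, t2]%classic.
pose S := I `&` c @^-1` B.
suff SI : S = I.
  have : I t2 by rewrite /I/= in_itv/= T2 lexx.
  by rewrite -SI => -[].
apply: (@segment_connected R t1 t2).
- by exists t1; split => //; rewrite /I/= in_itv/= lexx.
- by exists (c @^-1` B) => //; apply: open_comp.
- exists (c @^-1` D); first by apply: closed_comp.
  apply/seteqP; split=> t [It Bt]; split => //; first exact: BD.
  apply: DB => //; move: It; rewrite /I/= in_itv/= => /andP[h _].
  exact: le_trans h.
Qed.

End OmegaLimit.

Lemma compact_closed_ball (R : realType) (m : nat) (z0 : 'rV[R]_m) (r : R) : 0 < r ->
  compact [set z | `|z0 - z| <= r].
Proof.
move=> r0; apply: bounded_closed_compact.
  exists (r + `|z0|); split; first exact: num_real.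
  move=> k rk z /= zr; have -> : z = z0 - (z0 - z) by rewrite opprB addrC subrK.
  apply: le_trans (ler_normD z0 (- (z0 - z))) _; rewrite normrN.
  by apply: le_trans (ltW rk); rewrite [r + _]addrC lerD2l.
have := @closed_ball_closed R 'rV[R]_m z0 r.
by rewrite closed_ballE.
Qed.

(** * Convergence to an isolated equilibrium *)

Section Convergence.
Context {R : realType} {m : nat} {M : topologicalType}.
Variables (A : smooth_atlas R m M) (X : M -> 'rV[R]_m) (phi : R -> M -> M).
Hypothesis hausM : hausdorff_space M.
Hypothesis flow : is_flow A X phi.
Local Notation E := 'rV[R]_m.
Local Notation ch := (chart_at A).
Local Notation omega x := (omega_limit (fun t => phi t x)).

Lemma omega_limit_flow x y s : omega x y -> omega x (phi s y).
Proof.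
move=> oy N Ns T; have [t Tt Nt] := oy _ (@flow_continuous _ _ _ _ _ _ flow s y N Ns) (T - s).
exists (s + t); first by lra.
by rewrite (flowD flow).
Qed.

(** Without convergence the orbit would return close to y and leave a small ball around y again and
    again. It would then visit the compact shell between the open ball B and the closed ball D at
    arbitrarily late times, and an omega-limit point in the shell would be a second zero of X near
    y. *)
Lemma converges_to_isolated_equilibrium x y : omega x y ->
  (forall p, omega x p -> X p = 0) -> linearization A X y \in unitmx ->
  phi t x @[t --> +oo] --> y.
Proof.
move=> oy o0 Lu N Ny.
set c := ch y; have cA := ch_charts A y; have cy : cdom c y := ch_dom A y.
set z0 := cmap c y; pose V := vf_in_chart A c X.
have iz : \forall z \near z0, V z = 0 -> z = z0.
  apply: (@isolated_zero _ _ _ (linearization A X y)) => //.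
  - exact: (smooth_vf_differentiable cA cy (smooth_field flow)).
  - by move=> u; exact: (linearizationE flow).
  - by rewrite /V (vf_in_chart_id flow); exact: o0.
have Nz : \forall z \near z0, N (cinv c z).
  apply: (cinv_continuous (cimg cy)); rewrite -/z0 /z0 cmapK//.
have near3 : \forall z \near z0, [/\ V z = 0 -> z = z0, N (cinv c z) & (cmap c @` cdom c) z].
  by apply: filterS3 iz Nz (near_cimg (cimg cy)) => z.
move: near3 => /nbhs_ballP[e /= e0 he].
pose r := e / 2; have r0 : 0 < r by rewrite /r; lra.
have re : r < e by rewrite /r; lra.
have hr z : `|z0 - z| <= r -> [/\ V z = 0 -> z = z0, N (cinv c z) & (cmap c @` cdom c) z].
  by move=> zr; apply: he; rewrite -ball_normE /=; exact: le_lt_trans re.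
pose B : set M := [set p | cdom c p /\ `|z0 - cmap c p| < r].
pose D : set M := cinv c @` [set z | `|z0 - z| <= r].
have oB : open B.
  rewrite openE => p [cp pr].
  have h1 : nbhs (cmap c p) [set z | `|z0 - z| < r].
    have -> : [set z | `|z0 - z| < r] = ball z0 r by rewrite -ball_normE.
    by apply: open_nbhs_nbhs; split; [exact: ball_open|rewrite -ball_normE].
  exact: (filterI (near_cdom cp) (cmap_continuous cp h1)).
have cD : compact D.
  apply: continuous_compact; last exact: compact_closed_ball.
  apply: continuous_in_subspaceT => z; rewrite inE => /hr[_ _ cz].
  exact: cinv_continuous.
have BD : B `<=` D by move=> p [cp pr]; exists (cmap c p); [exact: ltW|exact: cmapK].
have BN : B `<=` N by move=> p [cp /ltW/hr[_ + _]]; rewrite cmapK.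
have By : nbhs y B by apply: open_nbhs_nbhs; split => //; split => //; rewrite subrr normr0.
apply: contrapT => nN.
have outB T : exists2 t, T <= t & ~ B (phi t x).
  apply: contrapT => no; apply: nN.
  have : \forall t \near +oo, T <= t by apply: nbhs_pinfty_ge; rewrite num_real.
  apply: filterS => t Tt; apply: contrapT => nNt; apply: no.
  by exists t => // /BN.
(* D is compact as the image of a closed coordinate ball; the Hausdorff property makes it closed in
   M. *)
have cr := crossing (@orbit_continuous _ _ _ _ _ _ flow x) oB (compact_closed hausM cD) BD
  (fun T => oy B By T) outB.
have /choice[s sP] k : exists t : R, k%:R <= t /\ (D `&` ~` B) (phi t x).
  by have [t h1 h2] := cr k%:R; exists t.
have cDB : compact (D `&` ~` B) by apply: compact_closedI => //; exact: open_closedC.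
have [p [op [[z zr zp] nBp]]] 
  := @omega_limit_cluster _ _ (fun t => phi t x) _ _ cDB (fun k => proj1 (sP k)) (fun k => proj2 (sP k)).
have [Vz _ cz] := hr z zr.
apply: nBp; rewrite -zp; split; first exact: cinv_dom.
rewrite cinvK// Vz ?subrr ?normr0//.
rewrite /V /vf_in_chart zp (o0 _ op) (tcoordE flow) /dcflow; exact: linear0.
Qed.

End Convergence.

Theorem theorem1 (R : realType) (n : nat) (M : topologicalType)
    (hausM : hausdorff_space M) (countM : @second_countable M)
    (A : smooth_atlas R (2 * n) M)
    (sigma : M -> 'M[R]_(2 * n)) (symp : symplectic A sigma)
    (Delta : M -> {vspace 'rV[R]_(2 * n)})
    (lagr : lagrange_distribution A sigma Delta n)
    (h : M -> R) (h_smooth : smooth_fun A h)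
    (X : M -> 'rV[R]_(2 * n)) (hamX : hamiltonian_field A sigma h X)
    (phi : R -> M -> M) (complX : is_flow A X phi)
    (mono : forall x, monotone_at A sigma Delta X x)
    (x0 : M)
    (cpt : compact (closure [set phi t x0 | t in [set t : R | 0 <= t]]))
    (neg : forall x, closure [set phi t x0 | t in [set t : R | 0 <= t]] x ->
       negative_curvature_at A sigma Delta X phi x) :
  exists xinf : M,
    [/\ phi t x0 @[t --> +oo] --> xinf,
        X xinf = 0
      & hyperbolic (linearization A X xinf)].
Proof.
set K := closure _ in cpt neg.
have oK y : omega_limit (fun t => phi t x0) y -> K y by exact: omega_limit_closure.
have [y [oy Ky]] : omega_limit (fun t => phi t x0) `&` K !=set0.
  apply: (@omega_limit_cluster _ _ _ (fun k => k%:R) _ cpt) => // k.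
  by apply: subset_closure; exists k%:R => //=; exact: ler0n.
have zero p : omega_limit (fun t => phi t x0) p -> X p = 0.
  move=> op; apply: contrapT => /eqP Xp.
  (* The omega-limit set is invariant for negative times as well, so the full orbit of p stays in K.
     The function f below is therefore bounded on all of R, and negative curvature is available at
     every time. *)
  have oK' t : K (phi t p) by apply: oK; exact: (@omega_limit_flow _ _ _ _ _ _ complX _ _ t op).
  pose f t := lyapunov A X sigma Delta (phi t p) (X (phi t p)).
  have lc := lyapunov_field_continuous complX symp h_smooth hamX lagr mono.
  have fc : continuous f.
    move=> t; apply: (@continuous_comp _ _ _ (fun t => phi t p)
      (fun y => lyapunov A X sigma Delta y (X y))); last exact: lc.
    exact: (orbit_continuous complX).
  have /compact_bounded[C [_ hC]] : compact ((fun y => lyapunov A X sigma Delta y (X y)) @` K).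
    by apply: continuous_compact => //; exact: continuous_subspaceT.
  apply: (bounded_convex_touching fc (C := C + 1)) => t.
    by apply: (hC (C + 1)); [lra|exists (phi t p)].
  have Xn : X (phi t p) != 0.
    apply: contra_neq Xp => e0.
    by rewrite -(flowK complX t p); exact: (field0_orbit complX).
  have [m0 [m1 [m2 [d0 d1 m2p m00 le]]]] :=
    lyapunov_touching complX symp h_smooth hamX lagr mono (neg _ (oK' t)) Xn.
  exists m0, m1, m2; split => //; first by rewrite m00 /f add0r.
  apply: filterS le => s; rewrite (tmap_field complX) /f (flowD complX).
  exact.
have hyp := hyperbolic_equilibrium complX symp h_smooth hamX lagr mono (neg _ Ky) (zero _ oy).
exists y; split => //; last exact: zero.
exact: (converges_to_isolated_equilibrium hausM complX oy zero (hyperbolic_unit hyp)).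
Qed.
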